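(* Let $L=L_N$ be a sequence of real numbers such that $L_N\to\infty$ and $L_N=o(N)$ as $N\to\infty$. For each $N$ let $U$ be drawn from $U(N)$ with respect to the Haar measure, and let $P=P_U$ be its characteristic polynomial. Then the random vector $$\left(\Re\left[\frac LN\cdot\frac{P'}{P}\left(1-\frac LN\right)\right],\ \Im\left[\frac LN\cdot\frac{P'}{P}\left(1-\frac LN\right)\right]\right)$$ converges in distribution, as $N\to\infty$, to a normal vector $(G,H)$, where $G$ and $H$ are independent real normal random variables, each with mean $0$ and variance $1/8$.
   Context: $U(N)$ is the group of $N\times N$ unitary matrices equipped with its Haar probability measure. For $U\in U(N)$, $P=P_U$ is its characteristic polynomial, $P(z)=\prod_{j=1}^N(z-z_j)$, where $z_1,\dots,z_N$ are the eigenvalues of $U$ with multiplicity. $\frac{P'}{P}(z)=P'(z)/P(z)=\sum_{j=1}^N\frac1{z-z_j}$ is the logarithmic derivative. *)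

(* Defs.v *)
From HB Require Import structures.
From mathcomp Require Import all_boot all_order all_algebra.
From mathcomp Require Import complex.
From mathcomp Require Import all_classical all_reals all_analysis.

Set Implicit Arguments.
Unset Strict Implicit.
Unset Printing Implicit Defensive.

Import Order.TTheory GRing.Theory Num.Theory.
Import numFieldNormedType.Exports.

Local Open Scope classical_set_scope.
Local Open Scope sesquilinear_scope.
Local Open Scope complex_scope.
Local Open Scope ring_scope.

(* The norm topology: R[i]^o carries the one of the modulus, R[i] has none in
   the library. *)
HB.instance Definition _ (R : realType) :=
  PseudoPointedMetric.copy R[i] (R[i])^o.

Definition unitary_group (R : realType) (n : nat) :=
  {M : 'M[R[i]]_n | M \is unitarymx}.

Section unitary_group.
Variables (R : realType) (n : nat).
Local Notation U := (unitary_group R n).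

HB.instance Definition _ := SubChoice.on U.

Lemma unitarymx1 : (1%:M : 'M[R[i]]_n) \is unitarymx.
Proof. by apply/unitarymxP; rewrite trmx1 map_mx1 mulmx1. Qed.

Lemma unitarymx_inv (M : U) : (val M)^t* \is unitarymx.
Proof. by rewrite trmxC_unitary; exact: valP. Qed.

Definition unitary_one : U := Sub 1%:M unitarymx1.
Definition unitary_mul (M N : U) : U :=
  Sub (val M *m val N) (mul_unitarymx (valP M) (valP N)).
Definition unitary_inv (M : U) : U := Sub ((val M)^t*) (unitarymx_inv M).

Lemma unitary_mulA : associative unitary_mul.
Proof. by move=> A B C; apply: val_inj; rewrite !SubK mulmxA. Qed.
Lemma unitary_mul1g : left_id unitary_one unitary_mul.
Proof. by move=> A; apply: val_inj; rewrite !SubK mul1mx. Qed.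
Lemma unitary_mulg1 : right_id unitary_one unitary_mul.
Proof. by move=> A; apply: val_inj; rewrite !SubK mulmx1. Qed.
Lemma unitary_mulgV : right_inverse unitary_one unitary_inv unitary_mul.
Proof. by move=> A; apply: val_inj; rewrite !SubK; exact/unitarymxP/valP. Qed.
Lemma unitary_mulVg : left_inverse unitary_one unitary_inv unitary_mul.
Proof.
by move=> A; apply: val_inj; rewrite !SubK; exact/mulmx1C/unitarymxP/valP.
Qed.

HB.instance Definition _ := isGroup.Build U unitary_mulA unitary_mul1g
  unitary_mulg1 unitary_mulVg unitary_mulgV.

HB.instance Definition _ := isPointed.Build U unitary_one.
HB.instance Definition _ := Topological.copy U
  (initial_topology (val : U -> 'M[R[i]]_n)).

HB.instance Definition _ := Measurable.copy U (g_sigma_algebraType (@open U)).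

End unitary_group.

(* A left-invariant Borel probability measure on a compact group is unique, and
   also right-invariant. *)
Definition haar (R : realType) (n : nat)
    (mu : probability (unitary_group R n) R) : Prop :=
  forall (V : unitary_group R n) (A : set (unitary_group R n)),
    measurable A -> mu [set (V * W)%g | W in A] = mu A.

Definition logderiv (F : fieldType) (p : {poly F}) (z : F) : F :=
  p^`().[z] / p.[z].

(* Laws are compared on measurable sets only: a [probability] takes junk values
   elsewhere.  The second parameter of [normal_prob] is the standard
   deviation. *)
Definition normal_rv d (T : measurableType d) (R : realType)
    (P : probability T R) (X : {RV P >-> R}) (m v : R) : Prop :=
  forall A : set R, measurable A ->
    distribution P X A = normal_prob m (Num.sqrt v) A.

Definition independent_rv d (T : measurableType d) (R : realType)
    (P : probability T R) (X Y : {RV P >-> R}) : Prop :=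
  forall A B : set R, measurable A -> measurable B ->
    P (X @^-1` A `&` Y @^-1` B) = (P (X @^-1` A) * P (Y @^-1` B))%E.

(* Measurability is required because the integral of a non-measurable function
   has a junk value. *)
Definition cvg_in_distribution (R : realType)
    (d_ : nat -> measure_display) (T_ : forall n, measurableType (d_ n))
    (P_ : forall n, probability (T_ n) R) (X_ : forall n, T_ n -> R * R)
    d (T : measurableType d) (P : probability T R) (X : T -> R * R) : Prop :=
  [/\ forall n, measurable_fun [set: T_ n] (X_ n),
      measurable_fun [set: T] X
    & forall f : R * R -> R, continuous f ->
        (exists M : R, forall x, `|f x| <= M) ->
        ('E_(P_ n)[f \o X_ n] @[n --> \oo] --> 'E_P[f \o X])%E].

(* Main.v *)
(** Let [r = 1 - L/N], [R = (1 - rU)^-1] and [V = Tr R - N]; the scaled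
    logarithmic derivative is [- (L / (N r)) * conj V].  Invariance of the Haar
    measure under [U |-> exp(itQ) U], [Q] an orthogonal projector, means that
    gradients have mean zero; applied to traces of products of [R] and [R^*],
    together with the Ward identity [R + R^* - 1 = (1 - r^2) R R^*], this bounds
    the second moments of [V] and of [Tr R^2 - Tr R], and then shows that every
    real linear form [th] of the scaled logarithmic derivative satisfies Stein's
    equation up to an error [O(1/L)]: [E (th sin(t th + a)) = t c E (cos(t th +
    a)) + O(1/L)].  Integrating it in [t] gives the limit of the characteristic
    functions.  As the second moments stay bounded, weak convergence follows
    once a bounded continuous function of [(x, y)] is approximated by
    trigonometric polynomials up to [e + C (x^2 + y^2) / M^2]. *)

Require Import Defs.
From HB Require Import structures.
From mathcomp Require Import all_boot all_order all_algebra.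
From mathcomp Require Import complex.
From mathcomp Require Import all_classical all_reals all_analysis.
From mathcomp Require Import measurable_realfun.
From mathcomp Require Import ring lra.

Set Implicit Arguments.
Unset Strict Implicit.
Unset Printing Implicit Defensive.

Import Order.TTheory GRing.Theory Num.Theory.
Import numFieldNormedType.Exports.

Local Open Scope classical_set_scope.
Local Open Scope sesquilinear_scope.
Local Open Scope complex_scope.
Local Open Scope ring_scope.

(** * Expectations of bounded functions *)

(** Projectors serve as directions because [exp(itQ) = 1 + (e^(it) - 1) Q] needs no matrix
    exponential, and they span all matrices, so no direction is lost.

    With [k = 1 - r^2], about [2L/N], and [K = 1/k], the squared Hilbert-Schmidt norm [hs] of the
    resolvent is of order [N K], [V] of order [K] and [Tr R^2 - Tr R] of order [K^2]. The loop
    equations contain [Tr R = N + V] as a factor: dividing by [N] isolates the wanted mean, but the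
    equations for second moments then contain cubic terms. The Ward identity, in the form
    [2 Re Tr R = N + k hs], gives these terms a sign or makes them absorbable. In Stein's equation
    the quadratic remainder has mean [O(K^2)] and a prefactor of order [k / N], which leaves
    [K / N], at most [1/L].

    For the linear form with coefficients [x], [y] one takes [a = - (x + iy) / 2]. The constant in
    Stein's equation is then [2 |a|^2 / (1 + r)^2], which tends to [|a|^2 / 2 = (x^2 + y^2) / 8]:
    this gives both the variance [1/8] and the independence. *)

Section bounded_expectation.
Context d (T : measurableType d) (R : realType) (P : probability T R).
Implicit Types f g : T -> R.

(** For fixed [n] and [r < 1] the resolvent is bounded, hence so is every integrand on the group.
    Integrability then follows from closure rules, and the value of [M] is not tracked. *)
Definition bounded_measurable f :=
  measurable_fun [set: T] f /\ exists M : R, forall x, `|f x| <= M.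

Definition expect f : R := \int[P]_x f x.

Lemma integrable_bounded f : bounded_measurable f ->
  P.-integrable setT (EFin \o f).
Proof.
move=> [mf [M bM]]; apply: measurable_bounded_integrable => //.
  by apply: le_lt_trans (probability_le1 P measurableT) _; rewrite ltry.
exists M; split=> [|N MN x _]; [exact: num_real|exact: le_trans (bM x) (ltW MN)].
Qed.

Lemma bounded_measurable_cst c : bounded_measurable (fun=> c).
Proof. by split; [exact: measurable_cst|exists `|c|]. Qed.

Lemma bounded_measurableD f g : bounded_measurable f -> bounded_measurable g ->
  bounded_measurable (fun x => f x + g x).
Proof.
move=> [mf [M bM]] [mg [N bN]]; split; first exact: measurable_funD.
exists (M + N) => x; apply: le_trans (ler_normD _ _) _.
by rewrite lerD.
Qed.

Lemma bounded_measurableN f : bounded_measurable f ->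
  bounded_measurable (fun x => - f x).
Proof.
move=> [mf [M bM]]; split; first exact: measurable_funN.
by exists M => x; rewrite normrN.
Qed.

Lemma bounded_measurableM f g : bounded_measurable f -> bounded_measurable g ->
  bounded_measurable (fun x => f x * g x).
Proof.
move=> [mf [M bM]] [mg [N bN]]; split; first exact: measurable_funM.
by exists (M * N) => x; rewrite normrM ler_pM.
Qed.

Lemma bounded_measurableX f n : bounded_measurable f ->
  bounded_measurable (fun x => f x ^+ n).
Proof.
move=> bf; elim: n => [|n IH]; first exact: bounded_measurable_cst.
by under eq_fun do rewrite exprS; exact: bounded_measurableM.
Qed.

Lemma bounded_measurable_comp (h : R -> R) f : measurable_fun setT f ->
  continuous h -> (forall x, `|h x| <= 1) -> bounded_measurable (h \o f).
Proof.
move=> mf ch bh; split; last by exists 1 => x; exact: bh.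
by apply: measurableT_comp => //; exact: continuous_measurable_fun.
Qed.

Lemma expect_cst c : expect (fun=> c) = c.
Proof.
rewrite /expect Rintegral_cst//; transitivity (c * 1); last exact: mulr1.
by congr (c * _); exact: (congr1 fine (probability_setT P)).
Qed.

Lemma expectD f g : bounded_measurable f -> bounded_measurable g ->
  expect (fun x => f x + g x) = expect f + expect g.
Proof. by move=> bf bg; rewrite /expect RintegralD//; exact: integrable_bounded. Qed.

Lemma expectZ c f : bounded_measurable f ->
  expect (fun x => c * f x) = c * expect f.
Proof. by move=> bf; rewrite /expect RintegralZl//; exact: integrable_bounded. Qed.

Lemma expectN f : bounded_measurable f -> expect (fun x => - f x) = - expect f.
Proof.
move=> bf; rewrite -mulN1r -expectZ//; congr expect.
by apply/funext => x; rewrite mulN1r.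
Qed.

Lemma expectB f g : bounded_measurable f -> bounded_measurable g ->
  expect (fun x => f x - g x) = expect f - expect g.
Proof.
by move=> bf bg; rewrite expectD ?expectN//; exact: bounded_measurableN.
Qed.

Lemma le_expect f g : bounded_measurable f -> bounded_measurable g ->
  (forall x, f x <= g x) -> expect f <= expect g.
Proof.
by move=> bf bg fg; apply: le_Rintegral => //; exact: integrable_bounded.
Qed.

Lemma normr_expect_le f g : bounded_measurable f -> bounded_measurable g ->
  (forall x, `|f x| <= g x) -> `|expect f| <= expect g.
Proof.
move=> bf bg fg; rewrite ler_norml -expectN//.
have fgx x : - g x <= f x <= g x by rewrite -ler_norml.
apply/andP; split; apply: le_expect => //; try exact: bounded_measurableN.
- by move=> x; case/andP: (fgx x).
- by move=> x; case/andP: (fgx x).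
Qed.

Lemma expectE f : bounded_measurable f -> ('E_P[f] = (expect f)%:E)%E.
Proof.
move=> bf; rewrite unlock /expect /Rintegral fineK//.
by apply: integrable_fin_num => //; exact: integrable_bounded.
Qed.

End bounded_expectation.

(** * Complex-valued measurable functions and their expectations *)

Section complex_measurable.
Context d (T : measurableType d) (R : realType).
Implicit Types f g : T -> R[i].

Definition cmeasurable f :=
  measurable_fun [set: T] (fun x => complex.Re (f x)) /\
  measurable_fun [set: T] (fun x => complex.Im (f x)).

Lemma ReM (x y : R[i]) : complex.Re (x * y) =
  complex.Re x * complex.Re y - complex.Im x * complex.Im y.
Proof. by case: x; case: y. Qed.

Lemma ImM (x y : R[i]) : complex.Im (x * y) =
  complex.Re x * complex.Im y + complex.Im x * complex.Re y.
Proof. by case: x; case: y. Qed.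

Lemma ReD (x y : R[i]) : complex.Re (x + y) = complex.Re x + complex.Re y.
Proof. by case: x; case: y. Qed.

Lemma ImD (x y : R[i]) : complex.Im (x + y) = complex.Im x + complex.Im y.
Proof. by case: x; case: y. Qed.

Lemma ReN (x : R[i]) : complex.Re (- x) = - complex.Re x.
Proof. by case: x. Qed.

Lemma ImN (x : R[i]) : complex.Im (- x) = - complex.Im x.
Proof. by case: x. Qed.

Lemma ReC (x : R[i]) : complex.Re (Num.conj x) = complex.Re x.
Proof. by case: x. Qed.

Lemma ImC (x : R[i]) : complex.Im (Num.conj x) = - complex.Im x.
Proof. by case: x. Qed.

(** The squared modulus as an element of [R], where [lra] and [nra] apply. *)
Definition sqn (z : R[i]) : R := complex.Re z ^+ 2 + complex.Im z ^+ 2.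

Lemma sqn_ge0 z : 0 <= sqn z.
Proof. by rewrite addr_ge0 ?sqr_ge0. Qed.

(** Inversion is continuous off [0]; the point [0] is split off as a measurable set. *)
Lemma measurable_invr : measurable_fun [set: R] (@GRing.inv R).
Proof.
have -> : [set: R] = [set 0] `|` [set~ 0] by rewrite setUv.
apply/measurable_funU => //; first exact: measurableC.
split; first exact: measurable_fun_set1.
apply: open_continuous_measurable_fun.
  by apply: closed_openC; exact: closed_eq.
by move=> x /set_mem /eqP x0; exact: inv_continuous.
Qed.

Lemma cmeasurable_cst c : cmeasurable (fun=> c).
Proof. by split; exact: measurable_cst. Qed.

Lemma cmeasurable_conj f : cmeasurable f ->
  cmeasurable (fun x => Num.conj (f x)).
Proof.
move=> [rf jf]; split; first by under eq_fun do rewrite ReC.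
by under eq_fun do rewrite ImC; exact: measurable_funN.
Qed.

Lemma cmeasurableN f : cmeasurable f -> cmeasurable (fun x => - f x).
Proof.
move=> [rf jf]; split.
  by under eq_fun do rewrite ReN; exact: measurable_funN.
by under eq_fun do rewrite ImN; exact: measurable_funN.
Qed.

Lemma cmeasurableD f g : cmeasurable f -> cmeasurable g ->
  cmeasurable (fun x => f x + g x).
Proof.
move=> [rf jf] [rg jg]; split.
  by under eq_fun do rewrite ReD; exact: measurable_funD.
by under eq_fun do rewrite ImD; exact: measurable_funD.
Qed.

Lemma cmeasurableM f g : cmeasurable f -> cmeasurable g ->
  cmeasurable (fun x => f x * g x).
Proof.
move=> [rf jf] [rg jg]; split.
  by under eq_fun do rewrite ReM; apply: measurable_funB; exact: measurable_funM.
by under eq_fun do rewrite ImM; apply: measurable_funD; exact: measurable_funM.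
Qed.

Lemma cmeasurableV f : cmeasurable f -> cmeasurable (fun x => (f x)^-1).
Proof.
move=> [rf jf].
have m2 : measurable_fun [set: T] (fun x => (sqn (f x))^-1).
  apply: (measurableT_comp measurable_invr).
  by apply: measurable_funD; exact: measurable_funX.
have invE (z : R[i]) : complex.Re z^-1 = complex.Re z * (sqn z)^-1 /\
    complex.Im z^-1 = - complex.Im z * (sqn z)^-1.
  by case: z => a b; rewrite /= mulNr.
split.
  under eq_fun do rewrite (invE _).1; exact: measurable_funM.
under eq_fun do rewrite (invE _).2; apply: measurable_funM => //.
exact: measurable_funN.
Qed.

Lemma cmeasurable_sum (I : Type) (s : seq I) (F : I -> T -> R[i]) :
  (forall i, cmeasurable (F i)) -> cmeasurable (fun x => \sum_(i <- s) F i x).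
Proof.
move=> mF; elim: s => [|i s IH].
  by under eq_fun do rewrite big_nil; exact: cmeasurable_cst.
by under eq_fun do rewrite big_cons; exact: cmeasurableD.
Qed.

Lemma cmeasurable_prod (I : Type) (s : seq I) (F : I -> T -> R[i]) :
  (forall i, cmeasurable (F i)) -> cmeasurable (fun x => \prod_(i <- s) F i x).
Proof.
move=> mF; elim: s => [|i s IH].
  by under eq_fun do rewrite big_nil; exact: cmeasurable_cst.
by under eq_fun do rewrite big_cons; exact: cmeasurableM.
Qed.

(** By Cramer's rule this covers the entries of the resolvent. *)
Lemma cmeasurable_det n (A : T -> 'M[R[i]]_n) :
  (forall i j, cmeasurable (fun x => A x i j)) ->
  cmeasurable (fun x => \det (A x)).
Proof.
move=> mA; apply: cmeasurable_sum => s; apply: cmeasurableM.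
  exact: cmeasurable_cst.
exact: cmeasurable_prod.
Qed.

End complex_measurable.

Section complex_expectation.
Context d (T : measurableType d) (R : realType) (P : probability T R).
Implicit Types f g : T -> R[i].

Definition cbounded f := cmeasurable f /\ exists M : R, forall x, `|f x| <= M%:C.

Definition cexpect f : R[i] :=
  expect P (fun x => complex.Re (f x)) +i* expect P (fun x => complex.Im (f x)).

Lemma normr_Re (z : R[i]) : `|complex.Re z|%:C <= `|z|.
Proof. exact: normc_ge_Re. Qed.

Lemma normr_Im (z : R[i]) : `|complex.Im z|%:C <= `|z|.
Proof.
(* [Im z] is the real part of [- z i], which has the modulus of [z]. *)
have := normc_ge_Re (- (z * 'i%C)); rewrite ReN complex.ReiNIm opprK => /le_trans; apply.
by rewrite normrN normrM complexiE normCi mulr1.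
Qed.

Lemma normc_le_ReIm (z : R[i]) : `|z| <= (`|complex.Re z| + `|complex.Im z|)%:C.
Proof.
case: z => a b; rewrite {1}(_ : a +i* b = a%:C + 'i%C * b%:C); last by simpc.
apply: (le_trans (ler_normD _ _)); rewrite normrM complexiE normCi mul1r /=.
by rewrite !normc_def /= !expr0n !addr0 !sqrtr_sqr -rmorphD.
Qed.

Lemma cbounded_Re f : cbounded f -> bounded_measurable (fun x => complex.Re (f x)).
Proof.
move=> [[rf jf] [M bM]]; split=> //; exists M => x.
by rewrite -lecR; exact: le_trans (normr_Re _) _.
Qed.

Lemma cbounded_Im f : cbounded f -> bounded_measurable (fun x => complex.Im (f x)).
Proof.
move=> [[rf jf] [M bM]]; split=> //; exists M => x.
by rewrite -lecR; exact: le_trans (normr_Im _) _.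
Qed.

Lemma cboundedP f : bounded_measurable (fun x => complex.Re (f x)) ->
  bounded_measurable (fun x => complex.Im (f x)) -> cbounded f.
Proof.
move=> [mr [M bM]] [mi [N bN]]; split=> //; exists (M + N) => x.
by apply: le_trans (normc_le_ReIm _) _; rewrite lecR lerD.
Qed.

Lemma cbounded_cst c : cbounded (fun=> c).
Proof. by apply: cboundedP; exact: bounded_measurable_cst. Qed.

Lemma cbounded_real (f : T -> R) : bounded_measurable f ->
  cbounded (fun x => (f x)%:C).
Proof. by move=> bf; apply: cboundedP => //; exact: bounded_measurable_cst. Qed.

Lemma cboundedD f g : cbounded f -> cbounded g -> cbounded (fun x => f x + g x).
Proof.
move=> [mf [M bM]] [mg [N bN]]; split; first exact: cmeasurableD.
exists (M + N) => x; rewrite rmorphD; apply: le_trans (ler_normD _ _) _.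
by rewrite lerD.
Qed.

Lemma cboundedN f : cbounded f -> cbounded (fun x => - f x).
Proof.
move=> [mf [M bM]]; split; first exact: cmeasurableN.
by exists M => x; rewrite normrN.
Qed.

Lemma cboundedB f g : cbounded f -> cbounded g -> cbounded (fun x => f x - g x).
Proof. by move=> bf bg; apply: cboundedD => //; exact: cboundedN. Qed.

Lemma cboundedM f g : cbounded f -> cbounded g -> cbounded (fun x => f x * g x).
Proof.
move=> [mf [M bM]] [mg [N bN]]; split; first exact: cmeasurableM.
by exists (M * N) => x; rewrite normrM rmorphM ler_pM.
Qed.

Lemma cbounded_conj f : cbounded f -> cbounded (fun x => Num.conj (f x)).
Proof.
move=> [mf [M bM]]; split; first exact: cmeasurable_conj.
by exists M => x; rewrite norm_conjC.
Qed.

Lemma cbounded_sum (I : Type) (s : seq I) (F : I -> T -> R[i]) :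
  (forall i, cbounded (F i)) -> cbounded (fun x => \sum_(i <- s) F i x).
Proof.
move=> mF; elim: s => [|i s IH].
  by under eq_fun do rewrite big_nil; exact: cbounded_cst.
by under eq_fun do rewrite big_cons; exact: cboundedD.
Qed.

Lemma cexpect_cst c : cexpect (fun=> c) = c.
Proof. by case: c => a b; rewrite /cexpect !expect_cst. Qed.

Lemma cexpectD f g : cbounded f -> cbounded g ->
  cexpect (fun x => f x + g x) = cexpect f + cexpect g.
Proof.
move=> bf bg; rewrite /cexpect; under eq_fun do rewrite ReD.
under [X in _ +i* expect P X]eq_fun do rewrite ImD.
by rewrite !expectD//; [exact: cbounded_Im..|exact: cbounded_Re|exact: cbounded_Re].
Qed.

Lemma cexpectZ c f : cbounded f -> cexpect (fun x => c * f x) = c * cexpect f.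
Proof.
move=> bf; rewrite /cexpect; under eq_fun do rewrite ReM.
under [X in _ +i* expect P X]eq_fun do rewrite ImM.
have := cbounded_Re bf; have := cbounded_Im bf => bi br.
have h (k : R) (g' : T -> R) : bounded_measurable g' -> bounded_measurable (fun x : T => k * g' x).
  by move=> ?; apply: bounded_measurableM => //; exact: bounded_measurable_cst.
by case: c => a b /=; rewrite expectB ?expectD ?expectZ//; apply: h.
Qed.

Lemma cexpectN f : cbounded f -> cexpect (fun x => - f x) = - cexpect f.
Proof.
move=> bf; rewrite -mulN1r -cexpectZ//; congr cexpect.
by apply/funext => x; rewrite mulN1r.
Qed.

Lemma cexpectB f g : cbounded f -> cbounded g ->
  cexpect (fun x => f x - g x) = cexpect f - cexpect g.
Proof. by move=> bf bg; rewrite cexpectD ?cexpectN//; exact: cboundedN. Qed.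

Lemma cexpect_conj f : cbounded f ->
  cexpect (fun x => Num.conj (f x)) = Num.conj (cexpect f).
Proof.
move=> bf; rewrite /cexpect; under eq_fun do rewrite ReC.
under [X in _ +i* expect P X]eq_fun do rewrite ImC.
by rewrite expectN//; exact: cbounded_Im.
Qed.

Lemma cexpect_sum (I : Type) (s : seq I) (F : I -> T -> R[i]) :
  (forall i, cbounded (F i)) ->
  cexpect (fun x => \sum_(i <- s) F i x) = \sum_(i <- s) cexpect (F i).
Proof.
move=> mF; elim: s => [|i s IH].
  by under eq_fun do rewrite big_nil; rewrite big_nil cexpect_cst.
under eq_fun do rewrite big_cons; rewrite big_cons cexpectD ?IH//.
exact: cbounded_sum.
Qed.

(** Real and imaginary parts are bounded separately, hence the factor 2; only the order in [M]
    matters later. *)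
Lemma cexpect_norm_le f (M : R) : cbounded f -> (forall x, `|f x| <= M%:C) ->
  `|cexpect f| <= (2 * M)%:C.
Proof.
move=> bf fM; apply: le_trans (normc_le_ReIm _) _; rewrite lecR /=.
rewrite mulr2n mulrDl !mul1r lerD// -[leRHS](expect_cst P);
  apply: normr_expect_le; try exact: bounded_measurable_cst.
- exact: cbounded_Re.
- by move=> x; rewrite -lecR; exact: le_trans (normr_Re _) _.
- exact: cbounded_Im.
- by move=> x; rewrite -lecR; exact: le_trans (normr_Im _) _.
Qed.

End complex_expectation.

(** * Haar measure *)

Section unitary_measurable.
Variables (R : realType) (n : nat).
Local Notation G := (unitary_group R n).

Lemma Re_continuous : continuous (fun z : R[i] => complex.Re z).
Proof.
move=> z A /nbhs_ballP[e /= e0 sub]; apply/nbhs_ballP.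
exists e%:C; first by rewrite /= ltcR.
move=> y /= zy; apply: sub; rewrite /ball/= -ltcR; apply: le_lt_trans zy.
by rewrite -ReN -ReD normr_Re.
Qed.

Lemma Im_continuous : continuous (fun z : R[i] => complex.Im z).
Proof.
move=> z A /nbhs_ballP[e /= e0 sub]; apply/nbhs_ballP.
exists e%:C; first by rewrite /= ltcR.
move=> y /= zy; apply: sub; rewrite /ball/= -ltcR; apply: le_lt_trans zy.
by rewrite -ImN -ImD normr_Im.
Qed.

Lemma continuous_unitary_measurable (f : G -> R) :
  continuous f -> measurable_fun [set: G] f.
Proof.
move=> cf; apply: (measurability (RGenOpens.G (R:=R))).
  exact: RGenOpens.measurableE.
move=> _ [A [a [b ->] <-]]; rewrite setTI.
apply: sub_sigma_algebra; move/continuousP: cf; apply.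
exact: interval_open.
Qed.

Lemma continuous_entry (i j : 'I_n) : continuous (fun U : G => val U i j).
Proof.
move=> U; apply: (@continuous_comp _ _ _ (val : G -> 'M[R[i]]_n)
  (fun M : 'M[R[i]]_n => M i j)); first exact: initial_continuous.
exact: coord_continuous.
Qed.

Lemma cmeasurable_entry (i j : 'I_n) : cmeasurable (fun U : G => val U i j).
Proof.
split; apply: continuous_unitary_measurable => U.
- apply: (@continuous_comp _ _ _ (fun U : G => val U i j) (@complex.Re R)).
    exact: continuous_entry.
  exact: Re_continuous.
- apply: (@continuous_comp _ _ _ (fun U : G => val U i j) (@complex.Im R)).
    exact: continuous_entry.
  exact: Im_continuous.
Qed.

Lemma continuous_mulmxl (V : 'M[R[i]]_n) :
  continuous (fun W : 'M[R[i]]_n => V *m W).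
Proof.
have c i j : continuous (fun W : 'M[R[i]]_n => (V *m W) i j).
  move=> W; under eq_fun do rewrite mxE.
  have -> : (fun x : 'M[R[i]]_n => \sum_k V i k * x k j) =
      \sum_k (fun x : 'M[R[i]]_n => V i k * x k j).
    by apply/funext => x; rewrite fct_sumE.
  have FF : Filter (nbhs W) := nbhs_filter W.
  apply: (big_ind2 (fun (f : 'M[R[i]]_n -> R[i]) a => f x @[x --> W] --> a)).
  - exact: (@cvg_cst _ (0 : R[i]) _ _ FF).
  - by move=> f a g b cf cg; exact: (@cvgD R[i] (R[i])^o _ _ FF f g a b cf cg).
  - by move=> k _; apply: (@cvgM _ _ _ FF); [exact: (@cvg_cst _ _ _ _ FF)|exact: coord_continuous].
move=> W A [B nB sBA].
have : nbhs W [set W' | forall i j, B i j ((V *m W') i j)].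
  have FF : Filter (nbhs W) := nbhs_filter W.
  apply: (@filter_forall _ _ _ _ FF) => i; apply: (@filter_forall _ _ _ _ FF) => j.
  exact: (c i j W _ (nB i j)).
by apply: filterS => W' BW'; exact: sBA.
Qed.

Lemma continuous_unitary_mul (V : G) : continuous (fun W : G => (V * W)%g).
Proof.
apply: continuous_comp_initial => W.
apply: (@continuous_comp _ _ _ (val : G -> 'M[R[i]]_n)
  (fun W => val V *m W)); first exact: initial_continuous.
exact: continuous_mulmxl.
Qed.

Lemma measurable_unitary_mul (V : G) :
  measurable_fun [set: G] (fun W : G => (V * W)%g).
Proof.
apply: (measurability (@open G)) => // _ [A oA <-]; rewrite setTI.
apply: sub_sigma_algebra; have /continuousP := @continuous_unitary_mul V.
exact.
Qed.

Variables (mu : probability G R) (mu_haar : haar mu).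

Lemma expect_haar (V : G) (f : G -> R) : bounded_measurable f ->
  expect mu (fun W => f (V * W)%g) = expect mu f.
Proof.
move=> bf; have mV := measurable_unitary_mul V.
have mf : measurable_fun setT (EFin \o f) by case: bf => ? _; exact/measurable_EFinP.
have bfV : bounded_measurable (fun W => f (V * W)%g).
  case: bf => mf' [M bM]; split; last by exists M.
  exact: (measurableT_comp mf' mV).
rewrite /expect /Rintegral; congr fine.
transitivity (\int[pushforward mu (fun W : G => (V * W)%g)]_x (f x)%:E)%E.
  rewrite integral_pushforward//.
  by rewrite preimage_setT; exact: (integrable_bounded mu bfV).
apply: eq_measure_integral => A mA _; rewrite /pushforward/=.
(* [haar] speaks of images: the preimage of [A] under multiplication by [V] is its image under
   multiplication by [V^-1]. *)
rewrite -(mu_haar (V^-1)%g mA); congr (mu _); apply/seteqP; split=> W /=.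
  by move=> AW; exists (V * W)%g => //; rewrite mulgA mulVg mul1g.
by move=> [W' AW' <-]; rewrite mulgA mulgV mul1g.
Qed.

Lemma cexpect_haar (V : G) (f : G -> R[i]) : cbounded f ->
  cexpect mu (fun W => f (V * W)%g) = cexpect mu f.
Proof.
move=> bf; rewrite /cexpect.
by rewrite (@expect_haar V (fun W => complex.Re (f W))) ?(@expect_haar V (fun W => complex.Im (f W)))//;
  [exact: cbounded_Im|exact: cbounded_Re].
Qed.

End unitary_measurable.

(** * Trigonometric inequalities *)

Section trigonometric_bounds.
Variable R : realType.
Implicit Types x h : R.

Lemma MVT_pos (f df : R -> R) h : (forall x, is_derive x (1 : R) f (df x)) ->
  0 <= h -> exists2 c, 0 <= c <= h & f h - f 0 = df c * h.
Proof.
move=> fdf h0.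
have cf : {within `[0, h], continuous f}.
  apply: continuous_subspaceT => x.
  by apply/differentiable_continuous/derivable1_diffP/ex_derive; exact: fdf.
have [c] := MVT_segment h0 (fun x _ => fdf x) cf.
by rewrite in_itv/= subr0 => ch ->; exists c.
Qed.

Lemma normr_sin_le x : `|sin x| <= `|x|.
Proof.
wlog x0 : x / 0 <= x => [H|].
  have [/H//|/ltW x0] := leP 0 x.
  by rewrite -normrN -sinN -(normrN x); apply: H; rewrite oppr_ge0.
have [c _] := MVT_pos (fun x => is_derive_sin x) x0.
rewrite sin0 subr0 => ->; rewrite normrM ler_piMl//.
exact: cos_max.
Qed.

Lemma cos_quadratic x : `|cos x - 1| <= x ^+ 2.
Proof.
have -> : cos x - 1 = - (sin (x / 2) ^+ 2 *+ 2).
  by rewrite {1}[x]splitr -mulr2n cos_mulr2n cos2sin2; ring.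
rewrite normrN ger0_norm ?mulrn_wge0 ?sqr_ge0//.
have : sin (x / 2) ^+ 2 <= (x / 2) ^+ 2.
  by rewrite -real_normK ?num_real// -[leRHS]real_normK ?num_real//
    ler_sqr ?nnegrE// normr_sin_le.
nra.
Qed.

Lemma sin_quadratic x : `|sin x - x| <= x ^+ 2.
Proof.
wlog x0 : x / 0 <= x => [H|].
  have [/H//|/ltW x0] := leP 0 x.
  rewrite -normrN opprD -sinN -(sqrrN x); apply: H; rewrite oppr_ge0//.
have df z : is_derive z (1 : R) (fun x => sin x - x) (cos z - 1).
  by apply: is_deriveB.
have [c /andP[c0 cx]] := MVT_pos df x0.
rewrite sin0 !subr0 => ->; rewrite normrM (ger0_norm x0) expr2 ler_wpM2r//.
apply: le_trans cx; have := cos_quadratic c; have := cos_le1 c.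
have := cos_geN1 c; move=> a b; rewrite ler0_norm ?subr_le0// opprB => H.
(* What remains is [1 - cos c <= c]. For [c <= 1] it follows from the quadratic bound, otherwise
   from [2 sin(c/2)^2 <= 2 |sin(c/2)| <= c]. *)
have [c1|/ltW c1] := leP c 1; first by nra.
have -> : cos c = 1 - sin (c / 2) ^+ 2 *+ 2.
  by rewrite {1}[c]splitr -mulr2n cos_mulr2n cos2sin2; ring.
have := normr_sin_le (c / 2); rewrite (@ger0_norm _ (c / 2)) ?divr_ge0//.
have := sin_max (c / 2); set s := sin _; rewrite -(real_normK (num_real s)).
have := normr_ge0 s; set t := `|s|; nra.
Qed.

Lemma sin_taylor x h : `|sin (x + h) - sin x - cos x * h| <= 2 * h ^+ 2.
Proof.
rewrite sinD (_ : _ - _ = sin x * (cos h - 1) + cos x * (sin h - h)); last by ring.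
apply: le_trans (ler_normD _ _) _; rewrite !normrM.
have := sin_max x; have := cos_max x; have := cos_quadratic h.
have := sin_quadratic h; have := normr_ge0 (sin x); have := normr_ge0 (cos x).
have := normr_ge0 (sin h - h); have := normr_ge0 (cos h - 1).
set a := `|sin x|; set b := `|cos x|; set c := `|_ - 1|; set e := `|_ - h|.
nra.
Qed.

Lemma cos_taylor x h : `|cos (x + h) - cos x + sin x * h| <= 2 * h ^+ 2.
Proof.
have := sin_taylor (x + pi / 2) h.
by rewrite (addrAC x) !sinDpihalf cosDpihalf mulNr opprK.
Qed.

End trigonometric_bounds.

Section unit_complex.
Variable R : realType.

Definition cis (t : R) : R[i] := cos t +i* sin t.

Lemma cis_unit t : cis t * Num.conj (cis t) = 1.
Proof.
rewrite /cis; apply/eqP; rewrite eq_complex /=; apply/andP; split; apply/eqP.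
  by rewrite mulrN opprK -!expr2 cos2Dsin2.
by ring.
Qed.

Lemma cis_taylor t : `|cis t - 1 - t%:C * 'i%C| <= (2 * t ^+ 2)%:C.
Proof.
apply: le_trans (normc_le_ReIm _) _; rewrite lecR /=.
have := cos_quadratic t; have := sin_quadratic t.
rewrite !(mul0r, mulr0, mulr1, subr0, addr0, oppr0); lra.
Qed.

End unit_complex.

Lemma conj_real (R : realType) (x : R) : Num.conj (x%:C) = x%:C.
Proof. by apply/eqP; rewrite eq_complex ReC ImC /= oppr0 !eqxx. Qed.

Lemma conjD (R : realType) (x y : R[i]) :
  Num.conj (x + y) = Num.conj x + Num.conj y.
Proof. exact: rmorphD. Qed.

Lemma conjB (R : realType) (x y : R[i]) :
  Num.conj (x - y) = Num.conj x - Num.conj y.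
Proof. exact: rmorphB. Qed.

Lemma conjM (R : realType) (x y : R[i]) :
  Num.conj (x * y) = Num.conj x * Num.conj y.
Proof. exact: rmorphM. Qed.

(** * Integration by parts on the unitary group *)

Section derivation.
Variables (R : realType) (n : nat).
Local Notation G := (unitary_group R n).
Implicit Types (f g Df Dg : G -> R[i]) (F : R -> G -> R[i]).

(** A one-sided [O(t^k)] at [0], uniform in the group element so that it survives integration. *)
Definition uniform_O (k : nat) F := exists M : R,
  forall t U, 0 <= t <= 1 -> `|F t U| <= (M * t ^+ k)%:C.

Lemma eq_uniform_O k F F' : (forall t U, F t U = F' t U) ->
  uniform_O k F -> uniform_O k F'.
Proof. by move=> FF' [M bF]; exists M => t U t01; rewrite -FF' bF. Qed.

Lemma uniform_OD k F F' : uniform_O k F -> uniform_O k F' ->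
  uniform_O k (fun t U => F t U + F' t U).
Proof.
move=> [M bF] [N bF']; exists (M + N) => t U t01.
apply: le_trans (ler_normD _ _) _; rewrite mulrDl rmorphD.
by rewrite lerD ?bF ?bF'.
Qed.

Lemma uniform_OM k l F F' : uniform_O k F -> uniform_O l F' ->
  uniform_O (k + l) (fun t U => F t U * F' t U).
Proof.
move=> [M bF] [N bF']; exists (M * N) => t U t01.
by rewrite normrM exprD mulrACA rmorphM ler_pM ?bF ?bF'.
Qed.

Lemma uniform_O_weaken k F : uniform_O k.+1 F -> uniform_O k F.
Proof.
move=> [M bF]; exists `|M| => t U t01; apply: le_trans (bF t U t01) _.
rewrite lecR; case/andP: t01 => t0 t1.
apply: (@le_trans _ _ (`|M| * t ^+ k.+1)).
  by rewrite ler_wpM2r ?exprn_ge0// ler_norm.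
by rewrite ler_wpM2l// exprS ler_piMl ?exprn_ge0.
Qed.

Lemma uniform_O_bounded f : cbounded f -> uniform_O 0 (fun _ => f).
Proof. by move=> [_ [M bM]]; exists M => t U _; rewrite expr0 mulr1. Qed.

Lemma uniform_O_time : uniform_O 1 (fun t _ => t%:C * 'i%C).
Proof.
exists 1 => t U /andP[t0 _]; rewrite expr1 mul1r normrM complexiE normCi mulr1.
by rewrite ger0_norm ?ler0c.
Qed.

Lemma uniform_O_conj k F : uniform_O k F ->
  uniform_O k (fun t U => Num.conj (F t U)).
Proof. by move=> [M bF]; exists M => t U t01; rewrite norm_conjC bF. Qed.

Lemma uniform_O_cis : uniform_O 2 (fun t _ => cis t - 1 - t%:C * 'i%C).
Proof. by exists 2 => t U _; exact: cis_taylor. Qed.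

Lemma uniform_O_cis1 : uniform_O 1 (fun t _ => cis t - 1).
Proof.
apply: (@eq_uniform_O _ (fun t _ => (cis t - 1 - t%:C * 'i%C) + t%:C * 'i%C)).
  by move=> t U; rewrite subrK.
apply: uniform_OD uniform_O_time; apply: uniform_O_weaken.
exact: uniform_O_cis.
Qed.

(* For such a [Q], [1 + (cis t - 1) *: Q] is [exp(itQ)]. *)
Definition projector (Q : 'M[R[i]]_n) := Q ^t* = Q /\ Q *m Q = Q.

Variables (Q : 'M[R[i]]_n) (hQ : projector Q).

Lemma curve_unitary t : 1%:M + (cis t - 1) *: Q \is unitarymx.
Proof.
apply/unitarymxP; rewrite linearD/= map_mxD linearZ/= map_mxZ trmx1 map_mx1.
rewrite hQ.1 mulmxDl !mulmxDr !mul1mx mulmx1 -scalemxAl -scalemxAr hQ.2.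
rewrite -addrA scalerA -!scalerDl rmorphB rmorph1.
rewrite [X in X *: Q](_ : _ = cis t * Num.conj (cis t) - 1); last first.
  by rewrite rmorph1; ring.
by rewrite cis_unit subrr scale0r addr0.
Qed.

Definition curve t : G := Sub (1%:M + (cis t - 1) *: Q) (curve_unitary t).

(** [Df] is the derivative along the curve divided by [i], which keeps [i] out of the gradients. As
    the remainder is uniformly quadratic, expectations can be differentiated without a limit
    theorem. *)
Definition deriv f Df := [/\ cbounded f, cbounded Df &
  uniform_O 2 (fun t U => f (curve t * U)%g - f U - t%:C * 'i%C * Df U)].

Lemma deriv_lipschitz f Df : deriv f Df ->
  uniform_O 1 (fun t U => f (curve t * U)%g - f U).
Proof.
move=> [bf bDf Of].
apply: (@eq_uniform_O _ (fun t U => (f (curve t * U)%g - f U -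
  t%:C * 'i%C * Df U) + t%:C * 'i%C * Df U)).
  by move=> t U; rewrite subrK.
apply: uniform_OD; first exact: uniform_O_weaken.
by apply: (@uniform_OM 1 0) uniform_O_time _; exact: uniform_O_bounded.
Qed.

Lemma eq_deriv f f' Df Df' : f =1 f' -> Df =1 Df' -> deriv f Df -> deriv f' Df'.
Proof. by move=> /funext -> /funext ->. Qed.

Lemma deriv_cst c : deriv (fun=> c) (fun=> 0).
Proof.
split; [exact: cbounded_cst..|]; exists 0 => t U _.
by rewrite mulr0 subrr subr0 normr0 mul0r.
Qed.

Lemma derivD f Df g Dg : deriv f Df -> deriv g Dg ->
  deriv (fun U => f U + g U) (fun U => Df U + Dg U).
Proof.
move=> [bf bDf Of] [bg bDg Og]; split; [exact: cboundedD..|].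
by apply: eq_uniform_O (uniform_OD Of Og) => t U; ring.
Qed.

Lemma derivM f Df g Dg : deriv f Df -> deriv g Dg ->
  deriv (fun U => f U * g U) (fun U => f U * Dg U + Df U * g U).
Proof.
move=> df dg; have lf := deriv_lipschitz df; have lg := deriv_lipschitz dg.
move: df dg => [bf bDf Of] [bg bDg Og]; split; first exact: cboundedM.
  by apply: cboundedD; exact: cboundedM.
(* The increment of a product is the product of the increments plus each factor times the increment
   of the other; the first term is quadratic because both factors are Lipschitz. *)
have O1 := @uniform_OM 0 2 _ _ (uniform_O_bounded bf) Og.
have O2 := @uniform_OM 0 2 _ _ (uniform_O_bounded bg) Of.
by apply: eq_uniform_O (uniform_OD (uniform_OM lf lg) (uniform_OD O1 O2)) => t U; ring.
Qed.

Lemma deriv_sum (I : Type) (s : seq I) (f Df : I -> G -> R[i]) :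
  (forall i, deriv (f i) (Df i)) ->
  deriv (fun U => \sum_(i <- s) f i U) (fun U => \sum_(i <- s) Df i U).
Proof.
move=> df; elim: s => [|i s IH].
  by apply: eq_deriv (deriv_cst 0) => U; rewrite big_nil.
by apply: eq_deriv (derivD (df i) IH) => U; rewrite big_cons.
Qed.

(* The increment [t i] of the curve is imaginary, whence the sign. *)
Lemma deriv_conj f Df : deriv f Df ->
  deriv (fun U => Num.conj (f U)) (fun U => - Num.conj (Df U)).
Proof.
move=> [bf bDf Of]; split; first exact: cbounded_conj.
  by apply: cboundedN; exact: cbounded_conj.
apply: eq_uniform_O (uniform_O_conj Of) => t U; rewrite !conjB !conjM conj_real.
by rewrite complexiE conjCi; ring.
Qed.

Lemma uniform_O_real k (F : R -> G -> R) M :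
  (forall t U, 0 <= t <= 1 -> `|F t U| <= M * t ^+ k) ->
  uniform_O k (fun t U => (F t U)%:C).
Proof.
move=> bF; exists M => t U t01.
apply: le_trans (normc_le_ReIm _) _; rewrite lecR/= normr0 addr0.
exact: bF.
Qed.

(** Stated for a pair [s], [c] so that sine and cosine share one proof of the chain rule. *)
Lemma deriv_comp (s c : R -> R) (th : G -> R) Dth : continuous s -> continuous c ->
  (forall x, `|s x| <= 1) -> (forall x, `|c x| <= 1) ->
  (forall x h, `|s (x + h) - s x - c x * h| <= 2 * h ^+ 2) ->
  deriv (fun U => (th U)%:C) Dth ->
  deriv (fun U => (s (th U))%:C) (fun U => (c (th U))%:C * Dth U).
Proof.
move=> cs cc bs bc taylor dth; have [M lth] := deriv_lipschitz dth.
move: dth => [bth bDth Oth].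
have mth : measurable_fun setT th by case: bth => -[].
have bcth : cbounded (fun U => (c (th U))%:C).
  by apply: cbounded_real; exact: (bounded_measurable_comp mth).
split.
- by apply: cbounded_real; exact: (bounded_measurable_comp mth).
- exact: cboundedM.
- pose F t U := s (th (curve t * U)%g) - s (th U) -
    c (th U) * (th (curve t * U)%g - th U).
  have OF : uniform_O 2 (fun t U => (F t U)%:C).
    apply: (@uniform_O_real _ _ (2 * M ^+ 2)) => t U t01.
    rewrite /F; have -> : th (curve t * U)%g =
      th U + (th (curve t * U)%g - th U) by ring.
    set h := _ - th U; rewrite (addrC (th U) h) addrK (addrC h).
    apply: le_trans (taylor _ _) _; rewrite -mulrA ler_wpM2l// -exprMn.
    have : `|h| <= M * t.
      have := lth t U t01; rewrite -rmorphB/= normc_def/= expr0n addr0 sqrtr_sqr.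
      by rewrite lecR expr1.
    by move=> hM; rewrite -(real_normK (num_real h)) lerXn2r ?nnegrE//; exact: le_trans hM.
  have O2 := @uniform_OM 0 2 _ _ (uniform_O_bounded bcth) Oth.
  apply: eq_uniform_O (uniform_OD OF O2) => t U; rewrite /F.
  by rewrite !(rmorphB, rmorphM)/=; ring.
Qed.

Lemma deriv_sin (th : G -> R) Dth : deriv (fun U => (th U)%:C) Dth ->
  deriv (fun U => (sin (th U))%:C) (fun U => (cos (th U))%:C * Dth U).
Proof.
apply: deriv_comp; [exact: continuous_sin|exact: continuous_cos|exact: sin_max|
  exact: cos_max|exact: sin_taylor].
Qed.

Lemma deriv_cos (th : G -> R) Dth : deriv (fun U => (th U)%:C) Dth ->
  deriv (fun U => (cos (th U))%:C) (fun U => (- sin (th U))%:C * Dth U).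
Proof.
apply: (@deriv_comp cos (fun x => - sin x)).
- exact: continuous_cos.
- by move=> x; apply: continuousN; exact: continuous_sin.
- exact: cos_max.
- by move=> x; rewrite normrN sin_max.
- by move=> x h; rewrite mulNr opprK cos_taylor.
Qed.

Variables (mu : probability G R) (mu_haar : haar mu).

(** By invariance the increment of [f] has mean zero, so [t |E Df|] is bounded by the mean of the
    remainder, of order [t^2]; divide by [t] and let it shrink. *)
Lemma cexpect_deriv f Df : deriv f Df -> cexpect mu Df = 0.
Proof.
move=> [bf bDf [M bM]]; apply/eqP/negPn/negP => E0.
have key t : 0 < t <= 1 -> `|cexpect mu Df| <= (2 * M * t)%:C.
  move=> /andP[t0 t1]; have t01 : 0 <= t <= 1 by rewrite t1 ltW.
  have bft : cbounded (fun U => f (curve t * U)%g).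
    case: bf => -[mr mi] [N bN]; split; last by exists N.
    by split; [exact: (measurableT_comp mr (measurable_unitary_mul _))|
               exact: (measurableT_comp mi (measurable_unitary_mul _))].
  have bD2 : cbounded (fun U => t%:C * 'i%C * Df U).
    by apply: cboundedM => //; exact: cbounded_cst.
  have := @cexpect_norm_le _ _ _ mu _ _ (cboundedB (cboundedB bft bf) bD2)
    (fun U => bM t U t01).
  rewrite cexpectB ?cexpectB//; last exact: cboundedB.
  rewrite (cexpect_haar mu_haar)// subrr sub0r normrN cexpectZ//.
  rewrite normrM normrM complexiE normCi mulr1.
  rewrite (@ger0_norm _ t%:C) ?ler0c ?(ltW t0)//.
  have -> : 2 * (M * t ^+ 2) = t * (2 * M * t) by ring.
  by rewrite [X in _ <= X]rmorphM ler_pM2l ?ltcR.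
pose e := complex.Re `|cexpect mu Df|.
have eE : `|cexpect mu Df| = e%:C.
  by rewrite /e normc_def.
have e0 : 0 < e by rewrite -ltcR -eE normr_gt0.
have M0 : 0 < 2 * M.
  have := key 1; rewrite ltr01 lexx mulr1 eE lecR => /(_ isT).
  exact: lt_le_trans.
(* Small enough that [2 * M * t] is at most [e / 2], whereas [key] demands that it be at least
   [e]. *)
pose t := Num.min 1 (e / (2 * M) / 2).
have t0 : 0 < t by rewrite lt_min ltr01/= !divr_gt0.
have := key t; rewrite t0 ge_min lexx /= => /(_ isT); rewrite eE lecR => h.
have : t <= e / (2 * M) / 2 by rewrite ge_min lexx orbT.
move/(ler_wpM2l (ltW M0)) => h2.
have := le_trans h h2; rewrite mulrA mulrCA divff ?gt_eqF// mulr1.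
by apply/negP; rewrite -ltNge; lra.
Qed.

End derivation.

(** * Gradients and the vanishing of their means *)

Section matrix_derivation.
Variables (R : realType) (n : nat).
Local Notation G := (unitary_group R n).
Implicit Types (A B DA DB : G -> 'M[R[i]]_n).

Definition mbounded A := forall i j, cbounded (fun U => A U i j).

Lemma mboundedM A B : mbounded A -> mbounded B -> mbounded (fun U => A U *m B U).
Proof.
move=> bA bB i j; under eq_fun do rewrite mxE.
by apply: cbounded_sum => k; exact: cboundedM.
Qed.

Lemma mboundedD A B : mbounded A -> mbounded B -> mbounded (fun U => A U + B U).
Proof.
by move=> bA bB i j; under eq_fun do rewrite mxE; exact: cboundedD.
Qed.

Lemma mboundedN A : mbounded A -> mbounded (fun U => - A U).
Proof. by move=> bA i j; under eq_fun do rewrite mxE; exact: cboundedN. Qed.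

Lemma mboundedB A B : mbounded A -> mbounded B -> mbounded (fun U => A U - B U).
Proof. by move=> bA bB; apply: mboundedD => //; exact: mboundedN. Qed.

Lemma mboundedZ (f : G -> R[i]) A : cbounded f -> mbounded A ->
  mbounded (fun U => f U *: A U).
Proof. by move=> bf bA i j; under eq_fun do rewrite mxE; exact: cboundedM. Qed.

Lemma mbounded_cst C : mbounded (fun=> C).
Proof. by move=> i j; exact: cbounded_cst. Qed.

Lemma mbounded_adj A : mbounded A -> mbounded (fun U => (A U)^t*).
Proof. by move=> bA i j; under eq_fun do rewrite !mxE; exact: cbounded_conj. Qed.

Lemma cbounded_tr A : mbounded A -> cbounded (fun U => \tr (A U)).
Proof. by move=> bA; apply: cbounded_sum. Qed.

Lemma cexpect_tr (mu : probability G R) A : mbounded A ->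
  cexpect mu (fun U => \tr (A U)) = \tr (\matrix_(i, j) cexpect mu (fun U => A U i j)).
Proof.
move=> bA; rewrite /mxtrace cexpect_sum//.
by apply: eq_bigr => i _; rewrite mxE.
Qed.

Section fixed_direction.
Variables (Q : 'M[R[i]]_n) (hQ : projector Q).

Definition mderiv (A DA : G -> 'M[R[i]]_n) := forall i j,
  deriv hQ (fun U => A U i j) (fun U => DA U i j).

Lemma mderivM A DA B DB : mderiv A DA -> mderiv B DB ->
  mderiv (fun U => A U *m B U) (fun U => A U *m DB U + DA U *m B U).
Proof.
move=> dA dB i j; apply: (@eq_deriv _ _ _ _
  (fun U => \sum_k A U i k * B U k j) _
  (fun U => \sum_k (A U i k * DB U k j + DA U i k * B U k j))).
- by move=> U; rewrite mxE.
- by move=> U; rewrite !mxE -big_split.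
- by apply: deriv_sum => k; exact: derivM.
Qed.

Lemma deriv_tr A DA : mderiv A DA ->
  deriv hQ (fun U => \tr (A U)) (fun U => \tr (DA U)).
Proof. by move=> dA; apply: deriv_sum. Qed.

End fixed_direction.

(** The derivative is linear in the direction [Q], so one matrix, paired with [Q] by the trace,
    encodes all directions. *)
Definition has_grad (f : G -> R[i]) (Gr : G -> 'M[R[i]]_n) := mbounded Gr /\
  forall Q (hQ : projector Q), deriv hQ f (fun U => \tr (Q *m Gr U)).

Lemma has_grad_eq f f' Gr Gr' : f =1 f' -> Gr =1 Gr' ->
  has_grad f Gr -> has_grad f' Gr'.
Proof. by move=> /funext -> /funext ->. Qed.

(** One projector has to be exhibited to read the boundedness of [f] off [has_grad], which contains
    it only inside [deriv]. *)
Lemma projector0 : projector (0 : 'M[R[i]]_n).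
Proof. by split; rewrite ?trmx0 ?map_mx0 ?mulmx0. Qed.

Lemma has_grad_cbounded f Gr : has_grad f Gr -> cbounded f.
Proof. by move=> [_ /(_ _ projector0)[]]. Qed.

Lemma has_grad_cst c : has_grad (fun=> c) (fun=> 0).
Proof.
split=> [|Q hQ]; first exact: mbounded_cst.
by apply: eq_deriv (deriv_cst hQ c) => // U; rewrite mulmx0 mxtrace0.
Qed.

Lemma has_gradD f Gf g Gg : has_grad f Gf -> has_grad g Gg ->
  has_grad (fun U => f U + g U) (fun U => Gf U + Gg U).
Proof.
move=> [bf df] [bg dg]; split=> [|Q hQ]; first exact: mboundedD.
by apply: eq_deriv (derivD (df _ hQ) (dg _ hQ)) => // U; rewrite mulmxDr mxtraceD.
Qed.

Lemma has_gradM f Gf g Gg : has_grad f Gf -> has_grad g Gg ->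
  has_grad (fun U => f U * g U) (fun U => f U *: Gg U + g U *: Gf U).
Proof.
move=> hf hg; have bf' := has_grad_cbounded hf; have bg' := has_grad_cbounded hg.
move: hf hg => [bf df] [bg dg]; split=> [|Q hQ].
  by apply: mboundedD; exact: mboundedZ.
apply: eq_deriv (derivM (df _ hQ) (dg _ hQ)) => // U.
by rewrite mulmxDr mxtraceD -!scalemxAr !mxtraceZ (mulrC (\tr _) (g U)).
Qed.

Lemma has_gradZ c f Gf : has_grad f Gf ->
  has_grad (fun U => c * f U) (fun U => c *: Gf U).
Proof.
move=> hf; apply: has_grad_eq (has_gradM (has_grad_cst c) hf) => // U.
by rewrite scaler0 addr0.
Qed.

Lemma has_gradN f Gf : has_grad f Gf -> has_grad (fun U => - f U) (fun U => - Gf U).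
Proof.
move=> hf; apply: has_grad_eq (has_gradZ (- 1) hf) => U; first exact: mulN1r.
exact: scaleN1r.
Qed.

Lemma has_gradB f Gf g Gg : has_grad f Gf -> has_grad g Gg ->
  has_grad (fun U => f U - g U) (fun U => Gf U - Gg U).
Proof. by move=> hf hg; apply: has_gradD => //; exact: has_gradN. Qed.

Lemma mxtrace_adj (A : 'M[R[i]]_n) : \tr (A^t*) = Num.conj (\tr A).
Proof. by rewrite /mxtrace raddf_sum; apply: eq_bigr => i _; rewrite !mxE. Qed.

Lemma adj_mul (A B : 'M[R[i]]_n) : (A *m B)^t* = B^t* *m A^t*.
Proof. by rewrite trmx_mul map_mxM. Qed.

Lemma has_grad_conj f Gf : has_grad f Gf ->
  has_grad (fun U => Num.conj (f U)) (fun U => - (Gf U)^t*).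
Proof.
move=> [bf df]; split=> [|Q hQ]; first by apply: mboundedN; exact: mbounded_adj.
apply: eq_deriv (deriv_conj (df _ hQ)) => // U.
(* Since [Q] is self-adjoint, conjugating [tr (Q X)] amounts to replacing [X] by its adjoint. *)
by rewrite mulmxN raddfN /= -mxtrace_adj adj_mul hQ.1 mxtrace_mulC.
Qed.

Lemma has_grad_sin (th : G -> R) Gt : has_grad (fun U => (th U)%:C) Gt ->
  has_grad (fun U => (sin (th U))%:C) (fun U => (cos (th U))%:C *: Gt U).
Proof.
move=> ht; have bt := has_grad_cbounded ht; move: ht => [bG dt].
have bc : cbounded (fun U => (cos (th U))%:C).
  apply: cbounded_real; apply: (@bounded_measurable_comp _ _ _ cos).
  - by case: bt => -[].
  - exact: continuous_cos.
  - exact: cos_max.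
split=> [|Q hQ]; first exact: mboundedZ.
by apply: eq_deriv (deriv_sin (dt _ hQ)) => // U; rewrite -scalemxAr mxtraceZ.
Qed.

Lemma has_grad_cos (th : G -> R) Gt : has_grad (fun U => (th U)%:C) Gt ->
  has_grad (fun U => (cos (th U))%:C) (fun U => (- sin (th U))%:C *: Gt U).
Proof.
move=> ht; have bt := has_grad_cbounded ht; move: ht => [bG dt].
have bc : cbounded (fun U => (- sin (th U))%:C).
  apply: cbounded_real; apply: bounded_measurableN.
  apply: (@bounded_measurable_comp _ _ _ sin).
  - by case: bt => -[].
  - exact: continuous_sin.
  - exact: sin_max.
split=> [|Q hQ]; first exact: mboundedZ.
by apply: eq_deriv (deriv_cos (dt _ hQ)) => // U; rewrite -scalemxAr mxtraceZ.
Qed.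

Lemma mxtrace_delta (A : 'M[R[i]]_n) i j : \tr (delta_mx i j *m A) = A j i.
Proof.
rewrite /mxtrace (bigD1 i)//= big1 => [|k ki].
  rewrite mxE (bigD1 j)//= big1 => [|k kj]; rewrite !mxE ?eqxx/=.
    by rewrite mul1r !addr0.
  by rewrite (negPf kj) mul0r.
by rewrite mxE big1 // => l _; rewrite !mxE (negPf ki) mul0r.
Qed.

(** For [i != j] and [|w| = 1], the orthogonal projector onto the line of [e_i + conj(w) e_j]. *)
Definition line_projector (w : R[i]) (i j : 'I_n) : 'M[R[i]]_n :=
  2^-1 *: (delta_mx i i + delta_mx j j + w *: delta_mx i j +
           Num.conj w *: delta_mx j i).

Lemma projector_delta i : projector (delta_mx i i : 'M[R[i]]_n).
Proof. by split; [rewrite trmx_delta map_delta_mx|rewrite mul_delta_mx]. Qed.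

Lemma line_projectorP w i j : i != j -> w * Num.conj w = 1 ->
  projector (line_projector w i j).
Proof.
move=> ij ww; split.
  apply/matrixP => k l; rewrite !mxE conjM !conjD !conjM conjCK !conjC_nat.
  rewrite (_ : Num.conj 2^-1 = 2^-1); last by rewrite fmorphV rmorph_nat.
  by rewrite ![(l == _) && _]andbC; ring.
rewrite /line_projector -scalemxAl -scalemxAr scalerA.
rewrite !(mulmxDl, mulmxDr) -!(scalemxAl, scalemxAr).
rewrite !mul_delta_mx_cond !eqxx (negPf ij) eq_sym (negPf ij) /= !mulr1n !mulr0n.
rewrite !(scaler0, addr0, add0r) !scalerA ww (mulrC (Num.conj w)) ww !scale1r.
set a := delta_mx i i; set b := delta_mx j j; set c := w *: _; set e := Num.conj w *: _.
rewrite [X in _ *: X](_ : _ = 2 *: (a + b + c + e)); last first.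
  by rewrite scaler_nat mulr2n; apply/matrixP => k l; rewrite !mxE; ring.
by rewrite scalerA -mulrA mulVf ?mulr1// pnatr_eq0.
Qed.

Variables (mu : probability G R) (mu_haar : haar mu).

(* The projectors [E_ii] and [line_projector w i j], [w = 1, i], span all
   matrices. *)
Lemma cexpect_grad f Gr : has_grad f Gr ->
  forall i j, cexpect mu (fun U => Gr U i j) = 0.
Proof.
move=> [bG dG]; set E := \matrix_(i, j) cexpect mu (fun U => Gr U i j).
have EQ Q : projector Q -> \tr (Q *m E) = 0.
  move=> hQ; rewrite -(cexpect_deriv mu_haar (dG _ hQ)).
  rewrite cexpect_tr; last by apply: mboundedM => //; exact: mbounded_cst.
  congr (\tr _); apply/matrixP => i j; rewrite !mxE.
  under [X in cexpect mu X]eq_fun do rewrite mxE.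
  rewrite cexpect_sum => [|k]; last by apply: cboundedM => //; exact: cbounded_cst.
  by apply: eq_bigr => k _; rewrite cexpectZ// mxE.
have Ed i : E i i = 0 by rewrite -mxtrace_delta EQ//; exact: projector_delta.
suff EE i j : E i j = 0 by move=> i j; have := EE i j; rewrite mxE.
have [->//|ij] := eqVneq i j.
have line w : w * Num.conj w = 1 -> w * E j i + Num.conj w * E i j = 0.
  move=> ww; have /EQ := line_projectorP ij ww.
  rewrite /line_projector -scalemxAl mxtraceZ !mulmxDl -!scalemxAl.
  rewrite !mxtraceD !mxtraceZ !mxtrace_delta !Ed !add0r => /eqP.
  by rewrite mulf_eq0 invr_eq0 pnatr_eq0/= => /eqP.
(* [w = 1] gives [E j i + E i j = 0], and [w = i] gives [E j i = E i j]. *)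
have := line 1; rewrite conjC1 mul1r !mul1r => /(_ erefl) e1.
have := line 'i; rewrite conjCi => /(_ _) e2.
have /e2 : 'i * - 'i = 1 :> R[i] by rewrite mulrN -expr2 sqrCi opprK.
rewrite mulNr -mulrBr => /eqP; rewrite mulf_eq0 (negPf (neq0Ci _))/= subr_eq0 => /eqP e3.
move: e1; rewrite e3 -mulr2n => /eqP; rewrite mulrn_eq0/= => /eqP.
by [].
Qed.

End matrix_derivation.

Lemma realCD (R : realType) (x y : R) : (x + y)%:C = x%:C + y%:C.
Proof. exact: rmorphD. Qed.

Lemma realCB (R : realType) (x y : R) : (x - y)%:C = x%:C - y%:C.
Proof. exact: rmorphB. Qed.

Lemma realCM (R : realType) (x y : R) : (x * y)%:C = x%:C * y%:C.
Proof. exact: rmorphM. Qed.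

Lemma realC_nat (R : realType) k : (k%:R : R)%:C = k%:R.
Proof. exact: rmorph_nat. Qed.

(** * Resolvent and loop equations *)

Section adjoint.
Variables (R : realType) (n : nat).
Implicit Types A B : 'M[R[i]]_n.

Lemma adjB A B : (A - B)^t* = A^t* - B^t*.
Proof. by apply/matrixP => i j; rewrite !mxE conjB. Qed.

Lemma adjZ c A : (c *: A)^t* = Num.conj c *: A^t*.
Proof. by apply/matrixP => i j; rewrite !mxE conjM. Qed.

Lemma adj1 : (1%:M : 'M[R[i]]_n)^t* = 1%:M.
Proof. by rewrite trmx1 map_mx1. Qed.

End adjoint.

Section resolvent.
Variables (R : realType) (n : nat) (r : R).
Hypotheses (r_gt0 : 0 < r) (r_lt1 : r < 1).
Local Notation G := (unitary_group R n).
Implicit Types U : G.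

(** [locked] keeps [invmx] from being unfolded in comparisons of terms. Apart from measurability,
    only the two inverse identities are used. *)
Definition resolvent U : 'M[R[i]]_n := locked (invmx (1%:M - r%:C *: val U)).

Lemma unitary_mulmxV U : val U *m (val U)^t* = 1%:M.
Proof. by apply/unitarymxP; exact: valP. Qed.

(** A row vector with [v = r v U] satisfies [|v|^2 = r^2 |v|^2], hence vanishes because [r < 1]. *)
Lemma resolvent_unit U : 1%:M - r%:C *: val U \in unitmx.
Proof.
rewrite -row_free_unit; apply: inj_row_free => v.
rewrite mulmxBr mulmx1 -scalemxAr => /eqP; rewrite subr_eq0 => /eqP vU.
have vv : v *m v^t* = (r ^+ 2)%:C *: (v *m v^t*).
  rewrite {1 2}vU linearZ/= map_mxZ -scalemxAl -scalemxAr scalerA.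
  rewrite trmx_mul map_mxM mulmxA -(mulmxA v) unitary_mulmxV mulmx1.
  by congr (_ *: _); rewrite expr2 rmorphM; congr (_ * _); exact: conj_real.
have r2 : 1 - (r ^+ 2)%:C != 0 :> R[i].
  rewrite -(rmorph1 (real_complex R)) -rmorphB fmorph_eq0.
  by apply/eqP => h; move: r_gt0 r_lt1; nra.
have v0 : \sum_j `|v 0 j| ^+ 2 = 0.
  have /matrixP/(_ 0 0) := vv; rewrite [RHS]mxE => /eqP.
  rewrite -subr_eq0 -{1}[X in X - _]mul1r -mulrBl mulf_eq0 (negPf r2) /= => /eqP.
  move=> h; apply: etrans h; rewrite mxE; apply: eq_bigr => j _; rewrite !mxE; exact: normCK.
apply/rowP => j; rewrite mxE.
have /psumr_eq0P := v0 => /(_ (fun j _ => exprn_ge0 _ (normr_ge0 _)))/(_ j isT).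
by move/eqP; rewrite expf_eq0/= normr_eq0 => /eqP.
Qed.

Lemma mulmx_resolvent U : (1%:M - r%:C *: val U) *m resolvent U = 1%:M.
Proof. by rewrite /resolvent -lock mulmxV// resolvent_unit. Qed.

Lemma resolvent_mulmx U : resolvent U *m (1%:M - r%:C *: val U) = 1%:M.
Proof. by rewrite /resolvent -lock mulVmx// resolvent_unit. Qed.

Lemma resolventE U : resolvent U - 1%:M = r%:C *: val U *m resolvent U.
Proof.
rewrite -[in LHS](mulmx_resolvent U).
by rewrite mulmxBl mul1mx opprB addrC subrK.
Qed.

Lemma resolventEr U : resolvent U - 1%:M = resolvent U *m (r%:C *: val U).
Proof.
rewrite -[in LHS](resolvent_mulmx U).
by rewrite mulmxBr mulmx1 opprB addrC subrK.
Qed.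

(** For [r = 1 - L/N] this is about [2L/N]; its inverse, called [K] below, is the scale of all
    moment bounds. *)
Definition ward_coef : R := 1 - r ^+ 2.

Lemma ward_coef_gt0 : 0 < ward_coef.
Proof. by rewrite subr_gt0 expr_lt1// ltW. Qed.

(** For [A = 1 - rU] with adjoint [A'], unitarity reads [A + A' - A A' = 1 - r^2]. Multiply by the
    resolvent on the left and by its adjoint on the right. *)
Lemma ward U : resolvent U + (resolvent U)^t* - 1%:M =
  ward_coef%:C *: (resolvent U *m (resolvent U)^t*).
Proof.
set A := 1%:M - r%:C *: val U.
have AR : resolvent U *m A = 1%:M by exact: resolvent_mulmx.
have ARt : A^t* *m (resolvent U)^t* = 1%:M.
  by rewrite -adj_mul AR trmx1 map_mx1.
have AA : A + A^t* - A *m A^t* = ward_coef%:C%:M.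
  rewrite /A adjB adjZ adj1 conj_real.
  rewrite mulmxBl !mulmxBr !mul1mx !mulmx1 -scalemxAl -scalemxAr unitary_mulmxV.
  apply/matrixP => i j; rewrite !mxE /ward_coef rmorphB rmorph1 rmorphXn.
  by case: eqVneq => _ /=; ring.
rewrite scalemxAr -mul_scalar_mx -AA mulmxA.
rewrite mulmxBr mulmxDr mulmxA AR mul1mx mulmxBl mulmxDl mul1mx.
by rewrite -!mulmxA ARt !mulmx1 (addrC (_ ^t*)).
Qed.

(** The square of the Hilbert-Schmidt norm of the resolvent. *)
Definition hs_norm U : R := \sum_i \sum_j sqn (resolvent U i j).

Lemma sqnE (z : R[i]) : (sqn z)%:C = z * Num.conj z.
Proof.
case: z => a b; apply/eqP; rewrite eq_complex ReM ImM ReC ImC /sqn /=.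
by apply/andP; split; apply/eqP; ring.
Qed.

Lemma hs_normE U : (hs_norm U)%:C = \tr (resolvent U *m (resolvent U)^t*).
Proof.
rewrite /hs_norm rmorph_sum; apply: eq_bigr => i _; rewrite rmorph_sum mxE.
by apply: eq_bigr => j _; rewrite !mxE; exact: sqnE.
Qed.

Lemma ward_trace U : ward_coef * hs_norm U =
  2 * complex.Re (\tr (resolvent U)) - n%:R.
Proof.
apply: complexI; rewrite realCM hs_normE -mxtraceZ -ward.
rewrite mxtraceD mxtraceD raddfN /= mxtrace_adj mxtrace1.
rewrite realCB realCM !realC_nat; congr (_ - _).
exact: addcJ.
Qed.

(** The Ward identity equates [k hs] with [2 Re tr R - n], and [2 Re tr R] is at most half of [k hs]
    plus [2 n / k] by completing squares on the diagonal. Absorbing gives the bound without any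
    operator norm. *)
Lemma hs_norm_bound U : hs_norm U <= 4 * n%:R / ward_coef ^+ 2.
Proof.
have k0 := ward_coef_gt0; have := ward_trace U; set k := ward_coef => hE.
have : 2 * complex.Re (\tr (resolvent U)) <= k / 2 * hs_norm U + 2 * n%:R / k.
  rewrite /mxtrace (raddf_sum (@complex.Re R : {additive _ -> _})).
  rewrite mulr_sumr /hs_norm.
  have -> : 2 * n%:R / k = \sum_(i < n) 2 / k.
    by rewrite sumr_const card_ord -mulr_natr; ring.
  rewrite mulr_sumr -big_split/=; apply: ler_sum => i _.
  apply: (@le_trans _ _ (k / 2 * sqn (resolvent U i i) + 2 / k)); last first.
    rewrite lerD2r ler_pM2l ?divr_gt0//.
    rewrite (bigD1 i)//= lerDl; apply: sumr_ge0 => j _; exact: sqn_ge0.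
  rewrite /sqn; set a := complex.Re _; set b := complex.Im _.
  have -> : k / 2 * (a ^+ 2 + b ^+ 2) + 2 / k =
    (k * a - 2) ^+ 2 / (2 * k) + k / 2 * b ^+ 2 + 2 * a.
    by field; rewrite gt_eqF.
  rewrite lerDr addr_ge0//; last by rewrite mulr_ge0 ?sqr_ge0// divr_ge0// ltW.
  by rewrite divr_ge0 ?sqr_ge0// mulr_ge0// ltW.
move: hE; rewrite -/k => hE h.
have n0 : 0 <= n%:R :> R by [].
have : k / 2 * hs_norm U <= 2 * n%:R / k by lra.
move/(ler_wpM2l (ltW k0)) => hk; rewrite ler_pdivlMr ?exprn_gt0//.
have e1 : k * (k / 2 * hs_norm U) = hs_norm U * k ^+ 2 / 2 by field.
have e2 : k * (2 * n%:R / k) = 2 * n%:R by field; rewrite gt_eqF.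
by move: hk; rewrite e1 e2; lra.
Qed.

Lemma normr_resolvent U i j : `|resolvent U i j| <= (4 * n%:R / ward_coef ^+ 2 + 1)%:C.
Proof.
have hs : sqn (resolvent U i j) <= 4 * n%:R / ward_coef ^+ 2.
  apply: le_trans (hs_norm_bound U); rewrite /hs_norm (bigD1 i)//= (bigD1 j)//=.
  rewrite -addrA lerDl addr_ge0//; first by apply: sumr_ge0 => k _; exact: sqn_ge0.
  by apply: sumr_ge0 => k _; apply: sumr_ge0 => l _; exact: sqn_ge0.
(* [sqrt s <= s + 1] spares a square root in the bound. *)
rewrite normc_def lecR; apply: le_trans (_ : sqn (resolvent U i j) + 1 <= _); last first.
  by rewrite lerD2r.
have := sqn_ge0 (resolvent U i j); rewrite -/(sqn _); set s := sqn _ => s0.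
have := sqr_sqrtr s0; have := sqrtr_ge0 s; nra.
Qed.

Lemma mbounded_resolvent : mbounded resolvent.
Proof.
move=> i j; split; last first.
  by exists (4 * n%:R / ward_coef ^+ 2 + 1) => U; exact: normr_resolvent.
have mE k l : cmeasurable (fun U : G => (1%:M - r%:C *: val U) k l).
  under eq_fun do rewrite !mxE.
  apply: cmeasurableD; first exact: cmeasurable_cst.
  apply: cmeasurableN; apply: cmeasurableM; first exact: cmeasurable_cst.
  exact: cmeasurable_entry.
under eq_fun do rewrite /resolvent -lock /invmx resolvent_unit !mxE.
apply: cmeasurableM.
  by apply: cmeasurableV; exact: cmeasurable_det.
apply: cmeasurableM; first exact: cmeasurable_cst.
by apply: cmeasurable_det => k l; under eq_fun do rewrite 2!mxE; exact: mE.
Qed.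

(** The resolvent identity: the difference of the inverted matrices is [(cis t - 1) Q r U], and
    [r U] times the resolvent of [U] is that resolvent minus [1]. *)
Lemma resolvent_mul Q (hQ : projector Q) t U :
  resolvent (curve hQ t * U)%g - resolvent U =
  (cis t - 1) *: (resolvent (curve hQ t * U)%g *m Q *m (resolvent U - 1%:M)).
Proof.
set V := (curve hQ t * U)%g.
rewrite -{1}(mulmx1 (resolvent V)) -{1}(mulmx_resolvent U).
rewrite -[X in _ - X](mul1mx (resolvent U)) -[X in X *m resolvent U](resolvent_mulmx V).
rewrite mulmxA -mulmxBl -mulmxBr.
have -> : 1%:M - r%:C *: val U - (1%:M - r%:C *: val V) =
    (cis t - 1) *: (Q *m (r%:C *: val U)).
  rewrite /V SubK mulmxDl mul1mx scalerDr opprB addrC addrA subrK.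
  by rewrite addrAC subrr add0r -scalemxAl -!scalemxAr !scalerA mulrC.
by rewrite resolventE -[in LHS](scalemxAr (cis t - 1)) -[in LHS](scalemxAl (cis t - 1)) !mulmxA.
Qed.

Lemma uniform_O_sum (I : Type) (s : seq I) k (F : I -> R -> G -> R[i]) :
  (forall i, uniform_O k (F i)) -> uniform_O k (fun t U => \sum_(i <- s) F i t U).
Proof.
move=> OF; elim: s => [|i s IH].
  exists 0 => t U _; rewrite big_nil normr0 mul0r//.
by apply: eq_uniform_O (uniform_OD (OF i) IH) => t U; rewrite big_cons.
Qed.

Lemma mderiv_resolvent Q (hQ : projector Q) :
  mderiv hQ resolvent (fun U => resolvent U *m Q *m (resolvent U - 1%:M)).
Proof.
have bR := mbounded_resolvent; have bQ := @mbounded_cst R n Q.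
have bM : mbounded (fun U => resolvent U - 1%:M).
  by apply: mboundedB => //; exact: mbounded_cst.
have bQM := mboundedM bQ bM.
have O0 (B : G -> 'M[R[i]]_n) : mbounded B -> forall i j,
    uniform_O 0 (fun t U => (resolvent (curve hQ t * U)%g *m B U) i j).
  move=> bB i j; apply: (@eq_uniform_O _ _ _
    (fun t U => \sum_k resolvent (curve hQ t * U)%g i k * B U k j)).
    by move=> t U; rewrite mxE.
  apply: uniform_O_sum => k; apply: (@uniform_OM _ _ 0 0).
    exists (4 * n%:R / ward_coef ^+ 2 + 1) => t U _.
    by rewrite expr0 mulr1 normr_resolvent.
  exact: uniform_O_bounded.
move=> i j; split; first exact: bR.
  by apply: mboundedM => //; exact: mboundedM.
(* The resolvent identity is used twice: for the increment itself, with one factor [cis t - 1], and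
   to replace the moved resolvent in it by the fixed one, at the cost of a second such factor. *)
have O1 := @uniform_OM _ _ 2 0 _ _ (@uniform_O_cis R n) (O0 _ bQM i j).
have O2 := @uniform_OM _ _ 1 0 _ _ (@uniform_O_cis1 R n) (O0 _ (mboundedM bQM bQM) i j).
have O3 := uniform_OM (@uniform_O_time R n) O2.
apply: eq_uniform_O (uniform_OD O1 O3) => t U.
have := resolvent_mul hQ t U; set V := (_ * U)%g.
set A := resolvent V; set B := resolvent U; set M := B - 1%:M => AB.
have -> : A i j - B i j = (A - B) i j by rewrite !mxE.
have -> : A *m (Q *m M *m (Q *m M)) = A *m Q *m M *m Q *m M by rewrite !mulmxA.
have -> : (cis t - 1) * (A *m Q *m M *m Q *m M) i j = ((A - B) *m Q *m M) i j.
  by rewrite AB -!scalemxAl [RHS]mxE.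
have -> : (A - B) i j = (cis t - 1) * (A *m Q *m M) i j by rewrite AB [LHS]mxE.
have -> : ((A - B) *m Q *m M) i j = (A *m Q *m M) i j - (B *m Q *m M) i j.
  by rewrite !mulmxBl [LHS]mxE; congr (_ + _); rewrite [LHS]mxE.
by rewrite mulmxA; ring.
Qed.

End resolvent.

Section loop_equations.
Variables (R : realType) (n : nat) (r : R).
Hypotheses (r_gt0 : 0 < r) (r_lt1 : r < 1).
Local Notation G := (unitary_group R n).
Variables (mu : probability G R) (mu_haar : haar mu).
Implicit Types U : G.

Local Notation A U := (resolvent r U).
Local Notation B U := ((resolvent r U)^t*).
Local Notation E := (cexpect mu).
Local Notation k := (ward_coef r).

Let bA : mbounded (fun U => A U) := mbounded_resolvent r_gt0 r_lt1.
Let bAA : mbounded (fun U => A U *m A U) := mboundedM bA bA.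

Lemma mxtrace_mid (C Q D : 'M[R[i]]_n) :
  \tr (C *m Q *m D) = \tr (Q *m (D *m C)).
Proof. by rewrite -mulmxA mxtrace_mulC -mulmxA. Qed.

(** Writes an entry as a pairing with [Q], so that the gradient of a resolvent entry has rank
    one. *)
Lemma mxtrace_outer (Q C D : 'M[R[i]]_n) i j :
  \tr (Q *m (col j D *m row i C)) = (C *m Q *m D) i j.
Proof.
rewrite mulmxA mxtrace_mulC mulmxA -row_mul [LHS]big_ord1.
rewrite -[RHS]/((C *m Q *m D) i j) !mxE.
by apply: eq_bigr => l _; rewrite !mxE.
Qed.

Lemma mbounded_outer (C D : G -> 'M[R[i]]_n) i j : mbounded C -> mbounded D ->
  mbounded (fun U => col j (D U) *m row i (C U)).
Proof.
move=> bC bD a b; under eq_fun do rewrite mxE big_ord1 !mxE.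
exact: cboundedM.
Qed.

Lemma has_grad_resolvent i j : has_grad (fun U => A U i j)
  (fun U => col j (A U - 1%:M) *m row i (A U)).
Proof.
split=> [|Q hQ].
  by apply: mbounded_outer => //; apply: mboundedB => //; exact: mbounded_cst.
by apply: eq_deriv (mderiv_resolvent r_gt0 r_lt1 hQ i j) => // U; rewrite mxtrace_outer.
Qed.

Lemma mderiv_sqr Q (hQ : projector Q) : mderiv hQ (fun U => A U *m A U)
  (fun U => A U *m A U *m Q *m (A U - 1%:M) + A U *m Q *m (A U *m A U - A U)).
Proof.
have dA := mderiv_resolvent r_gt0 r_lt1 hQ.
move=> i j; apply: eq_deriv (mderivM dA dA i j) => // U.
have -> : A U *m A U - A U = (A U - 1%:M) *m A U by rewrite mulmxBl mul1mx.
by rewrite !mulmxA.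
Qed.

Lemma has_grad_sqr i j : has_grad (fun U => (A U *m A U) i j)
  (fun U => col j (A U - 1%:M) *m row i (A U *m A U) +
            col j (A U *m A U - A U) *m row i (A U)).
Proof.
split=> [|Q hQ].
  apply: mboundedD; apply: mbounded_outer => //; apply: mboundedB => //.
  exact: mbounded_cst.
apply: eq_deriv (mderiv_sqr hQ i j) => // U.
by rewrite [in RHS]mulmxDr mxtraceD !mxtrace_outer [LHS]mxE.
Qed.

Lemma has_grad_tr : has_grad (fun U => \tr (A U)) (fun U => A U *m A U - A U).
Proof.
split=> [|Q hQ]; first exact: mboundedB.
apply: eq_deriv (deriv_tr (mderiv_resolvent r_gt0 r_lt1 hQ)) => // U.
by rewrite mxtrace_mid mulmxBl mul1mx.
Qed.

Lemma has_grad_tr_sqr : has_grad (fun U => \tr (A U *m A U))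
  (fun U => 2 *: (A U *m A U *m A U - A U *m A U)).
Proof.
split=> [|Q hQ].
  apply: (@mboundedZ _ _ (fun=> 2)); first exact: cbounded_cst.
  by apply: mboundedB => //; exact: mboundedM.
apply: eq_deriv (deriv_tr (mderiv_sqr hQ)) => // U.
rewrite mxtraceD !mxtrace_mid -scalemxAr mxtraceZ mulr_natl mulr2n.
by rewrite !mulmxBl mul1mx !mulmxA.
Qed.

Lemma mxtrace_mulE (C D : 'M[R[i]]_n) : \tr (C *m D) = \sum_i \sum_j C i j * D j i.
Proof. by apply: eq_bigr => i _; rewrite mxE. Qed.

Lemma trace_mul_split (f : 'I_n -> R[i]) (g : 'I_n -> R[i]) :
  \sum_i \sum_j f i * g j = (\sum_i f i) * \sum_j g j.
Proof. by rewrite mulr_suml; apply: eq_bigr => i _; rewrite mulr_sumr. Qed.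

Lemma loop_trace g Gg : has_grad g Gg -> E (fun U => \tr (Gg U)) = 0.
Proof.
move=> hg; rewrite cexpect_sum => [|i]; last exact: hg.1.
by rewrite big1// => i _; exact: (cexpect_grad mu_haar hg).
Qed.

(* Divergence theorem for the matrix-valued field [C]: summing over [i, j] the
   [(j, i)] entry of the gradient of [C i j * g]. *)
Lemma loop_field (C : G -> 'M[R[i]]_n) (GC : 'I_n -> 'I_n -> G -> 'M[R[i]]_n) g Gg :
  (forall i j, has_grad (fun U => C U i j) (GC i j)) -> has_grad g Gg ->
  E (fun U => (\sum_i \sum_j GC i j U j i) * g U + \tr (C U *m Gg U)) = 0.
Proof.
move=> hC hg; have bg := has_grad_cbounded hg.
have hCg i j := has_gradM (hC i j) hg.
have e U : (\sum_i \sum_j GC i j U j i) * g U + \tr (C U *m Gg U) =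
    \sum_i \sum_j (C U i j *: Gg U + g U *: GC i j U) j i.
  rewrite mxtrace_mulE mulr_suml -big_split; apply: eq_bigr => i _ /=.
  rewrite mulr_suml -big_split; apply: eq_bigr => j _ /=.
  by rewrite !mxE addrC (mulrC (g U)).
under eq_fun do rewrite e.
have b i j := (hCg i j).1 j i.
rewrite cexpect_sum => [|i]; last exact: cbounded_sum.
rewrite big1// => i _; rewrite cexpect_sum//.
by rewrite big1// => j _; exact: (cexpect_grad mu_haar (hCg i j)).
Qed.

(** The traces of [R^j - R^(j-1)] for [j = 1, 2, 3], written [V], [Y], [Z] below. The gradient of
    [V] has trace [Y] and that of [Y] has trace [2 Z - Y]. *)
Definition ctr U : R[i] := \tr (A U) - n%:R.
Definition dtr U : R[i] := \tr (A U *m A U) - \tr (A U).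
Definition dtr2 U : R[i] := \tr (A U *m A U *m A U) - \tr (A U *m A U).

(** The divergence of the field [R] factorises as [tr R] times [tr (R - 1)]. Since [tr R = n + V],
    its main part is [n] times the wanted mean of [V g]. *)
Lemma loop_resolvent g Gg : has_grad g Gg ->
  E (fun U => \tr (A U) * ctr U * g U + \tr (A U *m Gg U)) = 0.
Proof.
move=> hg; rewrite -[RHS](loop_field has_grad_resolvent hg).
congr (E _); apply/funext => U; congr (_ * _ + _).
rewrite -[ctr U](_ : \tr (A U - 1%:M) = _); last first.
  by rewrite raddfB/= mxtrace1.
rewrite -trace_mul_split; apply: eq_bigr => i _; apply: eq_bigr => j _.
by rewrite [RHS]mxE big_ord1 !mxE mulrC.
Qed.

(** The divergence of [R^2], arranged so that [dtr] has the coefficient [2 tr R - n], whose real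
    part is the nonnegative [k hs] by [ward_trace]. *)
Lemma loop_resolvent_sqr g Gg : has_grad g Gg ->
  E (fun U => ((2 * \tr (A U) - n%:R) * dtr U + \tr (A U) * ctr U) * g U +
              \tr (A U *m A U *m Gg U)) = 0.
Proof.
move=> hg; rewrite -[RHS](loop_field has_grad_sqr hg).
congr (E _); apply/funext => U; congr (_ * _ + _).
transitivity (\tr (A U *m A U) * \tr (A U - 1%:M) +
              \tr (A U) * \tr (A U *m A U - A U)).
  by rewrite !raddfB/= mxtrace1 /ctr /dtr; ring.
rewrite -!trace_mul_split -big_split; apply: eq_bigr => i _.
rewrite -big_split; apply: eq_bigr => j _.
by rewrite /= [RHS]mxE ![(_ *m row _ _) _ _]mxE !big_ord1 !mxE; congr (_ + _); rewrite mulrC.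
Qed.

(** Each application shortens a word with a neighbouring resolvent and adjoint, at the cost of a
    factor [1 / k]. *)
Lemma ward_mul (C D : 'M[R[i]]_n) U : k%:C * \tr (C *m A U *m B U *m D) =
  \tr (C *m A U *m D) + \tr (C *m B U *m D) - \tr (C *m D).
Proof.
rewrite -mxtraceZ.
have -> : k%:C *: (C *m A U *m B U *m D) = C *m (k%:C *: (A U *m B U)) *m D.
  by rewrite -scalemxAr -scalemxAl !mulmxA.
by rewrite -ward// mulmxBr mulmxDr mulmx1 mulmxBl mulmxDl raddfB/= mxtraceD.
Qed.

End loop_equations.

Local Opaque resolvent mulmx mxtrace.

Lemma mxtrN (R : realType) n (A : 'M[R[i]]_n) : \tr (- A) = - \tr A.
Proof. exact: raddfN. Qed.

Lemma mxtrB (R : realType) n (A B : 'M[R[i]]_n) : \tr (A - B) = \tr A - \tr B.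
Proof. exact: raddfB. Qed.

(** Triangular system for the means [e_pq] of the trace of [R^p] times the [q]-th power of its
    adjoint, with [h = e_11]; the combination solved for is the one left by [loop_dtr]. *)
Lemma ward_solve (F : fieldType) (k K h e12 e13 e21 e22 e23 : F) : k * K = 1 ->
  k * e12 = h -> k * e21 = h -> k * e13 = e12 -> k * e22 = e21 + e12 - h ->
  k * e23 = e22 + e13 - e12 ->
  - - (2 * e23 - 3 * e22 + e21) = (6 * K ^+ 3 - 10 * K ^+ 2 + 4 * K) * h.
Proof.
move=> kK; have solve x y : k * x = y -> x = y * K.
  by move=> <-; rewrite mulrAC kK mul1r.
by move=> /solve-> /solve-> /solve-> /solve-> /solve->; ring.
Qed.

(** * Exact identities for mixed moments of the resolvent *)

Section moments.
Variables (R : realType) (n : nat) (r : R).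
Hypotheses (r_gt0 : 0 < r) (r_lt1 : r < 1).
Local Notation G := (unitary_group R n).
Variables (mu : probability G R) (mu_haar : haar mu).
Implicit Types U : G.

Local Notation A U := (resolvent r U).
Local Notation B U := ((resolvent r U)^t*).
Local Notation E := (cexpect mu).
Local Notation k := (ward_coef r).
Local Notation hs := (@hs_norm R n r).
Local Notation V := (@ctr R n r).
Local Notation Y := (@dtr R n r).
Local Notation ex := (expect mu).

Let bA : mbounded (fun U => A U) := mbounded_resolvent r_gt0 r_lt1.
Let bB : mbounded (fun U => B U) := mbounded_adj bA.
Let bAA : mbounded (fun U => A U *m A U) := mboundedM bA bA.
Let bBB : mbounded (fun U => B U *m B U) := mboundedM bB bB.

Lemma cbounded_ctr : cbounded V.
Proof. by apply: cboundedB; [exact: cbounded_tr|exact: cbounded_cst]. Qed.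

Lemma cbounded_dtr : cbounded Y.
Proof. by apply: cboundedB; exact: cbounded_tr. Qed.

Lemma bounded_hs_norm : bounded_measurable hs.
Proof.
have : cbounded (fun U => \tr (A U *m B U)) by apply: cbounded_tr; exact: mboundedM.
move/cbounded_Re; congr bounded_measurable; apply/funext => U.
by rewrite -hs_normE.
Qed.

Lemma bounded_sqn (f : G -> R[i]) : cbounded f -> bounded_measurable (fun U => sqn (f U)).
Proof.
move=> bf; apply: bounded_measurableD; apply: bounded_measurableX.
  exact: cbounded_Re.
exact: cbounded_Im.
Qed.

Lemma cexpect_real (f : G -> R) : E (fun U => (f U)%:C) = (ex f)%:C.
Proof. by rewrite /cexpect /= expect_cst. Qed.

Lemma ward_hs U : k * hs U = n%:R + 2 * complex.Re (V U).
Proof.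
rewrite ward_trace// /ctr ReD ReN -(realC_nat R n) /=; ring.
Qed.

(** The gradient of [tr R] has trace [tr R^2 - tr R]. Together with the cubic analogue this makes
    the pure traces cancel in the averaged Ward relations. *)
Lemma cexpect_tr_sqr : E (fun U => \tr (A U *m A U)) = E (fun U => \tr (A U)).
Proof.
have := loop_trace mu_haar (@has_grad_tr R n r r_gt0 r_lt1).
under eq_fun do rewrite raddfB/=.
by rewrite cexpectB; [move/subr0_eq|exact: cbounded_tr..].
Qed.

Lemma cexpect_tr_cube : E (fun U => \tr (A U *m A U *m A U)) = E (fun U => \tr (A U)).
Proof.
have bAAA := mboundedM bAA bA.
have := loop_trace mu_haar (@has_grad_tr_sqr R n r r_gt0 r_lt1).
under eq_fun do rewrite mxtraceZ raddfB/=.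
rewrite cexpectZ; last by apply: cboundedB; exact: cbounded_tr.
rewrite cexpectB; [|exact: cbounded_tr..].
move/eqP; rewrite mulf_eq0 pnatr_eq0/= subr_eq0 => /eqP ->.
exact: cexpect_tr_sqr.
Qed.

Let trBB U : \tr (B U *m B U) = Num.conj (\tr (A U *m A U)).
Proof. by rewrite -mxtrace_adj adj_mul. Qed.

Let trBBB U : \tr (B U *m B U *m B U) = Num.conj (\tr (A U *m A U *m A U)).
Proof. by rewrite -mxtrace_adj !adj_mul mulmxA. Qed.

Let H : R[i] := E (fun U => \tr (A U *m B U)).

Lemma cexpect_hs : H = (ex hs)%:C.
Proof.
by rewrite /H -cexpect_real; congr (E _); apply/funext => U; rewrite hs_normE.
Qed.

Let k0 : k%:C != 0.
Proof. by rewrite fmorph_eq0 gt_eqF// ward_coef_gt0. Qed.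

Lemma cexpect_lincomb (f g h l : G -> R[i]) :
  cbounded f -> cbounded g -> cbounded h -> cbounded l ->
  (forall U, k%:C * f U = g U + h U - l U) -> k%:C * E f = E g + E h - E l.
Proof.
move=> bf bg bh bl e; rewrite -(cexpectZ mu _ bf) -(cexpectD mu bg bh).
rewrite -(cexpectB mu (cboundedD bg bh) bl).
by congr (E _); apply/funext.
Qed.

Lemma cexpect_lincomb_cancel (f g h l : G -> R[i]) :
  cbounded f -> cbounded g -> cbounded h -> cbounded l -> E h = E l ->
  (forall U, k%:C * f U = g U + h U - l U) -> k%:C * E f = E g.
Proof.
by move=> bf bg bh bl hl /(cexpect_lincomb bf bg bh bl) ->; rewrite hl addrK.
Qed.

Let trB U : \tr (B U) = Num.conj (\tr (A U)). Proof. exact: mxtrace_adj. Qed.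

Let EB2 : E (fun U => \tr (B U *m B U)) = E (fun U => \tr (B U)).
Proof.
transitivity (Num.conj (E (fun U => \tr (A U *m A U)))).
  rewrite -(cexpect_conj mu (cbounded_tr bAA)); congr (E _).
  by apply/funext => U; exact: trBB.
transitivity (Num.conj (E (fun U => \tr (A U)))).
  by congr Num.conj; exact: cexpect_tr_sqr.
rewrite -(cexpect_conj mu (cbounded_tr bA)); congr (E _).
by apply/funext => U; rewrite trB.
Qed.

Let EB3 : E (fun U => \tr (B U *m B U *m B U)) = E (fun U => \tr (B U *m B U)).
Proof.
transitivity (Num.conj (E (fun U => \tr (A U *m A U *m A U)))).
  rewrite -(cexpect_conj mu (cbounded_tr (mboundedM bAA bA))); congr (E _).
  by apply/funext => U; exact: trBBB.
transitivity (Num.conj (E (fun U => \tr (A U)))).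
  by congr Num.conj; exact: cexpect_tr_cube.
apply: etrans (esym EB2).
rewrite -(cexpect_conj mu (cbounded_tr bA)); congr (E _).
by apply/funext => U; rewrite trB.
Qed.

(** In [b12], [t12], [E12] and the like, the digits are the powers of the resolvent and of its
    adjoint. *)
Let b11 : mbounded (fun U => A U *m B U) := mboundedM bA bB.
Let b12 : mbounded (fun U => A U *m B U *m B U) := mboundedM b11 bB.
Let b13 : mbounded (fun U => A U *m B U *m B U *m B U) := mboundedM b12 bB.
Let b21 : mbounded (fun U => A U *m A U *m B U) := mboundedM bAA bB.
Let b22 : mbounded (fun U => A U *m A U *m B U *m B U) := mboundedM b21 bB.
Let b23 : mbounded (fun U => A U *m A U *m B U *m B U *m B U) := mboundedM b22 bB.
Let b03 : mbounded (fun U => B U *m B U *m B U) := mboundedM bBB bB.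
Let ward_mul := @ward_mul R n r r_gt0 r_lt1.

Let t11 U := \tr (A U *m B U).
Let t12 U := \tr (A U *m B U *m B U).
Let t13 U := \tr (A U *m B U *m B U *m B U).
Let t21 U := \tr (A U *m A U *m B U).
Let t22 U := \tr (A U *m A U *m B U *m B U).
Let t23 U := \tr (A U *m A U *m B U *m B U *m B U).

Lemma ward12 U : k%:C * t12 U = t11 U + \tr (B U *m B U) - \tr (B U).
Proof. by have := ward_mul 1%:M (B U) U; rewrite !mul1mx. Qed.

Let E12 : k%:C * E t12 = H.
Proof.
apply: (cexpect_lincomb_cancel (cbounded_tr b12) (cbounded_tr b11) (cbounded_tr bBB)
  (cbounded_tr bB) EB2).
exact: ward12.
Qed.

Let E21 : k%:C * E t21 = H.
Proof.
have cancel (a b h : R[i]) : a = b -> a + h - b = h.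
  by move=> ->; rewrite addrAC subrr add0r.
apply: etrans (cancel _ _ _ cexpect_tr_sqr).
apply: (cexpect_lincomb (cbounded_tr b21) (cbounded_tr bAA) (cbounded_tr b11) (cbounded_tr bA)) => U.
by have := ward_mul (A U) 1%:M U; rewrite !mulmx1.
Qed.

Let E13 : k%:C * E t13 = E t12.
Proof.
apply: (cexpect_lincomb_cancel (cbounded_tr b13) (cbounded_tr b12) (cbounded_tr b03)
  (cbounded_tr bBB) EB3) => U.
by have := ward_mul 1%:M (B U *m B U) U; rewrite !mul1mx !mulmxA.
Qed.

Let E22 : k%:C * E t22 = E t21 + E t12 - H.
Proof.
apply: (cexpect_lincomb (cbounded_tr b22) (cbounded_tr b21) (cbounded_tr b12)
  (cbounded_tr b11)) => U.
exact: (ward_mul (A U) (B U) U).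
Qed.

Let E23 : k%:C * E t23 = E t22 + E t13 - E t12.
Proof.
apply: (cexpect_lincomb (cbounded_tr b23) (cbounded_tr b22) (cbounded_tr b13)
  (cbounded_tr b12)) => U.
by have := ward_mul (A U) (B U *m B U) U; rewrite !mulmxA.
Qed.

Lemma has_grad_ctr : has_grad V (fun U => A U *m A U - A U).
Proof.
have h := has_gradB (@has_grad_tr R n r r_gt0 r_lt1) (has_grad_cst n n%:R).
apply: (has_grad_eq _ _ h); first by move=> U; rewrite /ctr.
by move=> U; rewrite subr0.
Qed.

Lemma has_grad_dtr : has_grad Y
  (fun U => 2 *: (A U *m A U *m A U - A U *m A U) - (A U *m A U - A U)).
Proof.
exact: has_gradB (@has_grad_tr_sqr R n r r_gt0 r_lt1) (@has_grad_tr R n r r_gt0 r_lt1).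
Qed.

Let K := k^-1.

Let cV := cbounded_ctr.
Let cY := cbounded_dtr.
Let ctrA : cbounded (fun U => \tr (A U)) := cbounded_tr bA.

(** Testing against [conj V] leaves [tr (R S S) - tr (R S)], [S] the adjoint of [R], whose mean the
    Ward identity reduces to [E hs]. *)
Lemma loop_ctr : E (fun U => \tr (A U) * V U * Num.conj (V U)) =
  ((K - 1) * ex hs)%:C.
Proof.
have hg := has_grad_conj has_grad_ctr.
have := loop_resolvent r_gt0 r_lt1 mu_haar hg.
have c1 : cbounded (fun U => \tr (A U) * V U * Num.conj (V U)).
  exact: (cboundedM (cboundedM ctrA cV) (cbounded_conj cV)).
rewrite (cexpectD mu c1 (cbounded_tr (mboundedM bA hg.1))).
move/eqP; rewrite addr_eq0 => /eqP ->.
have -> : (fun U => \tr (A U *m - (A U *m A U - A U)^t*)) =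
    (fun U => - (t12 U - t11 U)).
  apply/funext => U; rewrite adjB adj_mul mulmxN mulmxBr mulmxA.
  by rewrite !raddfN/= raddfB/=.
have c11 := cbounded_tr b11; have c12 := cbounded_tr b12.
rewrite (cexpectN mu (cboundedB c12 c11)) (cexpectB mu c12 c11) opprK.
have := E12; have : E t11 = (ex hs)%:C := cexpect_hs; rewrite /H -/t11 => ->.
move: (E t12) (ex hs) => e12 x h; apply: (mulfI k0); rewrite mulrBr h.
have kK : k%:C * K%:C = 1 by rewrite /K fmorphV mulfV.
transitivity (k%:C * K%:C * x%:C - k%:C * x%:C); first by rewrite kK mul1r.
by move: K k => c q; ring.
Qed.

(** The equation for [R^2] tested against [conj Y]; [ward_solve] reduces the remaining mixed traces
    to [E hs]. *)
Lemma loop_dtr : E (fun U => ((2 * \tr (A U) - n%:R) * Y U + \tr (A U) * V U) *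
    Num.conj (Y U)) = ((6 * K ^+ 3 - 10 * K ^+ 2 + 4 * K) * ex hs)%:C.
Proof.
have hg := has_grad_conj has_grad_dtr.
have := loop_resolvent_sqr r_gt0 r_lt1 mu_haar hg.
have c0 : cbounded (fun U => 2 * \tr (A U) - n%:R).
  apply: cboundedB (cboundedM _ ctrA) _; exact: cbounded_cst.
have c1 := cboundedM (cboundedD (cboundedM c0 cY) (cboundedM ctrA cV)) (cbounded_conj cY).
rewrite (cexpectD mu c1 (cbounded_tr (mboundedM bAA hg.1))).
move/eqP; rewrite addr_eq0 => /eqP ->.
have -> : (fun U => \tr (A U *m A U *m - (2 *: (A U *m A U *m A U - A U *m A U) -
      (A U *m A U - A U))^t*)) =
    (fun U => - (2 * t23 U - 3 * t22 U + t21 U)).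
  apply/funext => U; rewrite !(adjB, adjZ) !adj_mul conjC_nat.
  rewrite !(mulmxN, mulmxBr) -!scalemxAr !mulmxBr !mulmxA.
  rewrite /t23 /t22 /t21; move: (_ *m B U *m B U *m B U) => M23.
  move: (_ *m B U *m B U) => M22; move: (_ *m B U) => M21.
  by rewrite !(mxtrN, mxtrB, mxtraceZ); ring.
have c21 := cbounded_tr b21; have c22 := cbounded_tr b22; have c23 := cbounded_tr b23.
have cc (a : R[i]) : cbounded (fun _ : G => a) by exact: cbounded_cst.
have ee (a b : R[i]) : E (fun U => - (a * t23 U - b * t22 U + t21 U)) =
    - (a * E t23 - b * E t22 + E t21).
  have d22 := cboundedM (cc b) c22; have d23 := cboundedM (cc a) c23.
  rewrite (cexpectN mu (cboundedD (cboundedB d23 d22) c21)).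
  rewrite (cexpectD mu (cboundedB d23 d22) c21) (cexpectB mu d23 d22).
  by rewrite (cexpectZ mu a c23) (cexpectZ mu b c22).
rewrite ee.
have kK : k%:C * K%:C = 1 by rewrite /K fmorphV mulfV.
have := ward_solve kK E12 E21 E13 E22 E23; rewrite cexpect_hs => ->.
by move: (ex hs) K => x y; ring.
Qed.
End moments.

(** * Moment bounds and the approximate Stein equation *)

Section second_moments.
Variables (R : realType) (n : nat) (r : R).
Hypotheses (r_gt0 : 0 < r) (r_lt1 : r < 1).
Local Notation G := (unitary_group R n).
Variables (mu : probability G R) (mu_haar : haar mu).
Implicit Types U : G.

Local Notation A U := (resolvent r U).
Local Notation E := (cexpect mu).
Local Notation k := (ward_coef r).
Local Notation hs := (@hs_norm R n r).
Local Notation V := (@ctr R n r).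
Local Notation Y := (@dtr R n r).
Local Notation ex := (expect mu).
(** Equivalent to [K <= n]; in the application [n * k >= L >= 1]. *)
Hypothesis nk1 : 1 <= n%:R * k.
Let K := k^-1.

Lemma sqn_normr (z : R[i]) : (sqn z)%:C = `|z| ^+ 2.
Proof. by rewrite sqnE normCK. Qed.

Lemma sqnM (z w : R[i]) : sqn (z * w) = sqn z * sqn w.
Proof. by rewrite /sqn ReM ImM; ring. Qed.

Lemma sqn_conj (z : R[i]) : sqn (Num.conj z) = sqn z.
Proof. by rewrite /sqn ReC ImC; ring. Qed.

(** Cauchy-Schwarz with the arithmetic mean, which avoids the square roots of the two squared
    norms. *)
Lemma normr_mxtrace_mul (C D : 'M[R[i]]_n) (c d : R) :
  \tr (C *m C^t*) = c%:C -> \tr (D *m D^t*) = d%:C ->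
  `|\tr (C *m D)| <= ((c + d) / 2)%:C.
Proof.
have hsE (X : 'M[R[i]]_n) : \tr (X *m X^t*) = \sum_i \sum_j (sqn (X i j))%:C.
  rewrite mxtrace_mulE; apply: eq_bigr => i _; apply: eq_bigr => j _.
  by rewrite !mxE sqnE.
rewrite !hsE => hc hd.
have h2 : (2^-1 : R)%:C = 2^-1 by rewrite fmorphV rmorph_nat.
rewrite realCM realCD -hc -hd h2 mxtrace_mulE.
apply: le_trans (ler_norm_sum _ _ _) _.
rewrite [X in _ + X]exchange_big -big_split/= mulr_suml; apply: ler_sum => i _.
apply: le_trans (ler_norm_sum _ _ _) _.
rewrite -big_split/= mulr_suml; apply: ler_sum => j _.
rewrite normrM ler_pdivlMr ?ltr0n// !sqn_normr.
have h : 0 <= (`|C i j| - `|D j i|) ^+ 2.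
  by rewrite real_exprn_even_ge0// rpredB// normr_real.
rewrite -subr_ge0; move: h; congr (_ <= _).
by move: `|C i j| `|D j i| => x y; ring.
Qed.

(** [Y] is [tr ((R - 1) R)], and [R - 1 = r U R] is no larger than [R] in norm because [U] is
    unitary. *)
Lemma sqn_dtr_le U : sqn (Y U) <= hs U ^+ 2.
Proof.
have e1 : \tr ((A U - 1%:M) *m (A U - 1%:M)^t*) = (r ^+ 2 * hs U)%:C.
  have WW : (r%:C *: val U)^t* *m (r%:C *: val U) = (r ^+ 2)%:C%:M.
    rewrite adjZ conj_real -scalemxAl -scalemxAr scalerA.
    rewrite (_ : (val U)^t* *m val U = 1%:M); last exact/mulmx1C/unitary_mulmxV.
    by rewrite expr2 realCM scalemx1.
  rewrite resolventE// adj_mul -mulmxA mxtrace_mulC -!mulmxA WW.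
  by rewrite mulmxA mul_mx_scalar mxtraceZ -hs_normE realCM.
have e2 : \tr (A U *m (A U)^t*) = (hs U)%:C by rewrite hs_normE.
have YE : Y U = \tr ((A U - 1%:M) *m A U).
  by rewrite mulmxBl mul1mx raddfB.
have := normr_mxtrace_mul e1 e2; rewrite -YE => h.
have hs0 : 0 <= hs U.
  by apply: sumr_ge0 => i _; apply: sumr_ge0 => j _; exact: sqn_ge0.
rewrite -lecR sqn_normr rmorphXn; apply: lerXn2r.
- exact: normr_ge0.
- by rewrite nnegrE ler0c.
apply: le_trans h _; rewrite lecR.
have : r ^+ 2 <= 1 by rewrite expr_le1// ltW.
nra.
Qed.

Local Notation v2 := (fun U => sqn (V U)).
Local Notation y2 := (fun U => sqn (Y U)).
Local Notation x := (fun U => complex.Re (V U)).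

Let cV : cbounded V := @cbounded_ctr R n r r_gt0 r_lt1.
Let cY : cbounded Y := @cbounded_dtr R n r r_gt0 r_lt1.
Let bv : bounded_measurable v2 := bounded_sqn cV.
Let by2 : bounded_measurable y2 := bounded_sqn cY.
Let bh : bounded_measurable hs := @bounded_hs_norm R n r r_gt0 r_lt1.
Let bx : bounded_measurable x := cbounded_Re cV.

Let k_gt0 : 0 < k. Proof. exact: ward_coef_gt0. Qed.
Let k_le1 : k <= 1. Proof. by rewrite /ward_coef lerBlDr lerDl sqr_ge0. Qed.
Let K_ge1 : 1 <= K. Proof. by rewrite /K invf_ge1. Qed.
Let kK : k * K = 1. Proof. by rewrite /K mulfV// gt_eqF. Qed.
Let K_le : K <= n%:R.
Proof. by rewrite -(ler_pM2r k_gt0) (mulrC K) kK; exact: nk1. Qed.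
Let n_ge1 : 1 <= n%:R :> R. Proof. exact: le_trans K_ge1 K_le. Qed.

Lemma hs_ge0 U : 0 <= hs U.
Proof. by apply: sumr_ge0 => i _; apply: sumr_ge0 => j _; exact: sqn_ge0. Qed.

Let bc (c : R) : bounded_measurable (fun _ : G => c).
Proof. exact: bounded_measurable_cst. Qed.

Let bZ c (f : G -> R) : bounded_measurable f -> bounded_measurable (fun U => c * f U).
Proof. by move=> bf; apply: bounded_measurableM => //; exact: bounded_measurable_cst. Qed.

Lemma hsE U : hs U = K * (n%:R + 2 * x U).
Proof. by rewrite -ward_hs// mulrA (mulrC K) kK mul1r. Qed.

Lemma sqr_Re_le (z : R[i]) : complex.Re z ^+ 2 <= sqn z.
Proof. by rewrite /sqn lerDl sqr_ge0. Qed.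

Lemma expect_hs : ex hs = K * (n%:R + 2 * ex x).
Proof.
rewrite -(expectZ mu 2 bx) -[in RHS](expect_cst mu n%:R).
rewrite -(expectD mu (bc _) (bZ 2 bx)).
rewrite -(expectZ mu K (bounded_measurableD (bc _) (bZ 2 bx))).
by congr (ex _); apply/funext => U; exact: hsE.
Qed.

(** Real part of [loop_ctr]. As [2 Re tr R = n + k hs], its cubic term becomes the nonnegative mean
    of [k hs |V|^2]. *)
Lemma expect_hv : n%:R * ex v2 + ex (fun U => k * hs U * v2 U) =
  2 * ((K - 1) * ex hs).
Proof.
have bhv := bounded_measurableM (bZ k bh) bv.
rewrite -(expectZ mu n%:R bv) -(expectD mu (bZ n%:R bv) bhv).
have := congr1 (@complex.Re R) (loop_ctr r_gt0 r_lt1 mu_haar).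
rewrite /cexpect/= => <-.
rewrite -(expectZ mu 2); last first.
  by apply: cbounded_Re; apply: cboundedM (cbounded_conj cV); apply: cboundedM cV; exact: cbounded_tr (@mbounded_resolvent R n r r_gt0 r_lt1).
congr (ex _); apply/funext => U; rewrite ward_hs//.
rewrite -mulrA -sqnE ReM /= mulr0 subr0.
have -> : complex.Re (\tr (A U)) = n%:R + x U.
  by rewrite /ctr ReD ReN -(realC_nat R n) /=; ring.
by rewrite /=; ring.
Qed.

(** On the right of [expect_hv] stands [E hs = K (n + 2 E Re V)], only linear in [V], so that half
    of [n E|V|^2] absorbs it. *)
Lemma ctr_moments : [/\ ex v2 <= 20 * K ^+ 2,
  ex (fun U => k * hs U * v2 U) <= 10 * n%:R * K ^+ 2 &
  ex hs <= 22 * n%:R * K].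
Proof.
have e := expect_hv; rewrite expect_hs in e.
have bhv := bounded_measurableM (bZ k bh) bv.
have v0 : 0 <= ex v2.
  rewrite -(expect_cst mu 0); apply: le_expect => // U; exact: sqn_ge0.
have b0 : 0 <= ex (fun U => k * hs U * v2 U).
  rewrite -(expect_cst mu 0); apply: le_expect => // U.
  by rewrite mulr_ge0 ?sqn_ge0// mulr_ge0 ?hs_ge0// ltW.
have xv c : 0 < c -> 2 * ex x <= c * ex v2 + c^-1.
  move=> c0; rewrite -(expectZ mu 2 bx) -(expectZ mu c bv) -[X in _ + X](expect_cst mu).
  rewrite -(expectD mu (bZ c bv) (bc _)).
  apply: le_expect => [||U]; first exact: bZ.
    by apply: bounded_measurableD; [exact: bZ|exact: bounded_measurable_cst].
  have := sqr_Re_le (V U); set p := complex.Re (V U); set q := sqn (V U) => h2.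
  change (2 * p <= c * q + c^-1); rewrite -(ler_pM2l c0) mulrDr mulfV ?gt_eqF//.
  have h : 0 <= (c * p - 1) ^+ 2 by rewrite sqr_ge0.
  have h3 : c * c * p ^+ 2 <= c * c * q by rewrite ler_wpM2l// mulr_ge0// ltW.
  have -> : c * (2 * p) = c * c * p ^+ 2 + 1 - (c * p - 1) ^+ 2 by ring.
  rewrite mulrA; lra.
have n0 : 0 < n%:R :> R := lt_le_trans ltr01 n_ge1.
have K0 : 0 < K := lt_le_trans ltr01 K_ge1.
have KK : K ^+ 2 <= n%:R ^+ 2 by rewrite lerXn2r ?nnegrE// ltW.
set a := ex v2 in e v0 xv *; set b := ex _ in e b0 *; set y := ex x in e xv *.
have h1 : 4 * y * K ^+ 2 <= n%:R / 2 * a + 8 * n%:R * K ^+ 2.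
  (* With this weight the term in [a] is [n / 2 * a], half of what the left side offers. *)
  have c0 : 0 < n%:R / (4 * K ^+ 2) :> R.
    by rewrite divr_gt0// mulr_gt0// exprn_gt0.
  have := xv _ c0; rewrite -(ler_pM2r (_ : 0 < 2 * K ^+ 2)) ?mulr_gt0 ?exprn_gt0//.
  have -> : 2 * y * (2 * K ^+ 2) = 4 * y * K ^+ 2 by ring.
  move/le_trans; apply.
  have -> : (n%:R / (4 * K ^+ 2) * a + (n%:R / (4 * K ^+ 2))^-1) * (2 * K ^+ 2) =
     n%:R / 2 * a + 8 * (K ^+ 2 * K ^+ 2 / n%:R).
    by field; rewrite !gt_eqF.
  have : K ^+ 2 * K ^+ 2 / n%:R <= n%:R * K ^+ 2.
    rewrite ler_pdivrMr// (_ : n%:R * K ^+ 2 * n%:R = n%:R ^+ 2 * K ^+ 2); last by ring.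
    exact: ler_wpM2r (sqr_ge0 K) _ _ KK.
  by rewrite lerD2l -[8 * n%:R * _]mulrA ler_pM2l.
have h2 : n%:R * a + b <= 2 * n%:R * K ^+ 2 + 4 * y * K ^+ 2.
  have -> : n%:R * a + b = 2 * n%:R * K ^+ 2 + 4 * y * K ^+ 2 - 2 * (K * (n%:R + 2 * y)).
    by rewrite e; ring.
  rewrite lerBlDr lerDl mulr_ge0//.
  have : 0 <= ex hs.
    rewrite -(expect_cst mu 0); apply: le_expect => // U; exact: hs_ge0.
  by rewrite expect_hs.
have ha : a <= 20 * K ^+ 2.
  rewrite -(ler_pM2l n0); lra.
split=> //.
  have : 0 <= n%:R * a by rewrite mulr_ge0// ltW.
  lra.
rewrite expect_hs -/y mulrC ler_pM2r//.
(* The weight [1 / n] suffices here, since [K <= n] makes [a / n] at most [20 n]. *)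
have := xv _ (_ : 0 < n%:R^-1); rewrite invr_gt0 invrK => /(_ n0) h3.
have : n%:R^-1 * a <= 20 * n%:R.
  rewrite mulrC ler_pdivrMr// -mulrA -expr2.
  by apply: le_trans ha _; rewrite ler_pM2l.
lra.
Qed.

(* Either [k * hs U >= n / 2], or [Re (V U) < - n / 4] and then [V U] is large
   enough to absorb [Y U]. *)
Lemma dtr_pointwise U : n%:R * sqn (Y U) <=
  2 * (k * hs U * sqn (Y U)) + 16 * n%:R * K ^+ 2 * sqn (V U).
Proof.
have n0 : 0 < n%:R :> R := lt_le_trans ltr01 n_ge1.
have K0 : 0 < K := lt_le_trans ltr01 K_ge1.
have y0 := sqn_ge0 (Y U); have v0 := sqn_ge0 (V U).
have hy := sqn_dtr_le U; have h0 := hs_ge0 U.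
have hE := ward_hs r_gt0 r_lt1 U; have hE' := hsE U.
have xv := sqr_Re_le (V U).
have [xn|xn] := leP (- n%:R / 2) (2 * complex.Re (V U)).
  have h1 : n%:R * sqn (Y U) <= 2 * (k * hs U) * sqn (Y U).
    by rewrite ler_wpM2r// hE; lra.
  have : 0 <= 16 * n%:R * K ^+ 2 * sqn (V U).
    by rewrite !mulr_ge0 ?sqr_ge0// ltW.
  by move: h1; rewrite -mulrA; lra.
have hn : hs U <= K * n%:R by rewrite hE' ler_pM2l//; lra.
have h1 : sqn (Y U) <= K ^+ 2 * n%:R ^+ 2.
  by apply: le_trans hy _; rewrite -exprMn lerXn2r ?nnegrE// mulr_ge0// ltW.
have h2 : n%:R ^+ 2 <= 16 * sqn (V U).
  apply: le_trans (_ : 16 * complex.Re (V U) ^+ 2 <= _); last by rewrite ler_pM2l.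
  have -> : 16 * complex.Re (V U) ^+ 2 = (- (4 * complex.Re (V U))) ^+ 2 by ring.
  by rewrite lerXn2r ?nnegrE//; lra.
have h3 : n%:R * sqn (Y U) <= 16 * n%:R * K ^+ 2 * sqn (V U).
  have -> : 16 * n%:R * K ^+ 2 * sqn (V U) = n%:R * (K ^+ 2 * (16 * sqn (V U))) by ring.
  rewrite ler_pM2l//; apply: le_trans h1 _.
  by rewrite ler_wpM2l// sqr_ge0.
have : 0 <= 2 * (k * hs U * sqn (Y U)) by rewrite !mulr_ge0// ltW.
by move: h3; lra.
Qed.

Lemma Re_mul_le (z w : R[i]) c : 0 < c ->
  - complex.Re (z * w) <= (c * sqn z + c^-1 * sqn w) / 2.
Proof.
move=> c0; rewrite ReM /sqn; case: z w => [z1 z2] [w1 w2] /=.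
have e : (c * (z1 ^+ 2 + z2 ^+ 2) + c^-1 * (w1 ^+ 2 + w2 ^+ 2)) / 2 +
    (z1 * w1 - z2 * w2) = ((c * z1 + w1) ^+ 2 + (c * z2 - w2) ^+ 2) / (2 * c).
  by field; rewrite gt_eqF.
rewrite -subr_ge0 opprK e; apply: divr_ge0; first by rewrite addr_ge0 ?sqr_ge0.
by apply: mulr_ge0 => //; exact: ltW.
Qed.

Lemma sqn_mul_conj (z w : R[i]) (b : R) : sqn w <= b ^+ 2 -> 0 <= b ->
  - complex.Re (z * z * w) <= b * sqn z.
Proof.
move=> wb b0; have z0 := sqn_ge0 z.
apply: (le_trans (ler_norm _)); rewrite normrN.
rewrite -(@ler_pXn2r _ 2) ?nnegrE ?mulr_ge0// real_normK ?num_real//.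
apply: le_trans (sqr_Re_le _) _; rewrite !sqnM exprMn -expr2 mulrC.
by rewrite ler_wpM2r// sqr_ge0.
Qed.

(** The real part of [loop_dtr] contains the nonnegative mean of [k hs |Y|^2], which controls
    [n E|Y|^2] through [dtr_pointwise]; the cross term [q] is absorbed. *)
Lemma dtr_moment : ex y2 <= 900 * K ^+ 4.
Proof.
have [ha hb hc] := ctr_moments.
have n0 : 0 < n%:R :> R := lt_le_trans ltr01 n_ge1.
have K0 : 0 < K := lt_le_trans ltr01 K_ge1.
have bhy := bounded_measurableM (bZ k bh) by2.
have bhv := bounded_measurableM (bZ k bh) bv.
pose q U := \tr (A U) * V U * Num.conj (Y U).
have bq : cbounded q.
  apply: cboundedM (cbounded_conj cY); apply: cboundedM cV.
  exact: cbounded_tr (@mbounded_resolvent R n r r_gt0 r_lt1).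
have bRq := cbounded_Re bq.
have eB : ex (fun U => k * hs U * y2 U) + ex (fun U => complex.Re (q U)) =
    (6 * K ^+ 3 - 10 * K ^+ 2 + 4 * K) * ex hs.
  rewrite -(expectD mu bhy bRq).
  have := congr1 (@complex.Re R) (loop_dtr r_gt0 r_lt1 mu_haar).
  rewrite /cexpect/= => <-; congr (ex _); apply/funext => U.
  have -> : ((2 * \tr (A U) - n%:R) * Y U + \tr (A U) * V U) * Num.conj (Y U) =
      (2 * \tr (A U) - n%:R%:C) * (sqn (Y U))%:C + q U.
    by rewrite /q sqnE (realC_nat R n); ring.
  move: (q U) => qU; rewrite ReD ReM /= mulr0 subr0; congr (_ * _ + _).
  by rewrite ward_trace// ReD ReN ReM /=; ring.
have H0 : 0 <= ex hs.
  rewrite -(expect_cst mu 0); apply: le_expect => // U; exact: hs_ge0.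
have eB' : (6 * K ^+ 3 - 10 * K ^+ 2 + 4 * K) * ex hs <= 132 * n%:R * K ^+ 4.
  have h1 : (6 * K ^+ 3 - 10 * K ^+ 2 + 4 * K) * ex hs <= 6 * K ^+ 3 * ex hs.
    rewrite ler_wpM2r//; have : K <= K ^+ 2 by rewrite expr2 ler_peMl// ltW.
    by lra.
  apply: le_trans h1 _; have -> : 132 * n%:R * K ^+ 4 = 6 * K ^+ 3 * (22 * n%:R * K) by ring.
  by rewrite ler_wpM2l// mulr_ge0// exprn_ge0// ltW.
have hq : - ex (fun U => complex.Re (q U)) <=
    n%:R * (ex y2 / 16 + 4 * ex v2) + K * ex (fun U => k * hs U * v2 U).
  have bf := bounded_measurableD (bZ (n%:R / 16) by2) (bZ (n%:R * 4) bv).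
  have -> : n%:R * (ex y2 / 16 + 4 * ex v2) + K * ex (fun U => k * hs U * v2 U) =
    ex (fun U => (n%:R / 16 * y2 U + n%:R * 4 * v2 U) + K * (k * hs U * v2 U)).
    rewrite (expectD mu bf (bZ K bhv)) (expectD mu (bZ (n%:R / 16) by2) (bZ (n%:R * 4) bv)).
    rewrite (expectZ mu _ by2) (expectZ mu _ bv) (expectZ mu _ bhv); ring.
  rewrite -(expectN mu bRq); apply: le_expect.
  - exact: bounded_measurableN.
  - exact: (bounded_measurableD bf (bZ K bhv)).
  move=> U.
  (* Young's inequality handles the part with the factor [n]; in the cubic part [|Y| <= hs] leaves
     [hs |V|^2], whose mean [ctr_moments] bounds. *)
  have -> : q U = n%:R%:C * (V U * Num.conj (Y U)) + V U * V U * Num.conj (Y U).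
    by rewrite /q /ctr -(realC_nat R n); ring.
  rewrite ReD opprD; apply: lerD.
    rewrite ReM /= mul0r subr0 -mulrN.
    have -> : n%:R / 16 * sqn (Y U) + n%:R * 4 * sqn (V U) =
      n%:R * (sqn (Y U) / 16 + 4 * sqn (V U)) by ring.
    rewrite ler_pM2l//.
    have c0 : 0 < 8 :> R by [].
    have := Re_mul_le (V U) (Num.conj (Y U)) c0; rewrite sqn_conj.
    by lra.
  rewrite !mulrA (mulrC K) kK mul1r.
  apply: sqn_mul_conj; last exact: hs_ge0.
  by rewrite sqn_conj; exact: sqn_dtr_le.
have hp : n%:R * ex y2 <= 2 * ex (fun U => k * hs U * y2 U) + 16 * n%:R * K ^+ 2 * ex v2.
  rewrite -(expectZ mu _ by2) -(expectZ mu 2 bhy) -(expectZ mu _ bv).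
  rewrite -(expectD mu (bZ 2 bhy) (bZ _ bv)).
  apply: le_expect => [||U]; [exact: bZ| |exact: dtr_pointwise].
  exact: bounded_measurableD (bZ 2 bhy) (bZ _ bv).
have K2 : K ^+ 2 <= K ^+ 4 by rewrite ler_weXn2l.
have K3 : K ^+ 3 <= K ^+ 4 by rewrite ler_weXn2l.
have nv : n%:R * ex v2 <= 20 * (n%:R * K ^+ 4).
  rewrite mulrCA ler_pM2l//; apply: le_trans ha _; by rewrite ler_pM2l.
have nv2 : 16 * n%:R * K ^+ 2 * ex v2 <= 320 * (n%:R * K ^+ 4).
  have -> : 320 * (n%:R * K ^+ 4) = 16 * n%:R * K ^+ 2 * (20 * K ^+ 2) by ring.
  by rewrite ler_wpM2l// !mulr_ge0 ?sqr_ge0// ltW.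
have nb : K * ex (fun U => k * hs U * v2 U) <= 10 * (n%:R * K ^+ 4).
  apply: (@le_trans _ _ (K * (10 * n%:R * K ^+ 2))); first by rewrite ler_pM2l.
  have -> : K * (10 * n%:R * K ^+ 2) = 10 * (n%:R * K ^+ 3) by ring.
  by rewrite ler_pM2l// ler_pM2l.
have Q0 : 0 <= n%:R * K ^+ 4 by rewrite mulr_ge0 ?exprn_ge0// ltW.
rewrite -(ler_pM2l n0).
move: eB eB' hq hp nv nv2 nb.
set a := ex v2; set y := ex y2; set b := ex _; set c := ex _; set d := ex _.
have -> : n%:R * (y / 16 + 4 * a) = n%:R * y / 16 + 4 * (n%:R * a) by ring.
have -> : n%:R * (900 * K ^+ 4) = 900 * (n%:R * K ^+ 4) by ring.
have -> : 132 * n%:R * K ^+ 4 = 132 * (n%:R * K ^+ 4) by ring.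
(* In units of [n K^4] the total is [2 * (132 + 80 + 10) + 320 = 764], while [n * y / 8] is absorbed
   on the left, and [764 * 8 / 7 < 900]. *)
by move: ((6 * K ^+ 3 - 10 * K ^+ 2 + 4 * K) * d) => w *; lra.
Qed.

End second_moments.

Lemma ReCM (R : realType) (x : R) (z : R[i]) :
  complex.Re (x%:C * z) = x * complex.Re z.
Proof. by rewrite ReM /= mul0r subr0. Qed.

Lemma sqnD_le (R : realType) (z w : R[i]) : sqn (z + w) <= 2 * sqn z + 2 * sqn w.
Proof.
rewrite /sqn; case: z w => [p p'] [q q'] /=.
have : 0 <= (p - q) ^+ 2 + (p' - q') ^+ 2 by rewrite addr_ge0 ?sqr_ge0.
by move=> h; nra.
Qed.

Section stein_estimate.
Variables (R : realType) (n : nat) (r : R).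
Hypotheses (r_gt0 : 0 < r) (r_lt1 : r < 1).
Local Notation G := (unitary_group R n).
Variables (mu : probability G R) (mu_haar : haar mu).
Implicit Types U : G.

Local Notation A U := (resolvent r U).
Local Notation E := (cexpect mu).
Local Notation k := (ward_coef r).
Local Notation hs := (@hs_norm R n r).
Local Notation V := (@ctr R n r).
Local Notation Y := (@dtr R n r).
Local Notation Z := (@dtr2 R n r).
Local Notation ex := (expect mu).
Hypothesis nk1 : 1 <= n%:R * k.
Let K := k^-1.

Variables (a : R[i]) (sg t al : R).
Hypotheses (t0 : 0 <= t) (t1 : t <= 1) (sg0 : 0 < sg) (sgk : sg <= 2 * k).

(** With [sg = s / r] this is a general real linear form of the scaled logarithmic derivative as [a]
    varies; the shift [al] in [ph] covers cosine and sine at once. *)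
Definition lin U : R := 2 * sg * complex.Re (a * V U).
Let ph U : R := t * lin U + al.

Let cV : cbounded V := @cbounded_ctr R n r r_gt0 r_lt1.
Let cY : cbounded Y := @cbounded_dtr R n r r_gt0 r_lt1.
Let hV := @has_grad_ctr R n r r_gt0 r_lt1.
Let hY := @has_grad_dtr R n r r_gt0 r_lt1.
Let Gph U : 'M[R[i]]_n := (t * sg)%:C *:
  (a *: (A U *m A U - A U) + Num.conj a *: - (A U *m A U - A U)^t*).

Lemma double_Re (z : R[i]) : (2 * complex.Re z)%:C = z + Num.conj z.
Proof. by case: z => x y; apply/eqP; rewrite eq_complex ReD ImD ReC ImC /= subrr eqxx andbT; apply/eqP; ring. Qed.

Lemma has_grad_phase : has_grad (fun U => (ph U)%:C) Gph.
Proof.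
have h := has_gradD (has_gradZ (t * sg)%:C (has_gradD (has_gradZ a hV)
  (has_gradZ (Num.conj a) (has_grad_conj hV)))) (has_grad_cst n al%:C).
apply: (has_grad_eq _ _ h) => U; last by rewrite addr0.
rewrite /ph /lin -conjM -double_Re -realCM -realCD; congr (_%:C); ring.
Qed.

Let hsin := has_grad_sin has_grad_phase.
Let hcos := has_grad_cos has_grad_phase.

Let mph : measurable_fun setT ph.
Proof. by case: (has_grad_cbounded has_grad_phase) => -[]. Qed.

Let bsin : bounded_measurable (fun U => sin (ph U)).
Proof.
by apply: (bounded_measurable_comp mph); [exact: continuous_sin|exact: sin_max].
Qed.

Let bcos : bounded_measurable (fun U => cos (ph U)).
Proof.
by apply: (bounded_measurable_comp mph); [exact: continuous_cos|exact: cos_max].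
Qed.

Let bA : mbounded (fun U => A U) := @mbounded_resolvent R n r r_gt0 r_lt1.
Let bB : mbounded (fun U => (A U)^t*) := mbounded_adj bA.
Let kK : k * K = 1.
Proof. by rewrite /K mulfV// gt_eqF// ward_coef_gt0. Qed.

Let T U := \tr (A U *m (A U)^t* *m (A U)^t*) - \tr (A U *m (A U)^t*).

(** One Ward step. The part [(K - 1) * hs], where [hs = K (n + 2 Re V)], contains the only term with
    the factor [n], which produces the variance. *)
Lemma mixed_trE U : T U = ((K - 1) * hs U)%:C + K%:C * Num.conj (Y U).
Proof.
have kKC : k%:C * K%:C = 1 by rewrite -realCM kK.
have k0 : k%:C != 0 by apply/eqP => k0; move/eqP: kKC; rewrite k0 mul0r eq_sym oner_eq0.
apply: (mulfI k0); have := ward12 r_gt0 r_lt1 U; rewrite /T.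
have -> : \tr (A U *m (A U)^t*) = (hs U)%:C by rewrite hs_normE.
have -> : \tr ((A U)^t* *m (A U)^t*) = Num.conj (\tr (A U *m A U)).
  by rewrite -mxtrace_adj adj_mul.
have -> : \tr ((A U)^t*) = Num.conj (\tr (A U)) by exact: mxtrace_adj.
have e1 : k%:C * ((K - 1) * hs U)%:C = (hs U)%:C - k%:C * (hs U)%:C.
  rewrite -!realCM -realCB; congr (_%:C).
  by rewrite mulrA mulrBr kK mulr1 mulrBl mul1r.
rewrite /dtr conjB mulrBr => ->; rewrite mulrDr e1 mulrA kKC mul1r; ring.
Qed.

Lemma loop_sin : E (fun U => \tr (A U) * V U * (sin (ph U))%:C +
  (cos (ph U))%:C * ((t * sg)%:C * (a * Z U - Num.conj a * T U))) = 0.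
Proof.
rewrite -[RHS](loop_resolvent r_gt0 r_lt1 mu_haar hsin).
congr (E _); apply/funext => U; congr (_ + _).
rewrite -!scalemxAr !mxtraceZ; congr (_ * (_ * _)).
rewrite mulmxDr -!scalemxAr mxtraceD !mxtraceZ mulmxN mxtrN adjB adj_mul.
by rewrite !mulmxBr !mxtrB !mulmxA mulrN.
Qed.

(** The gradient of [Y + V] has trace exactly [2 Z]. Testing it with the cosine trades [Z], for
    which there is no moment bound, for products of [Y] and [V]. *)
Lemma loop_cos : E (fun U => (cos (ph U))%:C * (2 * Z U) +
  (Y U + V U) * ((- sin (ph U))%:C *
    ((t * sg)%:C * (a * Y U - Num.conj a * Num.conj (Y U))))) = 0.
Proof.
have hf := has_gradM (has_gradD hY hV) hcos.
rewrite -[RHS](loop_trace mu_haar hf).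
congr (E _); apply/funext => U.
rewrite mxtraceD !mxtraceZ addrC; congr (_ * (_ * _) + _ * _).
  congr (_ * _); rewrite mxtraceD !mxtraceZ mxtrN mxtrace_adj mxtrB /dtr mulrN.
  by [].
by rewrite subrK mxtraceZ mxtrB.
Qed.

Let bAA := mboundedM bA bA.
Let cZ : cbounded Z.
Proof. exact: cboundedB (cbounded_tr (mboundedM bAA bA)) (cbounded_tr bAA). Qed.
Let cT : cbounded T.
Proof.
exact: cboundedB (cbounded_tr (mboundedM (mboundedM bA bB) bB))
  (cbounded_tr (mboundedM bA bB)).
Qed.

Let f1 U := complex.Re (a * V U) * sin (ph U).
Let f2 U := complex.Re (a * V U * V U) * sin (ph U).
Let f3 U := complex.Re (a ^+ 2 * Z U) * cos (ph U).
Let f4 U := complex.Re (T U) * cos (ph U).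
Let f5 U := complex.Re (a ^+ 2 * a * (Y U + V U) * Y U -
  a ^+ 2 * Num.conj a * (Y U + V U) * Num.conj (Y U)) * sin (ph U).

Let ca (c : R[i]) : cbounded (fun _ : G => c). Proof. exact: cbounded_cst. Qed.
Let bf1 : bounded_measurable f1.
Proof. exact: bounded_measurableM (cbounded_Re (cboundedM (ca a) cV)) bsin. Qed.
Let bf2 : bounded_measurable f2.
Proof. exact: bounded_measurableM (cbounded_Re (cboundedM (cboundedM (ca a) cV) cV)) bsin. Qed.
Let bf3 : bounded_measurable f3.
Proof. exact: bounded_measurableM (cbounded_Re (cboundedM (ca _) cZ)) bcos. Qed.
Let bf4 : bounded_measurable f4.
Proof. exact: bounded_measurableM (cbounded_Re cT) bcos. Qed.
Let bf5 : bounded_measurable f5.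
Proof.
apply: bounded_measurableM bsin; apply: cbounded_Re.
have cYV := cboundedD cY cV.
exact: cboundedB (cboundedM (cboundedM (ca _) cYV) cY)
  (cboundedM (cboundedM (ca _) cYV) (cbounded_conj cY)).
Qed.

Let bZ c (f : G -> R) : bounded_measurable f -> bounded_measurable (fun U => c * f U).
Proof. by move=> bf; apply: bounded_measurableM => //; exact: bounded_measurable_cst. Qed.

(** Multiplying [loop_sin] by [a] before taking real parts produces [Re (a V)], as in [lin], and
    turns [conj a] into [|a|^2]. *)
Let S1 : n%:R * ex f1 + ex f2 + t * sg * (ex f3 - sqn a * ex f4) = 0.
Proof.
have c1 : cbounded (fun U => \tr (A U) * V U * (sin (ph U))%:C +
  (cos (ph U))%:C * ((t * sg)%:C * (a * Z U - Num.conj a * T U))).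
  apply: cboundedD.
    exact: cboundedM (cboundedM (cbounded_tr bA) cV) (cbounded_real bsin).
  apply: cboundedM (cbounded_real bcos) _; apply: cboundedM (ca _) _.
  exact: cboundedB (cboundedM (ca a) cZ) (cboundedM (ca _) cT).
have := congr1 (fun z => complex.Re (a * z)) loop_sin.
rewrite mulr0 -(cexpectZ mu a c1) /cexpect/= => <-.
have b34 := bounded_measurableD bf3 (bounded_measurableN (bZ (sqn a) bf4)).
rewrite -(expectZ mu _ bf4) -(expectB mu bf3 (bZ (sqn a) bf4)) -(expectZ mu _ b34).
rewrite -(expectZ mu _ bf1) -(expectD mu (bZ _ bf1) bf2).
rewrite -(expectD mu (bounded_measurableD (bZ _ bf1) bf2) (bZ _ b34)).
congr (ex _); apply/funext => U; rewrite /f1 /f2 /f3 /f4.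
have -> : \tr (A U) = V U + n%:R%:C by rewrite /ctr (realC_nat R n) subrK.
have aa : a * Num.conj a = (sqn a)%:C by rewrite sqnE.
have -> : a * ((V U + n%:R%:C) * V U * (sin (ph U))%:C +
    (cos (ph U))%:C * ((t * sg)%:C * (a * Z U - Num.conj a * T U))) =
  (n%:R * sin (ph U))%:C * (a * V U) + (sin (ph U))%:C * (a * V U * V U) +
  (t * sg * cos (ph U))%:C * (a ^+ 2 * Z U - (a * Num.conj a) * T U).
  by rewrite !realCM; ring.
by rewrite aa !(ReD, ReN, ReCM); ring.
Qed.

Let S2 : 2 * ex f3 = t * sg * ex f5.
Proof.
have c1 : cbounded (fun U => (cos (ph U))%:C * (2 * Z U) +
  (Y U + V U) * ((- sin (ph U))%:C *
    ((t * sg)%:C * (a * Y U - Num.conj a * Num.conj (Y U))))).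
  apply: cboundedD.
    exact: cboundedM (cbounded_real bcos) (cboundedM (ca _) cZ).
  apply: cboundedM (cboundedD cY cV) _.
  apply: cboundedM (cbounded_real (bounded_measurableN bsin)) _.
  apply: cboundedM (ca _) _.
  exact: cboundedB (cboundedM (ca a) cY) (cboundedM (ca _) (cbounded_conj cY)).
have := congr1 (fun z => complex.Re (a ^+ 2 * z)) loop_cos.
rewrite mulr0 -(cexpectZ mu (a ^+ 2) c1) /cexpect/= => e.
apply/eqP; rewrite -subr_eq0; apply/eqP; apply: etrans e.
rewrite -(expectZ mu _ bf3) -(expectZ mu _ bf5) -(expectB mu (bZ _ bf3) (bZ _ bf5)).
congr (ex _); apply/funext => U; rewrite /f3 /f5.
have -> : a ^+ 2 * ((cos (ph U))%:C * (2 * Z U) + (Y U + V U) * ((- sin (ph U))%:C *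
    ((t * sg)%:C * (a * Y U - Num.conj a * Num.conj (Y U))))) =
  (2 * cos (ph U))%:C * (a ^+ 2 * Z U) - (t * sg * sin (ph U))%:C *
  (a ^+ 2 * a * (Y U + V U) * Y U - a ^+ 2 * Num.conj a * (Y U + V U) * Num.conj (Y U)).
  by rewrite -(realC_nat R 2); ring.
rewrite [RHS]ReD [in RHS]ReN ![in RHS]ReCM.
by ring.
Qed.

Let normr_sin_cos_le (u w s : R) : `|u| <= w -> `|s| <= 1 -> `|u * s| <= w.
Proof.
move=> uw s1; rewrite normrM -[leRHS]mulr1 ler_pM//; exact: le_trans uw.
Qed.

Let normr_Re_mul (z w : R[i]) c : 0 < c ->
  `|complex.Re (z * w)| <= (c * sqn z + c^-1 * sqn w) / 2.
Proof.
move=> c0; rewrite ler_norml lerNl Re_mul_le//=.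
by have := Re_mul_le (- z) w c0; rewrite mulNr ReN opprK /sqn ReN ImN !sqrrN.
Qed.

Let n0 : 0 < n%:R :> R.
Proof.
rewrite ltr0n; case: n nk1 => //; rewrite mul0r => h.
by have := lt_le_trans ltr01 h; rewrite ltxx.
Qed.

Let K0 : 0 < K. Proof. by rewrite invr_gt0 ward_coef_gt0. Qed.

Let moments := ctr_moments r_gt0 r_lt1 mu_haar nk1.
Let v2_le : ex (fun U => sqn (V U)) <= 20 * K ^+ 2. Proof. by case: moments. Qed.
Let y2_le : ex (fun U => sqn (Y U)) <= 900 * K ^+ 4.
Proof. exact: dtr_moment. Qed.

Let bv := bounded_sqn cV.
Let by2 := bounded_sqn cY.

Let f2_le : `|ex f2| <= 10 * (sqn a + 1) * K ^+ 2.
Proof.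
apply: (@le_trans _ _ (ex (fun U => (sqn a + 1) / 2 * sqn (V U)))); last first.
  rewrite (expectZ mu _ bv).
  have -> : 10 * (sqn a + 1) * K ^+ 2 = (sqn a + 1) / 2 * (20 * K ^+ 2) by field.
  by rewrite ler_wpM2l// divr_ge0// addr_ge0// sqn_ge0.
apply: normr_expect_le => // [|U]; first exact: bZ.
apply: normr_sin_cos_le; last exact: sin_max.
have := normr_Re_mul (a * V U) (V U) ltr01; rewrite sqnM invr1; lra.
Qed.

Let f5_le : `|ex f5| <= (1840 * sqn a ^+ 3 + 900) * K ^+ 4.
Proof.
have a0 := sqn_ge0 a; have a30 : 0 <= sqn a ^+ 3 by rewrite exprn_ge0.
have b1 := bZ (2 * sqn a ^+ 3) bv; have b2 := bZ (2 * sqn a ^+ 3 + 1) by2.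
apply: (@le_trans _ _ (ex (fun U => 2 * sqn a ^+ 3 * sqn (V U) +
    (2 * sqn a ^+ 3 + 1) * sqn (Y U)))); last first.
  rewrite (expectD mu b1 b2) (expectZ mu _ bv) (expectZ mu _ by2).
  have K24 : K ^+ 2 <= K ^+ 4.
    by rewrite ler_weXn2l// /K invf_ge1 ?ward_coef_gt0// /ward_coef lerBlDr lerDl sqr_ge0.
  have h1 : 2 * sqn a ^+ 3 * ex (fun U => sqn (V U)) <= 2 * sqn a ^+ 3 * (20 * K ^+ 4).
    rewrite ler_wpM2l ?mulr_ge0//; apply: le_trans v2_le _.
    by rewrite ler_pM2l.
  have h2 : (2 * sqn a ^+ 3 + 1) * ex (fun U => sqn (Y U)) <=
      (2 * sqn a ^+ 3 + 1) * (900 * K ^+ 4).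
    by rewrite ler_wpM2l// addr_ge0// mulr_ge0.
  by lra.
apply: normr_expect_le => // [|U]; first exact: bounded_measurableD.
apply: normr_sin_cos_le; last exact: sin_max.
rewrite ReD ReN; apply: le_trans (ler_normB _ _) _.
have e1 : sqn (a ^+ 2 * a * (Y U + V U)) = sqn a ^+ 3 * sqn (Y U + V U).
  by rewrite expr2 !sqnM; ring.
have e2 : sqn (a ^+ 2 * Num.conj a * (Y U + V U)) = sqn a ^+ 3 * sqn (Y U + V U).
  by rewrite expr2 !sqnM sqn_conj; ring.
have := normr_Re_mul (a ^+ 2 * a * (Y U + V U)) (Y U) ltr01.
have := normr_Re_mul (a ^+ 2 * Num.conj a * (Y U + V U)) (Num.conj (Y U)) ltr01.
rewrite e1 e2 sqn_conj invr1 !mul1r.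
have := ler_wpM2l a30 (sqnD_le (Y U) (V U)).
set u1 := `|complex.Re _|; set u2 := `|complex.Re _|; move: (sqn a ^+ 3) => s3.
move: (sqn (Y U + V U)) (sqn (Y U)) (sqn (V U)) u1 u2 => w y v u1 u2 h h1 h2.
have -> : 2 * s3 * v + (2 * s3 + 1) * y = s3 * (2 * y + 2 * v) + y by ring.
lra.
Qed.

Let fx_le : `|ex (fun U => complex.Re (V U) * cos (ph U))| <= 21 / 2 * K.
Proof.
have b1 := bZ ((2 * K)^-1) bv; have b2 := @bounded_measurable_cst _ G R (K / 2).
apply: (@le_trans _ _ (ex (fun U => (2 * K)^-1 * sqn (V U) + K / 2))); last first.
  rewrite (expectD mu b1 b2) (expectZ mu _ bv) expect_cst.
  have : (2 * K)^-1 * ex (fun U => sqn (V U)) <= (2 * K)^-1 * (20 * K ^+ 2).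
    by rewrite ler_pM2l// invr_gt0 mulr_gt0.
  have -> : (2 * K)^-1 * (20 * K ^+ 2) = 10 * K by field; rewrite gt_eqF.
  lra.
apply: normr_expect_le => [||U].
- exact: bounded_measurableM (cbounded_Re cV) bcos.
- exact: bounded_measurableD.
apply: normr_sin_cos_le; last exact: cos_max.
(* The weight [1 / K] balances [E|V|^2], of order [K^2], against the constant [1]. *)
have c0 : 0 < (K)^-1 by rewrite invr_gt0.
have h := normr_Re_mul (V U) 1 c0.
have s1 : sqn (1 : R[i]) = 1 by rewrite /sqn /= expr0n addr0 expr1n.
rewrite (mulr1 (V U)) s1 in h.
rewrite [leRHS](_ : _ = ((K)^-1 * sqn (V U) + ((K)^-1)^-1 * 1) / 2)//.
by field; rewrite gt_eqF.
Qed.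

Let fy_le : `|ex (fun U => complex.Re (Y U) * cos (ph U))| <= 901 / 2 * K ^+ 2.
Proof.
have K20 : 0 < K ^+ 2 by rewrite exprn_gt0.
have b1 := bZ ((2 * K ^+ 2)^-1) by2; have b2 := @bounded_measurable_cst _ G R (K ^+ 2 / 2).
apply: (@le_trans _ _ (ex (fun U => (2 * K ^+ 2)^-1 * sqn (Y U) + K ^+ 2 / 2))); last first.
  rewrite (expectD mu b1 b2) (expectZ mu _ by2) expect_cst.
  have : (2 * K ^+ 2)^-1 * ex (fun U => sqn (Y U)) <= (2 * K ^+ 2)^-1 * (900 * K ^+ 4).
    by rewrite ler_pM2l// invr_gt0 mulr_gt0.
  have -> : (2 * K ^+ 2)^-1 * (900 * K ^+ 4) = 450 * K ^+ 2 by field; rewrite gt_eqF.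
  lra.
apply: normr_expect_le => [||U].
- exact: bounded_measurableM (cbounded_Re cY) bcos.
- exact: bounded_measurableD.
apply: normr_sin_cos_le; last exact: cos_max.
have c0 : 0 < (K ^+ 2)^-1 by rewrite invr_gt0.
have h := normr_Re_mul (Y U) 1 c0.
have s1 : sqn (1 : R[i]) = 1 by rewrite /sqn /= expr0n addr0 expr1n.
rewrite (mulr1 (Y U)) s1 in h.
rewrite [leRHS](_ : _ = ((K ^+ 2)^-1 * sqn (Y U) + ((K ^+ 2)^-1)^-1 * 1) / 2)//.
by field; rewrite gt_eqF.
Qed.

Let f4E : ex f4 = (K - 1) * K * n%:R * ex (fun U => cos (ph U)) +
  2 * (K - 1) * K * ex (fun U => complex.Re (V U) * cos (ph U)) +
  K * ex (fun U => complex.Re (Y U) * cos (ph U)).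
Proof.
have bx := bounded_measurableM (cbounded_Re cV) bcos.
have by' := bounded_measurableM (cbounded_Re cY) bcos.
rewrite -(expectZ mu _ bcos) -(expectZ mu _ bx) -(expectZ mu _ by').
rewrite -(expectD mu (bZ _ bcos) (bZ _ bx)).
rewrite -(expectD mu (bounded_measurableD (bZ _ bcos) (bZ _ bx)) (bZ _ by')).
congr (ex _); apply/funext => U; rewrite /f4 mixed_trE hsE// -/K.
by rewrite ReD ReCM ReC /=; ring.
Qed.

(** The summands come from [f2], from [f5], and from the parts of [f4] with [Re V] and [Re Y]; the
    factor 4 bounds [2 * sg * K]. *)
Definition stein_const (q : R) : R :=
  4 * (10 * (q + 1) + 2 * (1840 * q ^+ 3 + 900) + 944 * q).

(** [S1] divided by [n]: the main part of [f4] is the term subtracted, all others are [O(K^2)], and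
    the prefactor [2 * sg / n] with [sg * K <= 2] brings them down to [O(K / n)]. *)
Lemma stein_bound :
  `|ex (fun U => lin U * sin (ph U)) -
    t * (2 * sg ^+ 2 * (K ^+ 2 - K) * sqn a) * ex (fun U => cos (ph U))|
  <= stein_const (sqn a) * (K / n%:R).
Proof.
have a0 := sqn_ge0 a; have a30 : 0 <= sqn a ^+ 3 by rewrite exprn_ge0.
have K1 : 1 <= K.
  by rewrite /K invf_ge1 ?ward_coef_gt0// /ward_coef lerBlDr lerDl sqr_ge0.
have sK : sg * K <= 2.
  by have := ler_wpM2r (ltW K0) sgk; rewrite -mulrA kK mulr1.
have -> : ex (fun U => lin U * sin (ph U)) = 2 * sg * ex f1.
  rewrite -(expectZ mu _ bf1); congr (ex _); apply/funext => U.
  by rewrite /lin /f1 mulrA.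
have e1 : ex f1 = (- ex f2 - t * sg * (ex f3 - sqn a * ex f4)) / n%:R.
  apply: (mulfI (lt0r_neq0 n0)); rewrite mulrCA mulfV ?gt_eqF// mulr1.
  by have := S1; move: (ex f1) (ex f2) (t * sg * _) => x y z; lra.
have e3 : ex f3 = t * sg * ex f5 / 2.
  by have := S2; move: (ex f3) (t * sg * _) => x y; lra.
rewrite e1 e3 f4E.
have := f2_le; have := f5_le; have := fx_le; have := fy_le.
set c := ex (fun U => cos _); set x := ex _; set y := ex _; set p5 := ex f5.
set p2 := ex f2 => hx hy h5 h2.
have -> : 2 * sg * ((- p2 - t * sg * (t * sg * p5 / 2 - sqn a *
   ((K - 1) * K * n%:R * c + 2 * (K - 1) * K * y + K * x))) / n%:R) -
   t * (2 * sg ^+ 2 * (K ^+ 2 - K) * sqn a) * c =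
   2 * sg / n%:R * (- p2 - t ^+ 2 * sg ^+ 2 / 2 * p5 +
     t * sg * sqn a * (2 * (K - 1) * K * y + K * x)).
  by field; rewrite gt_eqF.
rewrite normrM ger0_norm; last by rewrite divr_ge0 ?mulr_ge0// ltW.
have Kn : 0 <= K / n%:R by rewrite divr_ge0// ltW.
have sgK2 : (sg * K) ^+ 2 <= 4.
  have -> : 4 = 2 ^+ 2 :> R by ring.
  by rewrite lerXn2r ?nnegrE// mulr_ge0// ltW.
have B2 : `|- p2| <= 10 * (sqn a + 1) * K ^+ 2 by rewrite normrN.
have B5 : `|t ^+ 2 * sg ^+ 2 / 2 * p5| <= 2 * (1840 * sqn a ^+ 3 + 900) * K ^+ 2.
  rewrite normrM ger0_norm; last by rewrite divr_ge0// mulr_ge0 ?sqr_ge0.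
  apply: (@le_trans _ _ (1 * sg ^+ 2 / 2 * ((1840 * sqn a ^+ 3 + 900) * K ^+ 4))).
    apply: ler_pM => //; first by rewrite divr_ge0// mulr_ge0 ?sqr_ge0.
    by rewrite ler_pM2r// ler_wpM2r ?sqr_ge0// expr_le1.
  have -> : 1 * sg ^+ 2 / 2 * ((1840 * sqn a ^+ 3 + 900) * K ^+ 4) =
    (sg * K) ^+ 2 / 2 * ((1840 * sqn a ^+ 3 + 900) * K ^+ 2) by ring.
  have W0 : 0 <= (1840 * sqn a ^+ 3 + 900) * K ^+ 2.
    apply: mulr_ge0 (sqr_ge0 K); apply: addr_ge0 (ler0n _ _).
    exact: mulr_ge0 (ler0n _ _) a30.
  rewrite -(mulrA 2); apply: ler_wpM2r => //.
  by rewrite ler_pdivrMr//; apply: le_trans sgK2 _; rewrite -natrM ler_nat.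
have Bxy : `|2 * (K - 1) * K * y + K * x| <= 472 * K ^+ 3.
  apply: le_trans (ler_normD _ _) _; rewrite !normrM (ger0_norm (ltW K0)).
  rewrite (@ger0_norm _ (K - 1)) ?subr_ge0// (@ger0_norm _ 2)//.
  have h1 : 2 * (K - 1) * K * `|y| <= 2 * K * K * (21 / 2 * K).
    apply: ler_pM => //; first by rewrite !mulr_ge0 ?subr_ge0// ltW.
    by rewrite ler_pM2r// ler_pM2l//; lra.
  have h2' : K * `|x| <= K * (901 / 2 * K ^+ 2) by rewrite ler_pM2l.
  have -> : 472 * K ^+ 3 = 2 * K * K * (21 / 2 * K) + K * (901 / 2 * K ^+ 2) +
    1 / 2 * K ^+ 3 by field.
  have : 0 <= K ^+ 3 by rewrite exprn_ge0// ltW.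
  lra.
have B3 : `|t * sg * sqn a * (2 * (K - 1) * K * y + K * x)| <= 944 * sqn a * K ^+ 2.
  rewrite normrM ger0_norm; last by rewrite !mulr_ge0// ltW.
  apply: (@le_trans _ _ (1 * sg * sqn a * (472 * K ^+ 3))).
    apply: ler_pM => //; first by rewrite !mulr_ge0// ltW.
    by apply: ler_wpM2r => //; rewrite ler_pM2r.
  have -> : 1 * sg * sqn a * (472 * K ^+ 3) = sg * K * (472 * sqn a * K ^+ 2) by ring.
  have -> : 944 * sqn a * K ^+ 2 = 2 * (472 * sqn a * K ^+ 2) by ring.
  apply: ler_wpM2r sK; apply: mulr_ge0 (exprn_ge0 _ (ltW K0)).
  exact: mulr_ge0 (ler0n _ _) a0.
have Btot : `|- p2 - t ^+ 2 * sg ^+ 2 / 2 * p5 +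
     t * sg * sqn a * (2 * (K - 1) * K * y + K * x)| <=
     stein_const (sqn a) / 4 * K ^+ 2.
  apply: le_trans (ler_normD _ _) _.
  have := ler_normB (- p2) (t ^+ 2 * sg ^+ 2 / 2 * p5).
  move: B2 B5 B3; rewrite /stein_const.
  set u1 := `|- p2|; set u2 := `|_ * p5|; set u3 := `|_ * _|; set u4 := `|_ - _|.
  lra.
apply: le_trans (ler_wpM2l _ Btot) _; first by rewrite divr_ge0 ?mulr_ge0// ltW.
have -> : 2 * sg / n%:R * (stein_const (sqn a) / 4 * K ^+ 2) =
  sg * K / 2 * (stein_const (sqn a) * (K / n%:R)).
  by move: (stein_const _) => w; field; rewrite gt_eqF.
apply: ler_piMl; last by lra.
apply: mulr_ge0 Kn; apply: mulr_ge0 (ler0n _ _) _.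
apply: addr_ge0 (mulr_ge0 (ler0n _ _) a0); apply: addr_ge0.
  exact: mulr_ge0 (ler0n _ _) (addr_ge0 a0 ler01).
apply: mulr_ge0 (ler0n _ _) (addr_ge0 _ (ler0n _ _)).
exact: mulr_ge0 (ler0n _ _) a30.
Qed.
End stein_estimate.

(** * From the Stein equation to characteristic functions *)

Section characteristic_ode.
Context d (T : measurableType d) (R : realType) (P : probability T R).
Implicit Types f g : T -> R.
Local Notation ex := (expect P).

Lemma integrable_dominated f g : measurable_fun setT f ->
  P.-integrable setT (EFin \o g) -> (forall x, `|f x| <= g x) ->
  P.-integrable setT (EFin \o f).
Proof.
move=> mf ig fg; apply: le_integrable ig => //; first exact/measurable_EFinP.
move=> x _ /=; rewrite lee_fin; apply: le_trans (fg x) _; exact: ler_norm.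
Qed.

Lemma is_derive_quadratic (f : R -> R) x l C :
  (forall h, `|f (x + h) - f x - l * h| <= C * h ^+ 2) -> is_derive x (1 : R) f l.
Proof.
move=> fh.
have C0 : 0 <= C.
  by apply: le_trans (normr_ge0 _) (le_trans (fh 1) _); rewrite expr1n mulr1.
have cv : h^-1 *: (f (h *: (1 : R) + x) - f x) @[h --> 0^'] --> l.
  apply/cvgrPdist_lt => e e0; near=> h.
  have h0 : h != 0 by near: h; exact: nbhs_dnbhs_neq.
  rewrite distrC (_ : _ - l = h^-1 * (f (x + h) - f x - l * h)); last first.
    by rewrite /GRing.scale/= mulr1 (addrC h) !mulrBr -(mulrCA l) mulVf// mulr1.
  rewrite normrM normfV ltr_pdivrMl ?normr_gt0//.
  apply: le_lt_trans (fh h) _; rewrite -(real_normK (num_real h)) expr2 mulrA mulrC.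
  rewrite ltr_pM2l ?normr_gt0//.
  apply: (@le_lt_trans _ _ ((C + 1) * `|h|)).
    by rewrite ler_wpM2r// lerDl.
  rewrite mulrC -ltr_pdivlMr; last by rewrite ltr_wpDl.
  near: h; apply: dnbhs0_lt.
  by rewrite divr_gt0// ltr_wpDl.
apply: DeriveDef; first by apply/cvg_ex; exists l.
exact: cvg_lim cv.
Unshelve. all: by end_near.
Qed.

Variables (th : T -> R) (mth : measurable_fun setT th).
Hypothesis ith2 : P.-integrable setT (EFin \o (fun x => th x ^+ 2)).

Let integrable_bounded_mul f : bounded_measurable f ->
  P.-integrable setT (EFin \o (fun x => th x * f x)).
Proof.
move=> [mf [M bM]].
apply: (@integrable_dominated _ (fun x => M * (1 + th x ^+ 2))).
- exact: measurable_funM.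
- have i1 := finite_measure_integrable_cst P 1 measurableT.
  have := integrableZl measurableT M (integrableD measurableT i1 ith2).
  by congr (_.-integrable _ _); apply/funext => x /=; rewrite EFinM EFinD.
- move=> x; rewrite normrM mulrC; have M0 : 0 <= M by exact: le_trans (bM x).
  apply: ler_pM => //; rewrite -(real_normK (num_real (th x))).
  by have := sqr_ge0 (`|th x| - 1); nra.
Qed.

Variable al : R.

Let A t := ex (fun x => cos (t * th x + al)).
Let B t := ex (fun x => th x * sin (t * th x + al)).

Let mlin t : measurable_fun setT (fun x => t * th x + al).
Proof. by apply: measurable_funD => //; exact: measurable_funM. Qed.

Let bcos t : bounded_measurable (fun x => cos (t * th x + al)).
Proof.
by apply: (bounded_measurable_comp (mlin t)); [exact: continuous_cos|exact: cos_max].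
Qed.

Let bsin t : bounded_measurable (fun x => sin (t * th x + al)).
Proof.
by apply: (bounded_measurable_comp (mlin t)); [exact: continuous_sin|exact: sin_max].
Qed.

(** The quadratic Taylor bound is integrated directly, so a second moment of [th] takes the place of
    dominated convergence. *)
Lemma is_derive_cf t : is_derive t (1 : R) A (- B t).
Proof.
apply: (@is_derive_quadratic _ _ _ (2 * ex (fun x => th x ^+ 2))) => h.
have i1 : P.-integrable setT (EFin \o (fun x => th x * sin (t * th x + al))).
  exact: integrable_bounded_mul.
have i2 : P.-integrable setT (EFin \o (fun x => h * (th x * sin (t * th x + al)))).
  have := integrableZl measurableT h i1.
  by congr (_.-integrable _ _); apply/funext => x /=; rewrite EFinM.
have i3 := integrable_bounded P (bounded_measurableD (bcos (t + h)) (bounded_measurableN (bcos t))).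
have i4 : P.-integrable setT (EFin \o (fun x => (cos ((t + h) * th x + al) - cos (t * th x + al)) + h * (th x * sin (t * th x + al)))).
  have := integrableD measurableT i3 i2.
  by congr (_.-integrable _ _); apply/funext => x /=; rewrite EFinD.
have i5 : P.-integrable setT (EFin \o (fun x => 2 * h ^+ 2 * (th x ^+ 2))).
  have := integrableZl measurableT (2 * h ^+ 2) ith2.
  by congr (_.-integrable _ _); apply/funext => x /=; rewrite EFinM.
have -> : A (t + h) - A t - - B t * h =
    ex (fun x => (cos ((t + h) * th x + al) - cos (t * th x + al)) + h * (th x * sin (t * th x + al))).
  rewrite /expect RintegralD// RintegralB//; [|exact: integrable_bounded..].
  by rewrite RintegralZl// mulNr opprK mulrC.
have -> : 2 * ex (fun x => th x ^+ 2) * h ^+ 2 = ex (fun x => 2 * h ^+ 2 * (th x ^+ 2)).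
  by rewrite /expect RintegralZl//; ring.
apply: le_trans (le_normr_Rintegral measurableT i4) _.
apply: le_Rintegral => //; first exact: (integrable_norm i4).
move=> x _; have := cos_taylor (t * th x + al) (h * th x).
have -> : t * th x + al + h * th x = (t + h) * th x + al by ring.
have -> : 2 * (h * th x) ^+ 2 = 2 * h ^+ 2 * th x ^+ 2 by ring.
have -> // : sin (t * th x + al) * (h * th x) = h * (th x * sin (t * th x + al)) by ring.
Qed.

(* The derivative of [E cos(t th + al) * exp(c t^2 / 2)] is at most
   [e * exp(c t^2 / 2)]. *)
Lemma cf_ode (c e : R) : 0 <= c ->
  (forall t, 0 <= t -> t <= 1 ->
    `|ex (fun x => th x * sin (t * th x + al)) -
      t * c * ex (fun x => cos (t * th x + al))| <= e) ->
  `|ex (fun x => cos (th x + al)) - expR (- (c / 2)) * cos al| <= e.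
Proof.
move=> c0 he.
pose F t := A t * expR (c / 2 * t ^+ 2).
have dF t : is_derive t (1 : R) F
    (A t * (c * t * expR (c / 2 * t ^+ 2)) + - B t * expR (c / 2 * t ^+ 2)).
  have dA := is_derive_cf t.
  have dq : is_derive t (1 : R) (fun t => expR (c / 2 * t ^+ 2)) (c * t * expR (c / 2 * t ^+ 2)).
    apply: is_derive_eq; rewrite /GRing.scale/=; lra.
  by apply: is_derive_eq; rewrite /GRing.scale/=; ring.
have [t /andP[t0 t1]] := MVT_pos dF ler01.
rewrite mulr1 /F expr1n mulr1 expr0n/= mulr0 expR0 mulr1 => eF.
have A0 : A 0 = cos al.
  rewrite /A (_ : (fun x => _) = (fun=> cos al)) ?expect_cst//.
  by apply/funext => x; rewrite mul0r add0r.
have A1 : A 1 = ex (fun x => cos (th x + al)).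
  by congr (ex _); apply/funext => x; rewrite mul1r.
have E0 := expR_gt0 (c / 2).
rewrite -A1 -(ler_pM2r E0) -{1}(ger0_norm (ltW E0)) -normrM.
have -> : (A 1 - expR (- (c / 2)) * cos al) * expR (c / 2) = A 1 * expR (c / 2) - A 0.
  have ee : expR (- (c / 2)) * expR (c / 2) = 1 by rewrite -expRD addNr expR0.
  by rewrite A0 mulrBl [X in _ - X]mulrAC ee mul1r.
rewrite eF.
have -> : A t * (c * t * expR (c / 2 * t ^+ 2)) + - B t * expR (c / 2 * t ^+ 2) =
  - (B t - t * c * A t) * expR (c / 2 * t ^+ 2) by ring.
rewrite normrM normrN (ger0_norm (expR_ge0 _)).
apply: ler_pM => //; first exact: he.
rewrite ler_expR -[leRHS]mulr1 ler_wpM2l ?divr_ge0//.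
by rewrite expr_le1.
Qed.

End characteristic_ode.

(** * Logarithmic derivative as a trace of the resolvent, and its measurability *)

Section logarithmic_derivative.

Lemma logderiv_prod (F : fieldType) (I : eqType) (s : seq I) (e : I -> F) (z : F) :
  (forall i, i \in s -> z - e i != 0) ->
  \prod_(i <- s) (z - e i) != 0 /\
  logderiv (\prod_(i <- s) ('X - (e i)%:P)) z = \sum_(i <- s) (z - e i)^-1.
Proof.
rewrite /logderiv; elim: s => [|i s IH] zs.
  by rewrite !big_nil derivC horner0 mul0r oner_neq0.
have [j js|n0 IHs] := IH; first by apply: zs; rewrite inE js orbT.
have zi : z - e i != 0 by apply: zs; rewrite mem_head.
rewrite !big_cons mulf_neq0//; split=> //.
rewrite -IHs poly.derivM derivXsubC mul1r hornerD !hornerM hornerXsubC.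
set q := \prod_(_ <- _) _; have qz : q.[z] != 0.
  rewrite /q horner_prod; apply: contraNneq n0 => <-; apply/eqP.
  by apply: eq_bigr => j _; rewrite hornerXsubC.
by field; rewrite qz zi.
Qed.

Lemma char_poly_conj (F : fieldType) n (P D : 'M[F]_n) : P \in unitmx ->
  char_poly (invmx P *m D *m P) = char_poly D.
Proof.
move=> uP; rewrite /char_poly.
have -> : char_poly_mx (invmx P *m D *m P) =
    map_mx polyC (invmx P) *m char_poly_mx D *m map_mx polyC P.
  rewrite /char_poly_mx mulmxBr mulmxBl -!map_mxM; congr (_ - _).
  by rewrite mul_mx_scalar -scalemxAl -map_mxM mulVmx// map_mx1 scalemx1.
rewrite !det_mulmx mulrAC -det_mulmx -map_mxM mulVmx//.
by rewrite map_mx1 det1 mul1r.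
Qed.

(** Diagonalisation identifies the sum of [1 / (z - e_i)] with the trace of the inverse of [z - A].
    That inverse enters as [X], so that a convenient expression for it can be supplied. *)
Lemma logderiv_char_poly (F : fieldType) n (P A X : 'M[F]_n) (e : 'rV[F]_n) z :
  P \in unitmx -> A = invmx P *m diag_mx e *m P -> (z%:M - A) *m X = 1%:M ->
  logderiv (char_poly A) z = \tr X.
Proof.
move=> uP AE AX; pose D := diag_mx (\row_i (z - e 0 i)).
have zA : z%:M - A = invmx P *m D *m P.
  have -> : D = z%:M - diag_mx e.
    by apply/matrixP => i j; rewrite !mxE; case: eqVneq => //=; rewrite ?subr0.
  rewrite mulmxBr mulmxBl -AE; congr (_ - _).
  by rewrite mul_mx_scalar -scalemxAl mulVmx// scalemx1.
have z0 i : z - e 0 i != 0.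
  have : \det (z%:M - A) != 0.
    by apply: contra_eq_neq (congr1 determinant AX) => d0; rewrite det_mulmx d0 mul0r det1 eq_sym oner_neq0.
  rewrite zA !det_mulmx det_diag mulrAC -det_mulmx mulVmx// det1 mul1r.
  by move/prodf_neq0/(_ i isT); rewrite mxE.
rewrite AE char_poly_conj// char_poly_trig ?diag_mx_is_trig//.
have -> : \prod_(i < n) ('X - (diag_mx e i i)%:P) = \prod_(i < n) ('X - (e 0 i)%:P).
  by apply: eq_bigr => i _; rewrite mxE eqxx.
have [_ ->] := @logderiv_prod F _ (index_enum 'I_n) (fun i => e 0 i) z (fun i _ => z0 i).
pose D' := diag_mx (\row_i (z - e 0 i)^-1).
have -> : X = invmx P *m D' *m P.
  have DD : D' *m D = 1%:M.
    rewrite mulmx_diag; apply/matrixP => i j; rewrite !mxE.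
    by case: eqVneq => //= _; rewrite mulVf.
  have : invmx P *m D' *m P *m ((z%:M - A) *m X) = invmx P *m D' *m P by rewrite AX mulmx1.
  rewrite zA !mulmxA mulmxK// -(mulmxA _ D' D) DD mulmx1 mulVmx// mul1mx.
  by [].
rewrite -mulmxA mxtrace_mulC -mulmxA mulmxV// mulmx1 mxtrace_diag.
by apply: eq_bigr => i _; rewrite mxE.
Qed.

(** From [r - U = - U (1 - r U')], [U'] the adjoint, the inverse has trace [- conj (tr (R U))] with
    [R] the resolvent, while [ctr r U = r tr (R U)] by [resolventEr]. *)
Lemma logderiv_unitary (R : realType) n (r : R) (U : unitary_group R n) :
  0 < r -> r < 1 ->
  logderiv (char_poly (val U)) r%:C = - (r^-1)%:C * Num.conj (ctr r U).
Proof.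
move=> r0 r1.
have nU : val U \is normalmx.
  apply/normalmxP; rewrite unitary_mulmxV; apply/esym.
  exact/mulmx1C/unitary_mulmxV.
have /orthomx_spectralP UE := nU.
pose B := (resolvent r U)^t*.
have AB : (1%:M - r%:C *: (val U)^t*) *m B = 1%:M.
  rewrite -(adj1 R n) -[r%:C]conj_real -adjZ -adjB -adj_mul resolvent_mulmx//.
have X : (r%:C%:M - val U) *m (- ((val U)^t* *m B)) = 1%:M.
  rewrite mulmxN -mulNmx mulmxA -AB; congr (_ *m B).
  rewrite opprB mulmxBl unitary_mulmxV mul_scalar_mx.
  by [].
rewrite (logderiv_char_poly (spectral_unit _) UE X).
rewrite mxtrN; have -> : \tr ((val U)^t* *m B) = Num.conj (\tr (resolvent r U *m val U)).
  by rewrite -mxtrace_adj adj_mul.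
have -> : ctr r U = r%:C * \tr (resolvent r U *m val U).
  by rewrite -mxtraceZ scalemxAr -resolventEr// mxtrB mxtrace1.
rewrite conjM conj_real mulNr mulrA -realCM mulVf ?gt_eqF// mul1r.
by [].
Qed.

End logarithmic_derivative.

Section measurable_logderiv.
Variables (R : realType) (n : nat).
Local Notation G := (unitary_group R n).

Definition pmeasurable (q : G -> {poly R[i]}) :=
  forall i, cmeasurable (fun U => (q U)`_i).

Lemma pmeasurable_cst c : pmeasurable (fun=> c).
Proof. by move=> i; exact: cmeasurable_cst. Qed.

Lemma pmeasurableD p q : pmeasurable p -> pmeasurable q ->
  pmeasurable (fun U => p U + q U).
Proof.
by move=> mp mq i; under eq_fun do rewrite coefD; exact: cmeasurableD.
Qed.

Lemma pmeasurableM p q : pmeasurable p -> pmeasurable q ->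
  pmeasurable (fun U => p U * q U).
Proof.
move=> mp mq i; under eq_fun do rewrite coefM.
by apply: cmeasurable_sum => j; exact: cmeasurableM.
Qed.

Lemma pmeasurable_char_poly : pmeasurable (fun U => char_poly (val U)).
Proof.
rewrite /char_poly /determinant.
have psum (I : Type) (s : seq I) (F : I -> G -> {poly R[i]}) :
    (forall i, pmeasurable (F i)) -> pmeasurable (fun U => \sum_(i <- s) F i U).
  move=> mF; elim: s => [|i s IH].
    by under eq_fun do rewrite big_nil; exact: pmeasurable_cst.
  by under eq_fun do rewrite big_cons; exact: pmeasurableD.
have pprod (I : Type) (s : seq I) (F : I -> G -> {poly R[i]}) :
    (forall i, pmeasurable (F i)) -> pmeasurable (fun U => \prod_(i <- s) F i U).
  move=> mF; elim: s => [|i s IH].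
    by under eq_fun do rewrite big_nil; exact: pmeasurable_cst.
  by under eq_fun do rewrite big_cons; exact: pmeasurableM.
apply: psum => s; apply: pmeasurableM; first exact: pmeasurable_cst.
apply: pprod => i k; under eq_fun do rewrite !mxE coefB coefC.
apply: cmeasurableD; first exact: cmeasurable_cst.
apply: cmeasurableN; case: eqP => _; last exact: cmeasurable_cst.
exact: cmeasurable_entry.
Qed.

(** The uniform size bound turns evaluation into a sum whose length does not depend on [U]. *)
Lemma cmeasurable_horner (q : G -> {poly R[i]}) z : pmeasurable q ->
  (forall U, (size (q U) <= n.+1)%N) -> cmeasurable (fun U => (q U).[z]).
Proof.
move=> mq sq.
have -> : (fun U => (q U).[z]) = (fun U => \sum_(i < n.+1) (q U)`_i * z ^+ i).
  by apply/funext => U; exact: horner_coef_wide.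
by apply: cmeasurable_sum => i; apply: cmeasurableM; [exact: mq|exact: cmeasurable_cst].
Qed.

Lemma cmeasurable_logderiv z :
  cmeasurable (fun U : G => logderiv (char_poly (val U)) z).
Proof.
apply: cmeasurableM.
  apply: cmeasurable_horner.
    move=> i; under eq_fun do rewrite coef_deriv -mulr_natr.
    by apply: cmeasurableM; [exact: pmeasurable_char_poly|exact: cmeasurable_cst].
  move=> U; rewrite /poly.deriv; apply: leq_trans (size_poly _ _) _.
  by rewrite size_char_poly.
apply: cmeasurableV; apply: cmeasurable_horner; first exact: pmeasurable_char_poly.
by move=> U; rewrite size_char_poly.
Qed.

End measurable_logderiv.

(** * Characteristic function of the scaled logarithmic derivative *)

Section unitary_characteristic.
Variables (R : realType) (n : nat) (l : R).
Local Notation G := (unitary_group R n).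
Variables (mu : probability G R) (mu_haar : haar mu).
Local Notation s := (l / n%:R).
Hypotheses (l1 : 1 <= l) (s12 : s <= 1 / 2).

Definition scaled_logderiv (U : G) : R[i] :=
  s%:C * logderiv (char_poly (val U)) (1 - s)%:C.

Lemma measurable_scaled_logderiv : cmeasurable scaled_logderiv.
Proof.
by apply: cmeasurableM; [exact: cmeasurable_cst|exact: cmeasurable_logderiv].
Qed.

Let r := 1 - s.

Hypothesis s_gt0 : 0 < s.

Let n0 : 0 < n%:R :> R.
Proof.
rewrite ltr0n lt0n; apply: contraTneq s_gt0 => ->.
by rewrite invr0 mulr0 ltxx.
Qed.

Let r0 : 0 < r. Proof. by rewrite subr_gt0; apply: le_lt_trans s12 _; lra. Qed.
Let r1 : r < 1. Proof. by rewrite /r ltrBlDr ltrDl. Qed.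
Let k := ward_coef r.
Let kE : k = s * (1 + r). Proof. by rewrite /k /ward_coef /r; ring. Qed.
Let k0 : 0 < k. Proof. exact: ward_coef_gt0. Qed.

Let nkl : l <= n%:R * k.
Proof.
rewrite kE mulrA (mulrC n%:R) divfK ?gt_eqF//.
by rewrite ler_peMr ?lerDl ?(ltW r0)// (le_trans ler01).
Qed.

Let nk1 : 1 <= n%:R * k. Proof. exact: le_trans nkl. Qed.

Let sg := s / r.
Let sg0 : 0 < sg. Proof. by rewrite divr_gt0. Qed.
(** From [s <= 1 / 2] comes [r >= 1 / 2], and then [2 (1 + r) r >= 1]. *)
Let sgk : sg <= 2 * k.
Proof.
rewrite /sg ler_pdivrMr// kE; have -> : 2 * (s * (1 + r)) * r = s * (2 * (1 + r) * r) by ring.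
have hr : 1 / 2 <= r by have := s12; rewrite /r; lra.
by rewrite ler_peMr ?(ltW s_gt0)//; nra.
Qed.

Lemma scaled_logderivE U : scaled_logderiv U = - (sg%:C * Num.conj (ctr r U)).
Proof.
rewrite /scaled_logderiv -/r logderiv_unitary// /sg (realCM s).
by ring.
Qed.

Let cV := @cbounded_ctr R n r r0 r1.

Lemma cbounded_scaled_logderiv : cbounded scaled_logderiv.
Proof.
have -> : scaled_logderiv = fun U => - (sg%:C * Num.conj (ctr r U)).
  by apply/funext => U; exact: scaled_logderivE.
apply: cboundedN; apply: cboundedM; first exact: cbounded_cst.
exact: cbounded_conj cV.
Qed.

Lemma scaled_logderiv_moment : expect mu (fun U => sqn (scaled_logderiv U)) <= 80.
Proof.
have -> : (fun U => sqn (scaled_logderiv U)) = fun U => sg ^+ 2 * sqn (ctr r U).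
  apply/funext => U; rewrite scaled_logderivE.
  have -> : sqn (- (sg%:C * Num.conj (ctr r U))) = sqn (sg%:C * Num.conj (ctr r U)).
    by rewrite /sqn ReN ImN !sqrrN.
  by rewrite sqnM sqn_conj; congr (_ * _); rewrite /sqn /= expr0n addr0.
rewrite expectZ; last exact: bounded_sqn.
have [v20 _ _] := ctr_moments r0 r1 mu_haar nk1.
have h : sg ^+ 2 <= 4 * k ^+ 2.
  have -> : 4 * k ^+ 2 = (2 * k) ^+ 2 by ring.
  apply: lerXn2r sgk; rewrite nnegrE; first exact: ltW.
  exact: mulr_ge0 (ler0n _ _) (ltW k0).
have -> : 80 = (4 * k ^+ 2) * (20 * k^-1 ^+ 2) :> R by field; rewrite gt_eqF.
apply: ler_pM => //; first exact: sqr_ge0.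
rewrite -(expect_cst mu 0); apply: le_expect.
- exact: bounded_measurable_cst.
- exact: bounded_sqn.
- by move=> U; exact: sqn_ge0.
Qed.

Lemma unitary_cf (x y al q : R) : q = (x ^+ 2 + y ^+ 2) / 4 ->
  `|expect mu (fun U => cos (x * complex.Re (scaled_logderiv U) +
       y * complex.Im (scaled_logderiv U) + al)) -
    expR (- (2 * q / (2 - s) ^+ 2 / 2)) * cos al| <= stein_const q / l.
Proof.
(* Chosen so that [2 * sg * Re (a V)] is the form with coefficients [x], [y] in the real and
   imaginary parts of [- sg * conj V]. *)
move=> qE; pose a : R[i] := (- x / 2) +i* (- y / 2).
have aq : sqn a = q by rewrite qE /sqn /a /=; field.
have thE U : lin r a sg U = x * complex.Re (scaled_logderiv U) +
    y * complex.Im (scaled_logderiv U).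
  rewrite scaled_logderivE ReN ImN ReCM /lin ImM ImC ReC ReM /=.
  by rewrite !mul0r addr0; field.
have bth : bounded_measurable (@lin R n r a sg).
  have ca := @cbounded_cst _ G R a.
  exact: (bounded_measurableM (@bounded_measurable_cst _ G R (2 * sg))
    (cbounded_Re (cboundedM ca cV))).
have ith2 := integrable_bounded mu (bounded_measurableX 2 bth).
(* [r^2 = 1 - k] gives [k^-2 - k^-1 = (r / k)^2]; with [k = s (1 + r)] and [sg = s / r] everything
   but [(1 + r)^2] cancels. *)
have cE : 2 * sg ^+ 2 * (k^-1 ^+ 2 - k^-1) * sqn a = 2 * q / (2 - s) ^+ 2.
  have -> : 2 - s = 1 + r by rewrite /r; ring.
  have e : k^-1 ^+ 2 - k^-1 = r ^+ 2 / k ^+ 2.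
    have -> : r ^+ 2 = 1 - k by rewrite /k /ward_coef; ring.
    by field; rewrite gt_eqF.
  rewrite aq e kE /sg; field.
  by rewrite !lt0r_neq0//; [exact: lt_le_trans l1|exact: addr_gt0].
have c0 : 0 <= 2 * q / (2 - s) ^+ 2.
  by rewrite divr_ge0 ?sqr_ge0// mulr_ge0// -aq sqn_ge0.
have Q0 : 0 <= stein_const q.
  have q0 : 0 <= q by rewrite -aq sqn_ge0.
  apply: mulr_ge0 (ler0n _ _) _.
  apply: addr_ge0 (mulr_ge0 (ler0n _ _) q0); apply: addr_ge0.
    exact: mulr_ge0 (ler0n _ _) (addr_ge0 q0 ler01).
  apply: mulr_ge0 (ler0n _ _) (addr_ge0 _ (ler0n _ _)).
  exact: mulr_ge0 (ler0n _ _) (exprn_ge0 _ q0).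
have step t : 0 <= t -> t <= 1 ->
    `|expect mu (fun U : G => lin r a sg U * sin (t * lin r a sg U + al)) -
     t * (2 * q / (2 - s) ^+ 2) * expect mu (fun U => cos (t * lin r a sg U + al))|
    <= stein_const q / l.
  move=> t0 t1; have := stein_bound r0 r1 mu_haar nk1 a al t0 t1 sg0 sgk.
  rewrite cE aq => /le_trans; apply.
  apply: ler_wpM2l => //; rewrite -invfM lef_pV2 ?posrE ?mulr_gt0//.
    by rewrite mulrC.
  exact: lt_le_trans l1.
have -> : (fun U => cos (x * complex.Re (scaled_logderiv U) +
    y * complex.Im (scaled_logderiv U) + al)) = fun U => cos (lin r a sg U + al).
  by apply/funext => U; rewrite thE.
exact: (cf_ode (proj1 bth) ith2 c0 step).
Qed.

End unitary_characteristic.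

(** * Characteristic function of the limit *)

Section normal_integral.
Variables (R : realType) (v : R).
Hypothesis v0 : 0 < v.
Let s := Num.sqrt v.
Local Notation lam := (@lebesgue_measure R).
Local Notation N := (normal_prob 0 s).
Local Notation p := (normal_pdf 0 s).

Let s0 : s != 0. Proof. by rewrite gt_eqF// sqrtr_gt0. Qed.

Lemma normal_pdf_sqrt (x : R) : p x = normal_peak s * expR (- (x ^+ 2 / (2 * v))).
Proof.
rewrite normal_pdfE// /normal_fun subr0 sqr_sqrtr ?(ltW v0)// mulNr.
by rewrite mulr_natl.
Qed.

(** The density and the Radon-Nikodym derivative have equal integrals over measurable sets, so they
    agree almost everywhere. *)
Lemma ge0_integral_normal_prob (f : R -> \bar R) : measurable_fun setT f ->
  (forall x, (0 <= f x)%E) ->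
  (\int[N]_x f x = \int[lam]_x (f x * (p x)%:E))%E.
Proof.
move=> mf f0.
have dom : N `<< lam := normal_prob_dominates 0 s.
have fi := Radon_Nikodym_SigmaFinite.f_integrable dom.
have ae : ae_eq lam setT (EFin \o p) (Radon_Nikodym_SigmaFinite.f N lam).
  apply: integral_ae_eq => //.
  - exact: integrable_normal_pdf.
  - exact: measurable_int fi.
  - by move=> A _ mA; rewrite -(Radon_Nikodym_SigmaFinite.f_integral dom mA).
rewrite -(Radon_Nikodym_SigmaFinite.change_of_variables dom f0 measurableT mf).
apply/esym; apply: ge0_ae_eq_integral => //.
- apply: emeasurable_funM => //; apply/measurable_EFinP.
  exact: measurable_normal_pdf.
- by apply: emeasurable_funM => //; exact: measurable_int fi.
- by move=> x _; rewrite mule_ge0// lee_fin normal_pdf_ge0.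
- by move=> x _; rewrite mule_ge0// Radon_Nikodym_SigmaFinite.f_ge0.
- exact: ae_eqe_mul2l.
Qed.

Lemma integrable_normal_prob (f : R -> R) : measurable_fun setT f ->
  lam.-integrable setT (EFin \o (fun x => f x * p x)) ->
  N.-integrable setT (EFin \o f).
Proof.
move=> mf /integrableP[_ ifp]; apply/integrableP; split.
  exact/measurable_EFinP.
rewrite ge0_integral_normal_prob//; last first.
  by apply/measurableT_comp => //; exact/measurable_EFinP.
apply: le_lt_trans ifp; rewrite le_eqVlt; apply/orP; left; apply/eqP.
apply: eq_integral => x _ /=.
by rewrite -EFinM normrM (ger0_norm (normal_pdf_ge0 _ _ _)).
Qed.

Lemma integral_normal_prob (f : R -> R) : measurable_fun setT f ->
  (\int[N]_x (f x)%:E = \int[lam]_x (f x * p x)%:E)%E.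
Proof.
move=> mf; have mef : measurable_fun setT (EFin \o f) by exact/measurable_EFinP.
have p0 x := normal_pdf_ge0 0 s x.
rewrite integralE [RHS]integralE; congr (_ - _)%E.
- rewrite ge0_integral_normal_prob//; last exact: measurable_funepos.
  apply: eq_integral => x _; rewrite !funeposE.
  by rewrite maxe_pMl ?lee_fin// mul0e EFinM.
- rewrite ge0_integral_normal_prob//; last exact: measurable_funeneg.
  apply: eq_integral => x _; rewrite !funenegE.
  by rewrite maxe_pMl ?lee_fin// mul0e EFinM mulNe.
Qed.

Let mp : measurable_fun setT p := measurable_normal_pdf 0 s.

Lemma integrable_sqr_normal_pdf :
  lam.-integrable setT (EFin \o (fun x => x ^+ 2 * p x)).
Proof.
(* Domination by a normal density of twice the variance: with [y = x^2 / (4 v)] half of the exponent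
   is kept, and [y exp(-y) <= 1] disposes of [x^2]. *)
pose s' := Num.sqrt (2 * v).
have s'0 : s' != 0 by rewrite gt_eqF// sqrtr_gt0 mulr_gt0.
have pk0 : 0 < normal_peak s' by exact: normal_peak_gt0.
have i1 : lam.-integrable setT (fun x => (4 * v * normal_peak s / normal_peak s')%:E * (normal_pdf 0 s' x)%:E)%E.
  by apply: integrableZl => //; exact: integrable_normal_pdf.
apply: le_integrable i1 => //.
  by apply/measurable_EFinP; apply: measurable_funM => //; exact: measurable_funX.
move=> x _ /=; rewrite lee_fin.
rewrite ger0_norm; last by rewrite mulr_ge0 ?sqr_ge0 ?normal_pdf_ge0.
apply: le_trans (ler_norm _).
rewrite normal_pdf_sqrt (normal_pdfE _ s'0) /normal_fun subr0 sqr_sqrtr; last first.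
  by rewrite mulr_ge0// ltW.
set y := x ^+ 2 / (4 * v).
have -> : - x ^+ 2 / (2 * v *+ 2) = - y.
  by rewrite /y; field; rewrite gt_eqF.
have -> : - (x ^+ 2 / (2 * v)) = - y + - y by rewrite /y; field; rewrite gt_eqF.
have -> : x ^+ 2 = 4 * v * y by rewrite /y; field; rewrite gt_eqF.
rewrite expRD.
have -> : 4 * v * y * (normal_peak s * (expR (- y) * expR (- y))) =
  4 * v * normal_peak s * expR (- y) * (y * expR (- y)) by ring.
have -> : 4 * v * normal_peak s / normal_peak s' * (normal_peak s' * expR (- y)) =
  4 * v * normal_peak s * expR (- y) * 1 by field; rewrite gt_eqF.
apply: ler_wpM2l.
  by rewrite !mulr_ge0 ?expR_ge0 ?normal_peak_ge0// ltW.
rewrite expRN ler_pdivrMr ?expR_gt0// mul1r.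
by apply: le_trans (expR_ge1Dx y); rewrite lerDr.
Qed.

Let integrable_pdf_dominated (f : R -> R) C : measurable_fun setT f ->
  (forall x, `|f x| <= C * (1 + x ^+ 2)) ->
  lam.-integrable setT (EFin \o (fun x => f x * p x)).
Proof.
move=> mf fC.
have i1 : lam.-integrable setT (fun x => C%:E * ((p x)%:E + (x ^+ 2 * p x)%:E))%E.
  apply: integrableZl => //; apply: integrableD => //.
    exact: integrable_normal_pdf.
  exact: integrable_sqr_normal_pdf.
apply: le_integrable i1 => //.
  by apply/measurable_EFinP; exact: measurable_funM.
move=> x _ /=; rewrite lee_fin; apply: le_trans (ler_norm _).
rewrite normrM (ger0_norm (normal_pdf_ge0 _ _ _)).
have -> : C * (p x + x ^+ 2 * p x) = C * (1 + x ^+ 2) * p x by ring.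
by rewrite ler_wpM2r ?normal_pdf_ge0.
Qed.

Variables (t al : R).
Let u x := x * sin (t * x + al) - t * v * cos (t * x + al).
Let g x := u x * p x.
Let F x := - v * (sin (t * x + al) * p x).

Let mu_ : measurable_fun setT u.
Proof.
have ml : measurable_fun setT (fun x : R => t * x + al).
  by apply: measurable_funD => //; exact: measurable_funM.
apply: measurable_funB; apply: measurable_funM => //.
  by apply: measurableT_comp => //; apply: continuous_measurable_fun; exact: continuous_sin.
by apply: measurableT_comp => //; apply: continuous_measurable_fun; exact: continuous_cos.
Qed.

Let u_le x : `|u x| <= (1 + `|t * v|) * (1 + x ^+ 2).
Proof.
apply: le_trans (ler_normB _ _) _; rewrite !(normrM x) (normrM (t * v)).
have := sin_max (t * x + al); have := cos_max (t * x + al).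
set a := `|cos _|; set b := `|sin _|; set c := `|t * v| => a1 b1.
have x2 : `|x| <= 1 + x ^+ 2.
  by rewrite -(real_normK (num_real x)); have := sqr_ge0 (`|x| - 1); nra.
have h1 : `|x| * b <= (1 + x ^+ 2) * 1 by apply: ler_pM => //; exact: normr_ge0.
have h2 : c * a <= c * (1 + x ^+ 2).
  apply: ler_wpM2l; first exact: normr_ge0.
  by apply: le_trans a1 _; rewrite lerDl sqr_ge0.
have -> : (1 + c) * (1 + x ^+ 2) = (1 + x ^+ 2) * 1 + c * (1 + x ^+ 2) by ring.
exact: lerD.
Qed.

Let ig : lam.-integrable setT (EFin \o g) := integrable_pdf_dominated mu_ u_le.

Let dF x : is_derive x (1 : R) F (g x).
Proof.
have -> : F = fun x => - v * (sin (t * x + al) * (normal_peak s * expR (- (x ^+ 2 / (2 * v))))).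
  by apply/funext => y; rewrite /F normal_pdf_sqrt.
have d1 : is_derive x (1 : R) (fun x => expR (- (x ^+ 2 / (2 * v))))
    (- (x / v) * expR (- (x ^+ 2 / (2 * v)))).
  apply: is_derive_eq; rewrite /GRing.scale/=; field; rewrite gt_eqF//.
have d2 : is_derive x (1 : R) (fun x => sin (t * x + al)) (t * cos (t * x + al)).
  by apply: is_derive_eq; rewrite /GRing.scale/=; ring.
apply: is_derive_eq; rewrite /GRing.scale/= /g /u normal_pdf_sqrt.
by field; rewrite gt_eqF.
Qed.

Let cF : continuous F.
Proof.
move=> x; have [d _] := dF x.
by apply: differentiable_continuous; exact/derivable1_diffP.
Qed.

Let cg : continuous g.
Proof.
move=> x; apply: cvgM; last by apply: continuous_normal_pdf.
have cl : {for x, continuous (fun x : R => t * x + al)}.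
  by apply: cvgD; [apply: cvgM; [exact: cvg_cst|exact: cvg_id]|exact: cvg_cst].
apply: cvgB; apply: cvgM; [exact: cvg_id| |exact: cvg_cst|].
  by apply: (continuous_comp cl); exact: continuous_sin.
by apply: (continuous_comp cl); exact: continuous_cos.
Qed.

Let FTC m : (0 < m)%N ->
  (\int[lam]_(x in `[(- m%:R)%R, m%:R%R]) (g x)%:E = (F m%:R%R - F (- m%:R)%R)%:E)%E.
Proof.
move=> m0; have mm : - m%:R < m%:R :> R by rewrite gtrN ?ltr0n.
rewrite (continuous_FTC2 mm (F := F)) ?EFinB//.
- exact: continuous_subspaceT.
- split=> [x _| |]; first by have [] := dF x.
    by apply: cvg_at_right_filter; exact: cF.
  by apply: cvg_at_left_filter; exact: cF.
- by move=> x _; rewrite derive1E; have [] := dF x.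
Qed.

(** Decay like [1 / |x|] is enough for the boundary terms, and it follows from [exp y >= 1 + y]. *)
Let F_le x : 1 <= `|x| -> `|F x| <= 2 * v ^+ 2 * normal_peak s / `|x|.
Proof.
move=> x1.
rewrite /F normrM normrN (gtr0_norm v0) normrM (ger0_norm (normal_pdf_ge0 _ _ _)).
have x0 : 0 < `|x| by exact: lt_le_trans x1.
have h1 : p x <= normal_peak s * (2 * v / `|x|).
  rewrite normal_pdf_sqrt ler_wpM2l ?normal_peak_ge0//.
  rewrite expRN -[leRHS]invrK lef_pV2 ?posrE ?expR_gt0 ?invr_gt0 ?divr_gt0 ?mulr_gt0//.
  apply: le_trans (expR_ge1Dx _); rewrite invf_div.
  apply: (@le_trans _ _ (x ^+ 2 / (2 * v))); last by rewrite lerDr.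
  rewrite ler_pM2r ?invr_gt0 ?mulr_gt0// -(real_normK (num_real x)) expr2.
  by rewrite ler_peMr// ltW.
have h2 : `|sin (t * x + al)| * p x <= 1 * (normal_peak s * (2 * v / `|x|)).
  by apply: ler_pM => //; [exact: normal_pdf_ge0|exact: sin_max].
have -> : 2 * v ^+ 2 * normal_peak s / `|x| = v * (1 * (normal_peak s * (2 * v / `|x|))) by ring.
by rewrite ler_pM2l.
Qed.

(* [g] is the derivative of [F], which vanishes at infinity. *)
Lemma integral_stein_pdf : (\int[lam]_x (g x)%:E = 0)%E.
Proof.
pose gn m x := ((EFin \o g) \_ `[- m%:R, m%:R]) x.
have mg : measurable_fun setT (EFin \o g) := measurable_int _ ig.
have mgn m : measurable_fun setT (gn m).
  by apply/(measurable_restrictT _ _).1 => //; exact: measurable_funS mg.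
have gn_cvg : {ae lam, forall x, setT x -> gn ^~ x @ \oo --> (EFin \o g) x}.
  apply: aeW => x _; apply: cvg_near_cst; near=> m.
  rewrite /gn patchE ifT// inE/= in_itv/= -ler_norml.
  by near: m; exact: nbhs_infty_ger.
have gn_le : {ae lam, forall x m, setT x -> (`|gn m x| <= `|(g x)%:E|)%E}.
  apply: aeW => x m _; rewrite /gn patchE; case: ifP => // _.
  by rewrite abse0.
have iag : lam.-integrable setT (fun x => `|(g x)%:E|%E) by exact: (integrable_abse ig).
have [_ _ cvg_gn] := @dominated_convergence _ _ R lam setT measurableT gn _ _ mgn mg gn_cvg iag gn_le.
have gnE m : (0 < m)%N -> (\int[lam]_x gn m x = (F m%:R - F (- m%:R)%R)%:E)%E.
  by move=> m0; rewrite -FTC// [RHS]integral_mkcond.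
have cvg0 : (\int[lam]_x gn m x @[m --> \oo] --> 0)%E.
  have h : (F m%:R - F (- m%:R)) @[m --> \oo] --> (0 : R).
    pose C := 4 * v ^+ 2 * normal_peak s.
    apply/cvgrPdist_le => e e0; near=> m.
    have m0 : (0 < m)%N by near: m; exact: nbhs_infty_gt.
    have mR : 0 < m%:R :> R by rewrite ltr0n.
    have m1 : 1 <= `|m%:R : R| by rewrite ger0_norm ?ler1n ?ler0n.
    rewrite sub0r normrN; apply: le_trans (ler_normB _ _) _.
    have Fm := F_le m1.
    have Fn : `|F (- m%:R)| <= 2 * v ^+ 2 * normal_peak s / `|m%:R|.
      by have := @F_le (- m%:R); rewrite normrN; apply.
    apply: (le_trans (lerD Fm Fn)); rewrite ger0_norm; last exact: ltW.
    have -> : 2 * v ^+ 2 * normal_peak s / m%:R + 2 * v ^+ 2 * normal_peak s / m%:R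
      = C / m%:R by rewrite /C; ring.
    rewrite ler_pdivrMr// mulrC -ler_pdivrMr//.
    by near: m; exact: nbhs_infty_ger.
  apply: cvg_EFin; first by near=> m; rewrite gnE//; near: m; exact: nbhs_infty_gt.
  apply: cvg_trans h; apply: near_eq_cvg; near=> m.
  by rewrite /= gnE//; near: m; exact: nbhs_infty_gt.
exact: (cvg_unique _ cvg_gn cvg0).
Unshelve. all: by end_near.
Qed.

Lemma integrable_sqr_normal_prob : N.-integrable setT (EFin \o (fun x => x ^+ 2)).
Proof.
apply: integrable_normal_prob; first exact: measurable_funX.
exact: integrable_sqr_normal_pdf.
Qed.

Lemma normal_prob_stein : expect N u = 0.
Proof. by rewrite /expect /Rintegral integral_normal_prob// integral_stein_pdf. Qed.

End normal_integral.

Section normal_cf.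
Variables (R : realType) (v : R).
Hypothesis v0 : 0 < v.
Local Notation N := (normal_prob 0 (Num.sqrt v)).

(** The normal law satisfies Stein's equation exactly, so [cf_ode] applies with error [0]. *)
Lemma normal_prob_cf xi al : expect N (fun x => cos (xi * x + al)) =
  expR (- (xi ^+ 2 * v / 2)) * cos al.
Proof.
have ith2 : N.-integrable setT (EFin \o (fun x => (xi * x) ^+ 2)).
  have := integrableZl measurableT (xi ^+ 2) (integrable_sqr_normal_prob v0).
  by congr (_.-integrable _ _); apply/funext => x /=; rewrite exprMn EFinM.
apply/eqP; rewrite -subr_eq0 -normr_le0; apply: (cf_ode _ ith2).
- exact: measurable_funM.
- by rewrite mulr_ge0 ?sqr_ge0 ?(ltW v0).
move=> t _ _; rewrite normr_le0 subr_eq0; apply/eqP.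
have ml : measurable_fun setT (fun x : R => (t * xi) * x + al).
  by apply: measurable_funD => //; exact: measurable_funM.
have bc : bounded_measurable (fun x : R => cos ((t * xi) * x + al)).
  by apply: (bounded_measurable_comp ml); [exact: continuous_cos|exact: cos_max].
have ms : measurable_fun setT (fun x : R => sin ((t * xi) * x + al)).
  by apply: measurableT_comp => //; apply: continuous_measurable_fun; exact: continuous_sin.
have ixs : N.-integrable setT (EFin \o (fun x => x * sin (t * xi * x + al))).
  have i1 := finite_measure_integrable_cst N 1 measurableT.
  have i2 : N.-integrable setT (EFin \o (fun x => 1 + x ^+ 2)).
    exact: (integrableD measurableT i1 (integrable_sqr_normal_prob v0)).
  apply: (integrable_dominated _ i2); first exact: measurable_funM.
  move=> x; rewrite normrM; have := sin_max (t * xi * x + al).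
  have := normr_ge0 x; rewrite -(real_normK (num_real x)).
  by have := sqr_ge0 (`|x| - 1); nra.
have := normal_prob_stein v0 (t * xi) al.
have ic : N.-integrable setT (EFin \o (fun x => t * xi * v * cos (t * xi * x + al))).
  by apply: integrable_bounded; apply: bounded_measurableM => //; exact: bounded_measurable_cst.
rewrite {1}/expect RintegralB// -!/(expect _ _) expectZ// => /eqP; rewrite subr_eq0 => /eqP h.
have -> : (fun x : R => cos (t * (xi * x) + al)) = (fun x => cos (t * xi * x + al)).
  by apply/funext => x; rewrite mulrA.
have -> : (fun x : R => xi * x * sin (t * (xi * x) + al)) = (fun x => xi * (x * sin (t * xi * x + al))).
  by apply/funext => x; rewrite !mulrA.
rewrite {1}/expect RintegralZl// -/(expect _ _) h; ring.
Qed.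

End normal_cf.

(** * Independent pairs of normal variables *)

Section joint.
Context d (T : measurableType d) (R : realType) (P : probability T R).
Implicit Types X G H : {RV P >-> R}.

Lemma expect_distribution X (f : R -> R) : bounded_measurable f ->
  expect (distribution P X) f = expect P (fun t => f (X t)).
Proof.
move=> bf; rewrite /expect /Rintegral integral_distribution//.
- by apply/measurable_EFinP; case: bf.
- apply: integrable_bounded; case: bf => mf [M bM].
  by split; [exact: measurableT_comp|exists M => x; exact: bM].
Qed.

(** Independence fixes the joint law on rectangles only; uniqueness of the product measure extends
    this to all sets, and Fubini's theorem splits the integral. *)
Lemma expect_indep G H (f g : R -> R) : independent_rv G H ->
  bounded_measurable f -> bounded_measurable g ->
  expect P (fun t => f (G t) * g (H t)) =
  expect P (fun t => f (G t)) * expect P (fun t => g (H t)).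
Proof.
move=> GH bf bg; rewrite -!expect_distribution//.
have mGH : measurable_fun setT (fun t => (G t, H t)).
  by apply: measurable_fun_pair; exact: measurable_funPT.
pose X : {RV P >-> (R * R)%type} := mfun_Sub (mem_set mGH).
pose h (z : R * R) := f z.1 * g z.2.
have bh : bounded_measurable h.
  case: bf bg => mf [M bM] [mg [K bK]]; split.
    by apply: measurable_funM; exact: measurableT_comp.
  by exists (M * K) => z; rewrite normrM ler_pM.
have prodE A B : measurable A -> measurable B ->
    distribution P X (A `*` B) = (distribution P G A * distribution P H B)%E.
  by move=> mA mB; rewrite -[RHS]GH.
have hE : (\int[distribution P X]_z (h z)%:E = \int[P]_t (h (X t))%:E)%E.
  rewrite integral_distribution//; first by apply/measurable_EFinP; case: bh.
  apply: integrable_bounded; case: bh => mh [M bM].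
  by split; [exact: (measurableT_comp mh mGH)|exists M => x; exact: bM].
transitivity (fine (\int[distribution P G \x distribution P H]_z (h z)%:E)%E).
  rewrite [LHS]/expect /Rintegral; congr fine.
  rewrite -[LHS]hE; apply: eq_measure_integral => A mA _.
  by rewrite [RHS](product_measure_unique prodE).
rewrite -integral12_prod_meas1; last first.
  apply: (@integrable_bounded _ _ _ (distribution P G \x distribution P H)%E).
  exact: bh.
have fubE x : fubini_F (distribution P H) (EFin \o h) x =
    ((expect (distribution P H) g)%:E * (f x)%:E)%E.
  rewrite /fubini_F /h/= muleC; under eq_integral do rewrite EFinM.
  rewrite integralZl//; last exact: integrable_bounded.
  congr (_ * _)%E; rewrite /expect /Rintegral fineK//.
  by apply: integrable_fin_num => //; exact: integrable_bounded.
rewrite (eq_integral (fun x => (expect (distribution P H) g)%:E * (f x)%:E)%E) => [|x _]; last exact: fubE.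
rewrite integralZl//; last exact: integrable_bounded.
rewrite fineM//; first by rewrite mulrC.
by apply: integrable_fin_num => //; exact: integrable_bounded.
Qed.

(* [R] and [measurableTypeR R] have the same measurable sets under different
   displays: the pushforward by the identity leads from one to the other. *)
Lemma expect_normal X v (f : R -> R) : normal_rv X 0 v -> bounded_measurable f ->
  expect P (fun t => f (X t)) = expect (normal_prob 0 (Num.sqrt v)) f.
Proof.
move=> Xn bf; rewrite -expect_distribution// /expect /Rintegral; congr fine.
have mid : measurable_fun setT (id : measurableTypeR R -> R) by [].
have [mf _] := bf.
rewrite (@eq_measure_integral _ _ _ setT (pushforward (normal_prob 0 (Num.sqrt v)) (id : measurableTypeR R -> R))); last first.
  by move=> A mA _; rewrite [LHS]Xn.
rewrite (integral_pushforward mid)//; first by apply/measurable_EFinP.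
by rewrite preimage_setT; apply: integrable_bounded.
Qed.

Lemma integrable_sqr_normal X v : 0 < v -> normal_rv X 0 v ->
  P.-integrable setT (EFin \o (fun t => X t ^+ 2)).
Proof.
move=> v0 Xn; have mX : measurable_fun setT X by exact: measurable_funPT.
have mid : measurable_fun setT (id : measurableTypeR R -> R) by [].
apply/integrableP; split.
  by apply/measurable_EFinP; exact: measurable_funX.
have mq : measurable_fun setT (fun x : R => `|(x ^+ 2)%:E|)%E.
  apply: measurableT_comp => //; apply/measurable_EFinP; exact: measurable_funX.
rewrite -[ltLHS](ge0_integral_distribution X mq)//.
rewrite (@eq_measure_integral _ _ _ setT (pushforward (normal_prob 0 (Num.sqrt v)) (id : measurableTypeR R -> R))); last first.
  by move=> A mA _; rewrite [LHS]Xn.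
rewrite (ge0_integral_pushforward mid)//.
by have := integrable_sqr_normal_prob v0 => /integrableP[_].
Qed.

Lemma normal_pair_cf G H v : 0 < v -> normal_rv G 0 v -> normal_rv H 0 v ->
  independent_rv G H -> forall x y al,
  expect P (fun t => cos (x * G t + y * H t + al)) =
  expR (- ((x ^+ 2 + y ^+ 2) * v / 2)) * cos al.
Proof.
move=> v0 Gn Hn GH x y al.
have bl (c a : R) : bounded_measurable (fun z : R => cos (c * z + a)).
  apply: (@bounded_measurable_comp _ _ _ cos (fun z => c * z + a)).
  - by apply: measurable_funD => //; exact: measurable_funM.
  - exact: continuous_cos.
  - exact: cos_max.
have bL X c a : bounded_measurable (fun t => cos (c * X t + a)).
  have [m1 [M bM]] := bl c a; split; last by exists M => t; exact: bM.
  exact: (measurableT_comp m1).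
have cfX X c a : normal_rv X 0 v ->
    expect P (fun t => cos (c * X t + a)) = expR (- (c ^+ 2 * v / 2)) * cos a.
  by move=> Xn; rewrite (expect_normal Xn (bl c a)) normal_prob_cf.
pose a' := al - pi / 2.
have sinE (z : R) : sin z = cos (z - pi / 2).
  by rewrite cosB cos_pihalf sin_pihalf mulr0 add0r mulr1.
have -> : (fun t => cos (x * G t + y * H t + al)) =
    (fun t => cos (x * G t + 0) * cos (y * H t + al) -
     cos (x * G t + - (pi / 2)) * cos (y * H t + (al - pi / 2))).
  by apply/funext => t; rewrite addr0 -addrA cosD (sinE (x * _)) (sinE (_ + _)) addrA.
rewrite expectB; [|exact: bounded_measurableM..].
(* Sines are cosines shifted by [pi / 2], so [cfX] covers them; the product of sines drops out
   because the mean of [sin (x * G)] has the factor [cos (pi / 2)]. *)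
rewrite !(expect_indep GH (bl _ _) (bl _ _)) !cfX// cos0 cosN cos_pihalf.
rewrite mulr0 mul0r subr0 mulr1 mulrA -expRD; congr (expR _ * _); ring.
Qed.

End joint.

(** * Trigonometric approximation and weak convergence *)

Section approximation.
Variable R : realType.

(* The Bernstein operator, by its one-step recursion: [bern n p phi] is the mean
   of [phi] under the binomial law of parameters [n] and [p]. *)
Fixpoint bern (n : nat) (p : R) (phi : nat -> R) : R :=
  if n is m.+1 then
    p * bern m p (fun k => phi k.+1) + (1 - p) * bern m p phi
  else phi 0%N.

Lemma bern_le n p phi psi : 0 <= p <= 1 -> (forall k, (k <= n)%N -> phi k <= psi k) ->
  bern n p phi <= bern n p psi.
Proof.
move=> /andP[p0 p1]; elim: n phi psi => [|n IH] phi psi le_phi; first exact: le_phi.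
apply: lerD; first by apply: ler_wpM2l => //; apply: IH => k kn; exact: le_phi.
by apply: ler_wpM2l; [rewrite subr_ge0|apply: IH => k kn; exact/le_phi/leqW].
Qed.

Lemma bernD n p phi psi :
  bern n p (fun k => phi k + psi k) = bern n p phi + bern n p psi.
Proof. by elim: n phi psi => //= n IH phi psi; rewrite !IH; ring. Qed.

Lemma bernZ n p c phi : bern n p (fun k => c * phi k) = c * bern n p phi.
Proof. by elim: n phi => //= n IH phi; rewrite !IH; ring. Qed.

Lemma bern_cst n p c : bern n p (fun=> c) = c.
Proof. by elim: n => //= n ->; ring. Qed.

(** The arbitrary centre [c] makes the induction work: a success moves it to [c - 1]. *)
Lemma bern_variance n p c :
  bern n p (fun k => (k%:R - c) ^+ 2) = (n%:R * p - c) ^+ 2 + n%:R * (p * (1 - p)).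
Proof.
elim: n c => [|n IH] c /=; first by rewrite mul0r; ring.
have -> : (fun k : nat => (k.+1%:R - c) ^+ 2) = (fun k => (k%:R - (c - 1)) ^+ 2).
  by apply/funext => k; rewrite -addn1 natrD; congr (_ ^+ 2); ring.
by rewrite !IH -[n.+1]addn1 natrD; ring.
Qed.

Lemma bern_mean_square n p : (0 < n)%N -> 0 <= p <= 1 ->
  bern n p (fun k => (k%:R / n%:R - p) ^+ 2) <= n%:R^-1.
Proof.
move=> n0 /andP[p0 p1]; have nR : n%:R != 0 :> R by rewrite pnatr_eq0 -lt0n.
have -> : (fun k : nat => (k%:R / n%:R - p) ^+ 2) =
    (fun k => n%:R^-1 ^+ 2 * (k%:R - n%:R * p) ^+ 2).
  by apply/funext => k; field.
rewrite bernZ bern_variance subrr expr0n/= add0r.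
have -> : n%:R^-1 ^+ 2 * (n%:R * (p * (1 - p))) = n%:R^-1 * (p * (1 - p)) by field.
by rewrite ler_piMr ?invr_ge0 ?ler0n//; nra.
Qed.

(** Multiplication by a cosine is a constructor, so Bernstein polynomials need no expansion;
    product-to-sum formulas are postponed to [trigpoly_cvg]. The phase [al] supplies the sines. *)
Inductive trigpoly : (R * R -> R) -> Prop :=
| trigpoly1 : trigpoly (fun=> 1)
| trigpolyZ c f : trigpoly f -> trigpoly (fun z => c * f z)
| trigpolyD f g : trigpoly f -> trigpoly g -> trigpoly (fun z => f z + g z)
| trigpolyM x y al f : trigpoly f ->
    trigpoly (fun z => f z * cos (x * z.1 + y * z.2 + al)).

Lemma trigpoly_bern n (p : R * R -> R) (phi : nat -> R * R -> R) :
  (forall f, trigpoly f -> trigpoly (fun z => p z * f z)) ->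
  (forall k, trigpoly (phi k)) ->
  trigpoly (fun z => bern n (p z) (fun k => phi k z)).
Proof.
move=> tp; elim: n phi => [|n IH] phi tphi; first exact: tphi.
rewrite /=; apply: trigpolyD; first by apply: tp; apply: (IH (fun k => phi k.+1)).
have -> : (fun z => (1 - p z) * bern n (p z) (phi^~ z)) =
    (fun z => bern n (p z) (phi^~ z) + -1 * (p z * bern n (p z) (phi^~ z))).
  by apply/funext => z; ring.
by apply: trigpolyD; [|apply: trigpolyZ; apply: tp]; exact: IH.
Qed.

(** Only the first point is confined to the box; the second will be a sample point [G u], which is
    not known to lie there. *)
Lemma unif_continuous_box (f : R * R -> R) M e : continuous f -> 0 < e ->
  exists2 de, 0 < de & forall x y x' y', `|x| <= M -> `|y| <= M ->
    `|x' - x| < de -> `|y' - y| < de -> `|f (x, y) - f (x', y')| <= e.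
Proof.
move=> cf e0.
have cA : compact (`[- M, M]%classic `*` `[- M, M]%classic : set (R * R)).
  by apply: compact_setX; exact: segment_compact.
pose Q (de : R) (z : R * R) := forall z' : R * R,
  `|z'.1 - z.1| < de -> `|z'.2 - z.2| < de -> `|f z - f z'| <= e.
have H : \forall de \near 0^'+, `[- M, M]%classic `*` `[- M, M]%classic `<=` Q de.
  apply: ((compact_near_coveringP _).1 cA R 0^'+ Q _ _) => z _.
  have /cvgrPdist_lt /(_ (e / 2)) := cf z.
  rewrite divr_gt0// => /(_ isT) /nbhs_ballP[r /= r0 fr].
  have fr' z' : `|z'.1 - z.1| < r -> `|z'.2 - z.2| < r -> `|f z - f z'| < e / 2.
    by move=> h1 h2; apply: fr; split; rewrite /ball/= distrC.
  exists (ball z (r / 2), [set de | de < r / 2]) => /=.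
    split; first by apply: nbhsx_ballx; rewrite divr_gt0.
    by apply: nbhs_right_lt; rewrite divr_gt0.
  move=> [z1 de] [/= [b1 b2] de_r] z' h1 h2.
  rewrite /ball/= (distrC z.1) in b1; rewrite /ball/= (distrC z.2) in b2.
  rewrite -(subrK (f z) (f z1)) -addrA (le_trans (ler_normD _ _))//.
  rewrite (splitr e) lerD// ltW//.
    by rewrite distrC; apply: fr'; [apply: lt_trans b1 _|apply: lt_trans b2 _];
       rewrite ltr_pdivrMr// ltr_pMr// ltr1n.
  apply: fr'.
    by rewrite -(subrK z1.1 z'.1) -addrA (le_lt_trans (ler_normD _ _))//; move: h1 b1 de_r => /=; lra.
  by rewrite -(subrK z1.2 z'.2) -addrA (le_lt_trans (ler_normD _ _))//; move: h2 b2 de_r => /=; lra.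
near (0 : R)^'+ => de; exists de => // x y x' y' xM yM hx hy.
have Hde : `[- M, M]%classic `*` `[- M, M]%classic `<=` Q de by near: de.
by apply: (Hde (x, y)) => //=; split; rewrite /= in_itv/= -ler_norml.
Unshelve. all: by end_near.
Qed.

Lemma normr_bern_le n p phi : 0 <= p <= 1 ->
  `|bern n p phi| <= bern n p (fun k => `|phi k|).
Proof.
move=> p01; rewrite ler_norml -mulN1r -bernZ.
apply/andP; split; apply: bern_le => // k _; rewrite ?ler_norm// mulN1r lerNl.
by rewrite -normrN ler_norm.
Qed.

(** By the mean value theorem, since on [[-1, 1]] the cosine is at least [1 - 2 (1/2)^2 = 1/2]. *)
Lemma sin_increasing (a b : R) : `|a| <= 1 -> `|b| <= 1 -> b <= a ->
  a - b <= 2 * (sin a - sin b).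
Proof.
move=> a1 b1 ba.
have dsin x : is_derive x (1 : R) (fun h => sin (b + h)) (cos (b + x)).
  by apply: is_derive_eq; rewrite /GRing.scale/=; ring.
have ab0 : 0 <= a - b by rewrite subr_ge0.
have [c /andP[c0 c1]] := MVT_pos dsin ab0.
rewrite addr0 (addrC b) subrK => ->; rewrite mulrA -[leLHS]mul1r ler_wpM2r//.
have -> : cos (b + c) = 1 - 2 * sin ((b + c) / 2) ^+ 2.
  by rewrite {1}[b + c]splitr -mulr2n cos_mulr2n cos2sin2; ring.
have hs := normr_sin_le ((b + c) / 2).
have bc : `|(b + c) / 2| <= 1 / 2.
  by rewrite normrM [`|2^-1|]ger0_norm// ler_pM2r//; move: a1 b1; rewrite !ler_norml; lra.
have := le_trans hs bc; rewrite -(real_normK (num_real (sin _))).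
set k := `|sin _| => k1; have k0 : 0 <= k by exact: normr_ge0.
by nra.
Qed.

Lemma sin_dist_ge (a b : R) : `|a| <= 1 -> `|b| <= 1 -> `|a - b| <= 2 * `|sin a - sin b|.
Proof.
wlog ba : a b / b <= a => [H a1 b1|a1 b1].
  have [ba|/ltW ab] := leP b a; first exact: H.
  by rewrite distrC (distrC (sin a)); exact: H.
rewrite ger0_norm ?subr_ge0//; apply: le_trans (sin_increasing a1 b1 ba) _.
by rewrite ler_pM2l// ler_norm.
Qed.

(** An arcsine of [2 u - 1] clamped to the range of the sine on [[-1, 1]]. Clamping does not
    increase distances, and [4] is [2] from [sin_dist_ge] times [2] from the rescaling of [u]. *)
Lemma sin_left_inverse : exists g : R -> R, forall u y, `|y| <= 1 ->
  `|g u - y| <= 4 * `|u - (1 + sin y) / 2|.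
Proof.
have n1 : `|1 : R| <= 1 by rewrite normr1.
have m1 : `|-1 : R| <= 1 by rewrite normrN normr1.
have sy (y : R) : `|y| <= 1 -> `|sin y| <= sin 1.
  move=> y1; have := y1; rewrite ler_norml => /andP[y1l y1r].
  have := sin_increasing n1 y1 y1r; have := sin_increasing y1 m1 y1l.
  by rewrite sinN ler_norml; lra.
have s1 : 0 <= sin 1 :> R by apply: le_trans (sy 1 n1); exact: normr_ge0.
have ex u : exists w : R, `|w| <= 1 /\
    sin w = Num.max (- sin 1) (Num.min (sin 1) (2 * u - 1)).
  have [|||w] := @IVT R sin (-1) 1 (Num.max (- sin 1) (Num.min (sin 1) (2 * u - 1))).
  - lra.
  - by apply: continuous_subspaceT; exact: continuous_sin.
  - rewrite sinN (_ : Num.min (- sin 1) _ = - sin 1); last by apply/min_idPl; lra.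
    rewrite (_ : Num.max (- sin 1) (sin 1) = sin 1); last by apply/max_idPr; lra.
    by rewrite le_max lexx/= ge_max ge_min lexx/= andbT; lra.
  by rewrite in_itv/= -ler_norml => w1 sw; exists w.
have [g hg] := choice ex.
exists g => u y y1; have [gu1 sgu] := hg u.
apply: le_trans (sin_dist_ge gu1 y1) _.
have h : `|sin (g u) - sin y| <= `|(2 * u - 1) - sin y|.
  have := sy y y1; rewrite sgu ler_norml => /andP[yl yr].
  case: (leP (sin 1) (2 * u - 1)) => h1.
    by rewrite (max_idPr _) ?ger0_norm; lra.
  case: (leP (- sin 1) (2 * u - 1)) => h2; first exact: lexx.
  by rewrite !ler0_norm; lra.
have -> : u - (1 + sin y) / 2 = 2^-1 * (2 * u - 1 - sin y) by field.
rewrite normrM [`|2^-1|]ger0_norm ?invr_ge0//.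
by move: h; set z1 := `|_|; set z2 := `|_|; lra.
Qed.

(* [q] is the Bernstein polynomial of [f] in the coordinates
   [p x = (1 + sin (x / M)) / 2] and [p y]: these have a Lipschitz left inverse
   on the square of half-side [M], and outside it [2 * B] is a trivial bound. *)
Theorem trigpoly_approx (f : R * R -> R) B M e : continuous f ->
  (forall z, `|f z| <= B) -> 0 < M -> 0 < e ->
  exists2 q, trigpoly q &
    forall z, `|f z - q z| <= e + 2 * B * (z.1 ^+ 2 + z.2 ^+ 2) / M ^+ 2.
Proof.
move=> cf fB M0 e0.
have B0 : 0 <= B by apply: le_trans (fB (0, 0)); exact: normr_ge0.
have [g hg] := sin_left_inverse.
pose p x := (1 + sin (x / M)) / 2.
have p01 x : 0 <= p x <= 1.
  have /andP[h1 h2] : -1 <= sin (x / M) <= 1 by rewrite sin_geN1 sin_le1.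
  by rewrite /p; lra.
have tp (c d : R) h : trigpoly h -> trigpoly (fun z => (1 + sin ((c * z.1 + d * z.2) / M)) / 2 * h z).
  move=> th.
  have -> : (fun z => (1 + sin ((c * z.1 + d * z.2) / M)) / 2 * h z) =
      (fun z => 2^-1 * h z + 2^-1 * (h z * cos (c / M * z.1 + d / M * z.2 + - (pi / 2)))).
    apply/funext => z; rewrite cosBpihalf.
    by have -> : (c * z.1 + d * z.2) / M = c / M * z.1 + d / M * z.2; [ring|field].
  by apply: trigpolyD; apply: trigpolyZ => //; exact: trigpolyM.
pose G u := M * g u.
have hG u x : `|x| <= M -> `|G u - x| <= 4 * M * `|u - p x|.
  move=> xM; have -> : G u - x = M * (g u - x / M) by rewrite /G; field; rewrite gt_eqF.
  have xM1 : `|x / M| <= 1 by rewrite normrM normfV (gtr0_norm M0) ler_pdivrMr// mul1r.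
  rewrite normrM (gtr0_norm M0) mulrAC mulrC ler_pM2r//; exact: hg.
have e20 : 0 < e / 2 by rewrite divr_gt0.
have [de de0 hde] := unif_continuous_box M cf e20.
(* Makes [C * (u - p z) ^+ 2] exceed [2 * B] whenever [G u] is at least [de] away from [z], by
   [hG]. *)
pose C := 2 * B * (16 * M ^+ 2 / de ^+ 2).
have B20 : 0 <= 2 * B by rewrite mulr_ge0.
have C0 : 0 <= C.
  by rewrite mulr_ge0// divr_ge0 ?sqr_ge0// mulr_ge0 ?sqr_ge0 ?ler0n.
(* Each of the two averaged square terms will be at most [C / n]. *)
have [n n0 nC] : exists2 n, (0 < n)%N & 2 * C / n%:R <= e / 2.
  near \oo => n; exists n; first by near: n; exact: nbhs_infty_gt.
  have n0 : 0 < n%:R :> R by rewrite ltr0n; near: n; exact: nbhs_infty_gt.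
  rewrite ler_pdivrMr// (mulrC (e / 2)) -ler_pdivrMr//.
  by near: n; exact: nbhs_infty_ger.
pose F (i j : nat) := f (G (i%:R / n%:R), G (j%:R / n%:R)).
pose q (z : R * R) := bern n (p z.1) (fun i => bern n (p z.2) (F i)).
exists q.
  apply: trigpoly_bern => [h th|i].
    have -> : (fun z : R * R => p z.1 * h z) = (fun z => (1 + sin ((1 * z.1 + 0 * z.2) / M)) / 2 * h z).
      by apply/funext => z; rewrite mul1r mul0r addr0.
    exact: tp.
  apply: (@trigpoly_bern n (fun z => p z.2) (fun j z => F i j)) => [h th|j].
    have -> : (fun z : R * R => p z.2 * h z) = (fun z => (1 + sin ((0 * z.1 + 1 * z.2) / M)) / 2 * h z).
      by apply/funext => z; rewrite mul1r mul0r add0r.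
    exact: tp.
  have -> : (fun=> F i j) = (fun _ : R * R => F i j * 1) by apply/funext => z; rewrite mulr1.
  by apply: trigpolyZ; exact: trigpoly1.
move=> [x y] /=.
have fqE : f (x, y) - q (x, y) = bern n (p x) (fun i => bern n (p y) (fun j => f (x, y) - F i j)).
  have -> : (fun i => bern n (p y) (fun j => f (x, y) - F i j)) =
      (fun i => f (x, y) + -1 * bern n (p y) (F i)).
    apply/funext => i.
    have -> : (fun j => f (x, y) - F i j) = (fun j => f (x, y) + -1 * F i j).
      by apply/funext => j; rewrite mulN1r.
    by rewrite bernD bern_cst bernZ.
  by rewrite bernD bernZ bern_cst mulN1r.
have le_fq (K : nat -> nat -> R) : (forall i j, `|f (x, y) - F i j| <= K i j) ->
    `|f (x, y) - q (x, y)| <= bern n (p x) (fun i => bern n (p y) (K i)).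
  move=> hK; rewrite fqE; apply: le_trans (normr_bern_le _ _ (p01 _)) _.
  apply: bern_le => // i _; apply: le_trans (normr_bern_le _ _ (p01 _)) _.
  exact: bern_le.
have le2B i j : `|f (x, y) - F i j| <= 2 * B.
  by apply: le_trans (ler_normB _ _) _; rewrite mulr_natl mulr2n; apply: lerD; exact: fB.
have [xyM|] := boolP ((`|x| <= M) && (`|y| <= M)); last first.
  move=> xyM; have := le_fq (fun _ _ => 2 * B) le2B.
  rewrite (_ : bern _ _ _ = 2 * B); last by under eq_fun do rewrite bern_cst; rewrite bern_cst.
  move=> /le_trans; apply; rewrite -[leLHS]add0r lerD//; first exact: ltW.
  rewrite -[in leRHS]mulrA -[leLHS]mulr1 ler_wpM2l// ler_pdivlMr ?exprn_gt0// mul1r.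
  rewrite -(real_normK (num_real x)) -(real_normK (num_real y)).
  have := normr_ge0 x; have := normr_ge0 y.
  by move: xyM; rewrite negb_and -!ltNge => /orP[|]; nra.
have /andP[xM yM] := xyM.
(* Chebyshev's argument before averaging: either both sample points are within [de] and uniform
   continuity applies, or one is far and its square term exceeds [2 * B]. *)
have le_fF i j : `|f (x, y) - F i j| <=
    e / 2 + C * (i%:R / n%:R - p x) ^+ 2 + C * (j%:R / n%:R - p y) ^+ 2.
  have far u z : `|z| <= M -> de <= `|G u - z| -> 2 * B <= C * (u - p z) ^+ 2.
    move=> zM h; have h' := le_trans h (hG u z zM).
    rewrite /C -mulrA -[leLHS]mulr1 ler_wpM2l ?mulr_ge0//.
    rewrite mulrAC ler_pdivlMr ?exprn_gt0// mul1r -(real_normK (num_real (u - _))).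
    have -> : 16 * M ^+ 2 * `|u - p z| ^+ 2 = (4 * M * `|u - p z|) ^+ 2 by ring.
    by rewrite lerXn2r ?nnegrE ?(ltW de0)//; exact: le_trans (ltW de0) h'.
  have c1 := mulr_ge0 C0 (sqr_ge0 (i%:R / n%:R - p x)).
  have c2 := mulr_ge0 C0 (sqr_ge0 (j%:R / n%:R - p y)).
  have [d1|d1] := ltP `|G (i%:R / n%:R) - x| de; last first.
    apply: le_trans (le2B i j) _; have := far _ _ xM d1; move: c1 c2.
    by set a := C * _; set b := C * _; lra.
  have [d2|d2] := ltP `|G (j%:R / n%:R) - y| de; last first.
    apply: le_trans (le2B i j) _; have := far _ _ yM d2; move: c1 c2.
    by set a := C * _; set b := C * _; lra.
  apply: le_trans (hde _ _ _ _ xM yM d1 d2) _; move: c1 c2.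
  by set a := C * _; set b := C * _; lra.
apply: le_trans (le_fq _ le_fF) _.
have -> : (fun i : nat => bern n (p y) (fun j => e / 2 + C * (i%:R / n%:R - p x) ^+ 2 + C * (j%:R / n%:R - p y) ^+ 2)) =
  (fun i : nat => (e / 2 + C * bern n (p y) (fun j => (j%:R / n%:R - p y) ^+ 2)) + C * (i%:R / n%:R - p x) ^+ 2).
  by apply/funext => i; rewrite bernD bern_cst bernZ; ring.
rewrite bernD bern_cst bernZ.
have hx := ler_wpM2l C0 (bern_mean_square n0 (p01 x)).
have hy := ler_wpM2l C0 (bern_mean_square n0 (p01 y)).
have xy0 : 0 <= 2 * B * (x ^+ 2 + y ^+ 2) / M ^+ 2.
  by rewrite divr_ge0 ?sqr_ge0// mulr_ge0// addr_ge0 ?sqr_ge0.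
move: hx hy nC xy0; rewrite -mulrA.
set a := C * bern _ _ _; set b := C * bern _ _ _; set c := C / _; set k := _ / M ^+ 2; lra.
Unshelve. all: by end_near.
Qed.

End approximation.

(** * Weak convergence from characteristic functions and second moments *)

Section weak_convergence.
Variable R : realType.
Implicit Types f q : R * R -> R.
Local Notation sq z := (z.1 ^+ 2 + z.2 ^+ 2).

Section one_space.
Context d (T : measurableType d) (P : probability T R) (Z : T -> R * R).
Hypothesis mZ : measurable_fun [set: T] Z.

Let mZ1 : measurable_fun [set: T] (fun t => (Z t).1).
Proof. exact: measurableT_comp mZ. Qed.

Let mZ2 : measurable_fun [set: T] (fun t => (Z t).2).
Proof. exact: measurableT_comp mZ. Qed.

Lemma bounded_measurable_cos_lin x y al :
  bounded_measurable (fun t => cos (x * (Z t).1 + y * (Z t).2 + al)).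
Proof.
apply: (@bounded_measurable_comp _ _ _ cos (fun t => x * (Z t).1 + y * (Z t).2 + al)).
- by apply: measurable_funD => //; apply: measurable_funD; exact: measurable_funM.
- exact: continuous_cos.
- exact: cos_max.
Qed.

Lemma bounded_measurable_trigpoly q : trigpoly q -> bounded_measurable (fun t => q (Z t)).
Proof.
elim=> [|c f _ IH|f g _ IHf _ IHg|x y al f _ IH].
- exact: bounded_measurable_cst.
- by apply: bounded_measurableM => //; exact: bounded_measurable_cst.
- exact: bounded_measurableD.
- by apply: bounded_measurableM => //; exact: bounded_measurable_cos_lin.
Qed.

(** [R * R] carries the product sigma-algebra; measurability of [f] along [Z] is obtained as a
    pointwise limit of trigonometric polynomials on growing boxes. *)
Lemma bounded_measurable_continuous f B : continuous f -> (forall z, `|f z| <= B) ->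
  bounded_measurable (fun t => f (Z t)).
Proof.
move=> cf fB; split; last by exists B => t; exact: fB.
have B0 : 0 <= B by apply: le_trans (fB (0, 0)); exact: normr_ge0.
have ex m : exists q, trigpoly q /\
    forall z, `|f z - q z| <= m.+1%:R^-1 + 2 * B * sq z / m.+1%:R ^+ 2.
  have m0 : 0 < m.+1%:R :> R by rewrite ltr0n.
  have m'0 : 0 < m.+1%:R^-1 :> R by rewrite invr_gt0.
  by have [q tq qf] := trigpoly_approx cf fB m0 m'0; exists q.
have [q hq] := choice ex.
apply: (@measurable_fun_cvg _ _ _ _ (fun m t => q m (Z t))) => [m|t _].
  by have [] := bounded_measurable_trigpoly (hq m).1.
apply/cvgrPdist_le => e e0; near=> m.
apply: (le_trans ((hq m).2 (Z t))).
set s := (Z t).1 ^+ 2 + (Z t).2 ^+ 2; have s0 : 0 <= s by rewrite addr_ge0 ?sqr_ge0.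
have m0 : 0 < m.+1%:R :> R by rewrite ltr0n.
apply: (@le_trans _ _ ((1 + 2 * B * s) / m.+1%:R)).
  rewrite [leRHS]mulrDl mul1r lerD2l ler_wpM2l//; first by rewrite !mulr_ge0.
  by rewrite lef_pV2 ?posrE ?exprn_gt0// expr2 ler_peMl ?ler1n// ltW.
rewrite ler_pdivrMr// (mulrC e) -ler_pdivrMr//.
apply: (@le_trans _ _ m%:R); last by rewrite ler_nat.
by near: m; exact: nbhs_infty_ger.
Unshelve. all: by end_near.
Qed.

Lemma expect_dist_le f q e c K : bounded_measurable (fun t => f (Z t)) ->
  bounded_measurable (fun t => q (Z t)) ->
  P.-integrable setT (EFin \o (fun t => sq (Z t))) ->
  expect P (fun t => sq (Z t)) <= K -> 0 <= c ->
  (forall z, `|f z - q z| <= e + c * sq z) ->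
  `|expect P (fun t => f (Z t)) - expect P (fun t => q (Z t))| <= e + c * K.
Proof.
move=> bf bq isq sqK c0 fq.
have ifq := integrable_bounded P (bounded_measurableD bf (bounded_measurableN bq)).
have ie := finite_measure_integrable_cst P e measurableT.
have ic : P.-integrable setT (EFin \o (fun t => c * sq (Z t))).
  have := integrableZl measurableT c isq.
  by congr (_.-integrable _ _); apply/funext => t /=; rewrite EFinM.
have iec : P.-integrable setT (EFin \o (fun t => e + c * sq (Z t))).
  exact: (integrableD measurableT ie ic).
rewrite -expectB//; apply: le_trans (le_normr_Rintegral measurableT ifq) _.
apply: (@le_trans _ _ (expect P (fun t => e + c * sq (Z t)))).
  by apply: le_Rintegral => //; exact: (integrable_norm ifq).
rewrite /expect RintegralD// RintegralZl//.
have := expect_cst P e; rewrite /expect => ->.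
by rewrite lerD2l ler_wpM2l.
Qed.

End one_space.

Context (d_ : nat -> measure_display) (T_ : forall n, measurableType (d_ n))
  (P_ : forall n, probability (T_ n) R) (Z_ : forall n, T_ n -> R * R)
  d (T : measurableType d) (P : probability T R) (Z : T -> R * R).
Hypothesis mZ_ : forall n, measurable_fun [set: T_ n] (@Z_ n).
Hypothesis mZ : measurable_fun [set: T] Z.
Hypothesis cf_cvg : forall x y al,
  expect (P_ n) (fun t => cos (x * (@Z_ n t).1 + y * (@Z_ n t).2 + al)) @[n --> \oo] -->
  expect P (fun t => cos (x * (Z t).1 + y * (Z t).2 + al)).

Let cvgE (g : R * R -> R) : Prop :=
  expect (P_ n) (fun t => g (@Z_ n t)) @[n --> \oo] --> expect P (fun t => g (Z t)).

Let bmE (g : R * R -> R) :=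
  (forall n, bounded_measurable (fun t => g (@Z_ n t))) /\
  bounded_measurable (fun t => g (Z t)).

Let cvgEZ c g : bmE g -> cvgE g -> cvgE (fun z => c * g z).
Proof.
move=> [bn b] cg; rewrite /cvgE expectZ//.
under eq_cvg => n do rewrite (expectZ _ _ (bn n)).
exact: (cvgM (cvg_cst c) cg).
Qed.

Let cvgED f g : bmE f -> bmE g -> cvgE f -> cvgE g -> cvgE (fun z => f z + g z).
Proof.
move=> [bn b] [bn' b'] cf cg; rewrite /cvgE expectD//.
under eq_cvg => n do rewrite (expectD _ (bn n) (bn' n)).
exact: (cvgD cf cg).
Qed.

(** The extra cosine strengthens the induction: in the case [trigpolyM] two cosines merge into a sum
    of single ones, to which the hypothesis for the smaller polynomial applies. *)
Lemma trigpoly_cvg q : trigpoly q -> forall x y al,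
  cvgE (fun z => q z * cos (x * z.1 + y * z.2 + al)).
Proof.
have bh f x y al : trigpoly f -> bmE (fun z => f z * cos (x * z.1 + y * z.2 + al)).
  move=> tf; split=> [n|]; apply: bounded_measurableM.
  - exact: (bounded_measurable_trigpoly (@mZ_ n)).
  - exact: (bounded_measurable_cos_lin (@mZ_ n)).
  - exact: (bounded_measurable_trigpoly mZ).
  - exact: (bounded_measurable_cos_lin mZ).
elim=> [|c f tf IH|f g tf IHf tg IHg|x' y' al' f tf IH] x y al.
- by under eq_fun do rewrite mul1r; exact: cf_cvg.
- by under eq_fun do rewrite -mulrA; exact: (@cvgEZ c _ (bh _ _ _ _ tf) (IH _ _ _)).
- under eq_fun do rewrite mulrDl.
  exact: (cvgED (bh _ _ _ _ tf) (bh _ _ _ _ tg) (IHf _ _ _) (IHg _ _ _)).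
have -> : (fun z : R * R => f z * cos (x' * z.1 + y' * z.2 + al') * cos (x * z.1 + y * z.2 + al)) =
    (fun z => 2^-1 * (f z * cos ((x' + x) * z.1 + (y' + y) * z.2 + (al' + al)) +
            f z * cos ((x' - x) * z.1 + (y' - y) * z.2 + (al' - al)))).
  apply/funext => z.
  have -> : (x' + x) * z.1 + (y' + y) * z.2 + (al' + al) =
    (x' * z.1 + y' * z.2 + al') + (x * z.1 + y * z.2 + al) by ring.
  have -> : (x' - x) * z.1 + (y' - y) * z.2 + (al' - al) =
    (x' * z.1 + y' * z.2 + al') - (x * z.1 + y * z.2 + al) by ring.
  set u := x' * _ + _ + _; set v := x * _ + _ + _.
  by rewrite (cosD u) (cosB u); field.
have [b1 b1'] := bh f (x' + x) (y' + y) (al' + al) tf.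
have [b2 b2'] := bh f (x' - x) (y' - y) (al' - al) tf.
have b12 : bmE (fun z => f z * cos ((x' + x) * z.1 + (y' + y) * z.2 + (al' + al)) +
    f z * cos ((x' - x) * z.1 + (y' - y) * z.2 + (al' - al))).
  by split=> [n|]; exact: bounded_measurableD.
apply: (cvgEZ b12).
exact: (cvgED (conj b1 b1') (conj b2 b2') (IH _ _ _) (IH _ _ _)).
Qed.

Variable K : R.
Hypothesis Z_K : \forall n \near \oo,
  (P_ n).-integrable setT (EFin \o (fun t => sq (@Z_ n t))) /\
  expect (P_ n) (fun t => sq (@Z_ n t)) <= K.
Hypothesis iZ : P.-integrable setT (EFin \o (fun t => sq (Z t))).
Hypothesis Z_le : expect P (fun t => sq (Z t)) <= K.

Theorem weak_cvg_cf f B : continuous f -> (forall z, `|f z| <= B) ->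
  expect (P_ n) (fun t => f (@Z_ n t)) @[n --> \oo] --> expect P (fun t => f (Z t)).
Proof.
move=> cf fB; apply/cvgrPdist_le => e e0.
have B0 : 0 <= B by apply: le_trans (fB (0, 0)); exact: normr_ge0.
have K0 : 0 <= K.
  apply: le_trans Z_le; apply: Rintegral_ge0 => t _.
  by rewrite addr_ge0 ?sqr_ge0.
have BKe : 0 <= 16 * B * K / e by rewrite divr_ge0 ?(ltW e0)// !mulr_ge0.
(* [M ^+ 2 >= M >= 16 * B * K / e] gives [c * K <= e / 8]. Two approximation errors of
   [e / 8 + e / 8] and [e / 2] for [q] add up to [e]. *)
pose M := 1 + 16 * B * K / e.
have M1 : 1 <= M by rewrite lerDl.
have M0 : 0 < M by exact: lt_le_trans M1.
have e80 : 0 < e / 8 by rewrite divr_gt0.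
have [q tq fq] := trigpoly_approx cf fB M0 e80.
pose c := 2 * B / M ^+ 2.
have c0 : 0 <= c by rewrite divr_ge0 ?sqr_ge0// mulr_ge0.
have fq' z : `|f z - q z| <= e / 8 + c * sq z.
  by apply: le_trans (fq z) _; rewrite /c (mulrAC (2 * B)).
have cK : c * K <= e / 8.
  rewrite /c mulrAC ler_pdivrMr ?exprn_gt0//.
  have h : 16 * B * K / e <= M ^+ 2.
    apply: (@le_trans _ _ M); first by rewrite lerDr.
    by rewrite expr2 ler_peMr// ltW.
  by move: h; rewrite ler_pdivrMr//; set m := M ^+ 2; lra.
have : cvgE q.
  have -> : q = (fun z => q z * cos (0 * z.1 + 0 * z.2 + 0)).
    by apply/funext => z; rewrite !mul0r !addr0 cos0 mulr1.
  exact: trigpoly_cvg.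
move=> /cvgrPdist_le /(_ (e / 2)); rewrite divr_gt0// => /(_ isT) q_cvg.
near=> n.
have [isq sqK] : (P_ n).-integrable setT (EFin \o (fun t => sq (@Z_ n t))) /\
  expect (P_ n) (fun t => sq (@Z_ n t)) <= K by near: n.
have bq := bounded_measurable_trigpoly (@mZ_ n) tq.
have bq' := bounded_measurable_trigpoly mZ tq.
have bf := bounded_measurable_continuous (@mZ_ n) cf fB.
have bf' := bounded_measurable_continuous mZ cf fB.
have h1 := expect_dist_le bf bq isq sqK c0 fq'.
have h2 := expect_dist_le bf' bq' iZ Z_le c0 fq'.
have h3 : `|expect P (fun t => q (Z t)) - expect (P_ n) (fun t => q (@Z_ n t))| <= e / 2.
  by near: n.
move: h1 h2 h3 cK; rewrite !ler_norml.
set a1 := expect P _; set a2 := expect P _; set a3 := expect (P_ n) _; set a4 := expect (P_ n) _.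
move=> /andP[? ?] /andP[? ?] /andP[? ?] ?; lra.
Unshelve. all: by end_near.
Qed.

End weak_convergence.

(** * Convergence in law of the scaled logarithmic derivative *)

Theorem theorem1p2 (R : realType) (L : nat -> R)
    (L_infty : L N @[N --> \oo] --> +oo)
    (L_o : L =o_\oo (fun N : nat => N%:R : R))
    (mu : forall N : nat, probability (unitary_group R N) R)
    (mu_haar : forall N : nat, haar (mu N))
    (d : measure_display) (T : measurableType d) (P : probability T R)
    (G H : {RV P >-> R})
    (G_normal : normal_rv G 0 (1 / 8)) (H_normal : normal_rv H 0 (1 / 8))
    (GH_indep : independent_rv G H) :
  cvg_in_distribution mu
    (fun (N : nat) (U : unitary_group R N) =>
       let w := (L N / N%:R)%:C *
                logderiv (char_poly (val U)) (1 - L N / N%:R)%:C in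
       (complex.Re w, complex.Im w))
    P (fun t => (G t, H t)).
Proof.
pose Z N (U : unitary_group R N) := (complex.Re (@scaled_logderiv R N (L N) U),
  complex.Im (@scaled_logderiv R N (L N) U)).
have mZ N : measurable_fun [set: unitary_group R N] (@Z N).
  by have [mr mi] := @measurable_scaled_logderiv R N (L N); exact: measurable_fun_pair.
have mGH : measurable_fun [set: T] (fun t => (G t, H t)).
  by apply: measurable_fun_pair; exact: measurable_funPT.
pose s N := L N / N%:R.
have s_le e : 0 < e -> \forall N \near \oo, `|s N| <= e.
  move=> e0; move/eqoP : L_o => /(_ e e0) Le; near=> N.
  have N0 : 0 < N%:R :> R by rewrite ltr0n; near: N; exact: nbhs_infty_gt.
  rewrite normrM normfV (gtr0_norm N0) ler_pdivrMr//.
  by rewrite -[X in e * X](gtr0_norm N0); near: N.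
have s_cvg0 : s N @[N --> \oo] --> 0.
  apply/cvgrPdist_le => e e0; near=> N; rewrite sub0r normrN.
  by near: N; exact: s_le.
have good : \forall N \near \oo, [/\ 1 <= L N, s N <= 1 / 2 & 0 < s N].
  near=> N.
  have N0 : 0 < N%:R :> R by rewrite ltr0n; near: N; exact: nbhs_infty_gt.
  have L1 : 1 <= L N by near: N; exact: (cvgryPge _).1.
  split=> //; last by rewrite divr_gt0// (lt_le_trans ltr01).
  by apply: le_trans (ler_norm _) _; near: N; apply: s_le.
have v0 : 0 < 1 / 8 :> R by rewrite divr_gt0.
have cf_cvg x y al :
    expect (mu N) (fun U => cos (x * (Z N U).1 + y * (Z N U).2 + al)) @[N --> \oo] -->
    expect P (fun t => cos (x * G t + y * H t + al)).
  rewrite (normal_pair_cf v0)//.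
  pose q := (x ^+ 2 + y ^+ 2) / 4.
  (* [unitary_cf] compares with a normal law whose variance still depends on [N] through [s]; at
     [s = 0] one has [2 * q / 4 = (x^2 + y^2) / 8]. *)
  have b_cvg : expR (- (2 * q / (2 - s N) ^+ 2 / 2)) * cos al @[N --> \oo] -->
      expR (- ((x ^+ 2 + y ^+ 2) * (1 / 8) / 2)) * cos al.
    have -> : (x ^+ 2 + y ^+ 2) * (1 / 8) / 2 = 2 * q / (2 - 0) ^+ 2 / 2.
      by rewrite /q subr0; field.
    have c1 : 2 - s N @[N --> \oo] --> (2 - 0 : R).
      by apply: cvgB => //; exact: cvg_cst.
    have c2 : (2 - s N) ^+ 2 @[N --> \oo] --> (2 - 0 : R) ^+ 2.
      by under eq_cvg do rewrite expr2; rewrite expr2; apply: cvgM.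
    have c3 : ((2 - s N) ^+ 2)^-1 @[N --> \oo] --> ((2 - 0 : R) ^+ 2)^-1.
      by apply: cvgV => //; rewrite subr0 expf_neq0.
    have c4 : - (2 * q / (2 - s N) ^+ 2 / 2) @[N --> \oo] --> - (2 * q / (2 - 0) ^+ 2 / 2).
      apply: cvgN; apply: cvgM; last exact: cvg_cst.
      by apply: cvgM => //; exact: cvg_cst.
    apply: cvgM; last exact: cvg_cst.
    exact: (continuous_cvg _ (@continuous_expR R _) c4).
  apply/cvgrPdist_le => e e0.
  have e20 : 0 < e / 2 by rewrite divr_gt0.
  move/cvgrPdist_le : b_cvg => /(_ _ e20) b_near.
  near=> N.
  have [L1 s12 s0] : [/\ 1 <= L N, s N <= 1 / 2 & 0 < s N] by near: N.
  have h1 := unitary_cf (mu_haar N) L1 s12 s0 al (erefl q).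
  have h2 : stein_const q / L N <= e / 2.
    have L0 : 0 < L N by exact: lt_le_trans L1.
    rewrite ler_pdivrMr// (mulrC (e / 2)) -ler_pdivrMr//.
    by near: N; exact: (cvgryPge _).1.
  have h3 : `|expR (- ((x ^+ 2 + y ^+ 2) * (1 / 8) / 2)) * cos al -
     expR (- (2 * q / (2 - s N) ^+ 2 / 2)) * cos al| <= e / 2 by near: N.
  rewrite (splitr e) -[X in `|X|](subrKA (expR (- (2 * q / (2 - s N) ^+ 2 / 2)) * cos al)).
  apply: le_trans (ler_normD _ _) _; apply: lerD => //.
  by rewrite distrC; exact: le_trans h1 h2.
split=> // f cf [B fB].
have iGH : P.-integrable setT (EFin \o (fun t => G t ^+ 2 + H t ^+ 2)).
  have := integrableD measurableT (integrable_sqr_normal v0 G_normal) (integrable_sqr_normal v0 H_normal).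
  by congr (_.-integrable _ _).
have bf N : bounded_measurable (fun U => f (Z N U)).
  exact: bounded_measurable_continuous cf fB.
have bf' : bounded_measurable (fun t => f (G t, H t)).
  exact: (bounded_measurable_continuous mGH cf fB).
rewrite (expectE P bf'); under eq_cvg => N do rewrite (expectE (mu N) (bf N)).
apply: cvg_EFin; first by near=> N.
(* A common bound for the second moments of the limit and, for large [N], of the sequence. *)
pose K := Num.max 80 (expect P (fun t => G t ^+ 2 + H t ^+ 2)).
apply: (@weak_cvg_cf _ _ _ mu Z _ _ P (fun t => (G t, H t)) mZ mGH cf_cvg K _ iGH _ f B cf fB).
  near=> N.
  have [L1 s12 s0] : [/\ 1 <= L N, s N <= 1 / 2 & 0 < s N] by near: N.
  split; last by rewrite le_max (scaled_logderiv_moment (mu_haar N) L1 s12 s0).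
  exact: (integrable_bounded (mu N) (bounded_sqn (cbounded_scaled_logderiv s12 s0))).
by rewrite le_max lexx orbT.
Unshelve. all: by end_near.
Qed.
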